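(* Let $\mathbb{F}$ be $\mathbb{R}$, $\mathbb{C}$ or $\mathbb{H}$. Let $V$ be a real algebraic variety and let $X\subseteq V$ be a compact locally contractible subset. Then there exists a stratification $\mathcal{S}$ of $V$ such that each topological $\mathbb{F}$-vector bundle on $X$ is topologically isomorphic to a piecewise $\mathcal{S}$-algebraic $\mathbb{F}$-vector bundle on $X$, which is uniquely determined up to piecewise $\mathcal{S}$-algebraic isomorphism.
   Context: A real algebraic variety is a locally ringed space isomorphic to an algebraic subset of $\mathbb{R}^m$ (for some $m$) endowed with the Zariski topology and the sheaf of real-valued regular functions; its morphisms are called regular maps. All topological notions refer to the Euclidean topology unless ''Zariski'' is specified. A stratification of $V$ is a finite collection of pairwise disjoint Zariski locally closed subvarieties of $V$ (some possibly empty) whose union is $V$. $\mathbb{F}$-vector spaces are left vector spaces ($\mathbb{H}$ denotes the quaternions). For a space $X$, $\varepsilon_X^n(\mathbb{F})$ is the product $\mathbb{F}$-vector bundle with total space $X\times\mathbb{F}^n$. If $Z_0$ is a real algebraic variety, an algebraic $\mathbb{F}$-vector subbundle of $\varepsilon_{Z_0}^n(\mathbb{F})$ has its usual meaning (a subbundle which, Zariski locally on $Z_0$, has a frame consisting of regular sections), and algebraic morphisms between such bundles are the bundle morphisms that are regular maps of total spaces. Let $X\subseteq V$ be any subset with Zariski closure $Z$ in $V$. An algebraic $\mathbb{F}$-vector bundle on $X$ (algebraic $\mathbb{F}$-vector subbundle of $\varepsilon_X^n(\mathbb{F})$) is a topological $\mathbb{F}$-vector subbundle $\xi$ of $\varepsilon_X^n(\mathbb{F})$,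 for some $n$, for which there exist a Zariski open neighborhood $Z_0\subseteq Z$ of $X$ and an algebraic $\mathbb{F}$-vector subbundle $\tilde\xi$ of $\varepsilon_{Z_0}^n(\mathbb{F})$ with $\tilde\xi|_X=\xi$; the pair $(Z_0,\tilde\xi)$ is called an algebraic extension of $\xi$. An algebraic morphism $\varphi\colon\xi\to\eta$ of algebraic $\mathbb{F}$-vector bundles on $X$ is a topological morphism for which there exist algebraic extensions $(Z_0,\tilde\xi)$, $(Z_0,\tilde\eta)$ and an algebraic morphism $\tilde\varphi\colon\tilde\xi\to\tilde\eta$ restricting to $\varphi$ over $X$. For a stratification $\mathcal{S}$ of $V$, a piecewise $\mathcal{S}$-algebraic $\mathbb{F}$-vector bundle on $X$ is a topological $\mathbb{F}$-vector subbundle $\xi$ of $\varepsilon_X^n(\mathbb{F})$, for some $n$, such that for every $S\in\mathcal{S}$ and each connected component $\Sigma$ of $X\cap S$ the restriction $\xi|_\Sigma$ is an algebraic $\mathbb{F}$-vector subbundle of $\varepsilon_\Sigma^n(\mathbb{F})$. A piecewise $\mathcal{S}$-algebraic morphism of such bundles is a topological morphism whose restriction over each such $\Sigma$ is an algebraic morphism. These form a category; a piecewise $\mathcal{S}$-algebraic isomorphism is an isomorphism in it. *)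

(* Defs.v *)
From HB Require Import structures.
From mathcomp Require Import all_boot all_order all_algebra.
From mathcomp Require Import ring complex.
From mathcomp Require Import all_classical all_reals all_analysis.
From mathcomp Require mpoly.

Set Implicit Arguments.
Unset Strict Implicit.
Unset Printing Implicit Defensive.

Import Order.TTheory GRing.Theory Num.Theory.
Import numFieldNormedType.Exports.

Local Open Scope classical_set_scope.
Local Open Scope ring_scope.

(* [Quat a b c d] is a + b i + c j + d k. *)
Record quaternion (R : Type) :=
  Quat { quat1 : R; quati : R; quatj : R; quatk : R }.

Section QuaternionRing.
Context (R : realType).
Local Notation H := (quaternion R).

Definition quat_tuple (x : H) : R * R * R * R :=
  (quat1 x, quati x, quatj x, quatk x).
Definition tuple_quat (t : R * R * R * R) : H :=
  Quat t.1.1.1 t.1.1.2 t.1.2 t.2.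

Lemma quat_tupleK : cancel quat_tuple tuple_quat.
Proof. by case. Qed.

HB.instance Definition _ := Choice.copy H (can_type quat_tupleK).

Definition quat_add (x y : H) : H :=
  Quat (quat1 x + quat1 y) (quati x + quati y)
       (quatj x + quatj y) (quatk x + quatk y).
Definition quat_opp (x : H) : H :=
  Quat (- quat1 x) (- quati x) (- quatj x) (- quatk x).
Definition quat_mul (x y : H) : H :=
  let: Quat a b c d := x in let: Quat a' b' c' d' := y in
  Quat (a * a' - b * b' - c * c' - d * d')
       (a * b' + b * a' + c * d' - d * c')
       (a * c' - b * d' + c * a' + d * b')
       (a * d' + b * c' - c * b' + d * a').

Fact quat_addA : associative quat_add.
Proof. by move=> [????] [????] [????]; rewrite /quat_add /= !addrA. Qed.
Fact quat_addC : commutative quat_add.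
Proof. by move=> [????] [????]; congr Quat; rewrite /= addrC. Qed.
Fact quat_add0 : left_id (Quat 0 0 0 0) quat_add.
Proof. by move=> [????]; rewrite /quat_add /= !add0r. Qed.
Fact quat_addN : left_inverse (Quat 0 0 0 0) quat_opp quat_add.
Proof. by move=> [????]; rewrite /quat_add /= !addNr. Qed.

HB.instance Definition _ :=
  GRing.isZmodule.Build H quat_addA quat_addC quat_add0 quat_addN.

Fact quat_mulA : associative quat_mul.
Proof. by move=> [????] [????] [????]; congr Quat; ring. Qed.
Fact quat_mul1 : left_id (Quat 1 0 0 0) quat_mul.
Proof. by move=> [????]; congr Quat; ring. Qed.
Fact quat_mulr1 : right_id (Quat 1 0 0 0) quat_mul.
Proof. by move=> [????]; congr Quat; ring. Qed.
Fact quat_mulDl : left_distributive quat_mul +%R.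
Proof. by move=> [????] [????] [????]; congr Quat; rewrite /=; ring. Qed.
Fact quat_mulDr : right_distributive quat_mul +%R.
Proof. by move=> [????] [????] [????]; congr Quat; rewrite /=; ring. Qed.
Fact quat_1neq0 : Quat 1 0 0 0 != 0 :> H.
Proof. by apply/eqP => -[] /eqP; rewrite oner_eq0. Qed.

HB.instance Definition _ := GRing.Zmodule_isNzRing.Build H
  quat_mulA quat_mul1 quat_mulr1 quat_mulDl quat_mulDr quat_1neq0.

End QuaternionRing.

Inductive scalar_kind := RealF | ComplexF | QuaternionF.

Definition scalar_ring (R : realType) (K : scalar_kind) : nzRingType :=
  match K with
  | RealF => R
  | ComplexF => R[i]
  | QuaternionF => quaternion R
  end.

Definition real_dim (K : scalar_kind) : nat :=
  match K with RealF => 1 | ComplexF => 2 | QuaternionF => 4 end.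

(* The space F, for F = R, C, H.  Its Euclidean topology and its structure of
   real algebraic variety are those of R^1, R^2, R^4 through [real_coord]. *)
Definition scalars (R : realType) (K : scalar_kind) : Type := scalar_ring R K.

HB.instance Definition _ (R : realType) (K : scalar_kind) :=
  GRing.NzRing.copy (scalars R K) (scalar_ring R K).

Definition real_coord (R : realType) (K : scalar_kind) :
    scalars R K -> 'rV[R]_(real_dim K) :=
  match K with
  | RealF => fun z => \row_(l < 1) z
  | ComplexF => fun z => \row_(l < 2) [:: complex.Re z; complex.Im z]`_l
  | QuaternionF => fun z =>
      \row_(l < 4) [:: quat1 z; quati z; quatj z; quatk z]`_l
  end.

HB.instance Definition _ (R : realType) (K : scalar_kind) :=
  Topological.copy (scalars R K) (initial_topology (@real_coord R K)).

Definition real_vec_coord (R : realType) (K : scalar_kind) (n : nat)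
    (v : 'rV[scalars R K]_n) : 'rV[R]_(n * real_dim K) :=
  mxvec (\matrix_(i < n, l < real_dim K) real_coord (v ord0 i) ord0 l).

(* A Zariski topology together with a sheaf of real-valued functions; f is a
   section over U when [fs_reg U f], and only its values on U matter.  The
   axioms of a topology and of a sheaf are not fields: they follow from
   [real_variety]. *)
Record funspace (R : realType) := FunSpace {
  fs_car :> Type;
  fs_zopen : set (set fs_car);
  fs_reg : set fs_car -> set (fs_car -> R) }.

Section Zariski.
Context (R : realType) (V : funspace R).

Definition zclosed (C : set V) := fs_zopen (~` C).

Definition zclosure (X : set V) : set V :=
  \bigcap_(C in [set C | zclosed C /\ X `<=` C]) C.

Definition zlocally_closed (S : set V) :=
  exists U C, [/\ fs_zopen U, zclosed C & S = U `&` C].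

(* Sections over a subspace W of the restricted sheaf. *)
Definition regular_on (W : set V) (f : V -> R) :=
  forall x, W x -> exists U g, [/\ fs_zopen U, U x, fs_reg U g &
    forall y, W y -> U y -> f y = g y].

Definition stratification (SS : set (set V)) :=
  [/\ finite_set SS, (forall S, SS S -> zlocally_closed S),
      trivIset SS id & \bigcup_(S in SS) S = setT].

End Zariski.

(* The Zariski topology and the sheaf of regular functions on T determined by
   an algebra A of global functions: closed sets are the common zero loci of
   subsets of A, regular functions are locally quotients of elements of A. *)
Definition algebra_zopen (R : realType) (T : Type) (A : set (T -> R)) :
    set (set T) :=
  [set U | exists2 P, P `<=` A & U = ~` [set x | forall p, P p -> p x = 0]].

Definition algebra_space (R : realType) (T : Type) (A : set (T -> R)) :
    funspace R :=
  @FunSpace R T (algebra_zopen A)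
    (fun U => [set f | forall x, U x -> exists W p q,
       [/\ algebra_zopen A W, W x, A p, A q &
         forall y, W y -> U y -> q y != 0 /\ f y = p y / q y]]).

Definition poly_eval (R : realType) (m : nat) (p : mpoly.mpoly m R)
    (x : 'rV[R]_m) : R :=
  mpoly.meval (fun i => x ord0 i) p.

Definition affine_space (R : realType) (m : nat) : funspace R :=
  algebra_space [set f | exists p : mpoly.mpoly m R, f = poly_eval p].

(* V is isomorphic, through phi, to the algebraic set [range phi] of R^m with
   its Zariski topology and its sheaf of regular functions.  As phi is
   injective, every function on V has the form g \o phi. *)
Definition real_variety (R : realType) (V : funspace R) :=
  exists m (phi : V -> affine_space R m),
    [/\ injective phi, zclosed (range phi),
        (forall U, fs_zopen U <-> exists2 W, fs_zopen W & U = phi @^-1` W) &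
        (forall U (g : affine_space R m -> R), fs_zopen U ->
           (fs_reg U (g \o phi) <-> regular_on (phi @` U) g))].

(* The Euclidean topology of V: the coarsest one for which all regular
   functions V -> R are continuous.  For an algebraic subset of R^m this is the
   topology induced by that of R^m. *)
Definition regular_eval (R : realType) (V : funspace R) (x : V) :
    {ptws {f : V -> R | fs_reg setT f} -> R} := fun f => sval f x.

HB.instance Definition _ (R : realType) (V : funspace R) :=
  gen_eqMixin (fs_car V).
HB.instance Definition _ (R : realType) (V : funspace R) :=
  gen_choiceMixin (fs_car V).
HB.instance Definition _ (R : realType) (V : funspace R) :=
  Topological.copy (fs_car V) (initial_topology (@regular_eval R V)).

(* Borsuk's notion: each neighborhood U of x in X contains a neighborhood of x
   in X which is contractible in U. *)
Definition locally_contractible (R : realType) (T : topologicalType)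
    (X : set T) :=
  forall x U, X x -> nbhs x U -> exists W (H : T * R -> T) c,
    [/\ nbhs x W, W `<=` U,
        {within (W `&` X) `*` `[0, 1], continuous H} &
        forall y, W y -> X y -> [/\ H (y, 0) = y, H (y, 1) = c &
          forall t, t \in `[0, 1] -> (U `&` X) (H (y, t))]].

(* Families of F-vector spaces over B.  The total space is a topological space
   in bijection with the set of pairs (b, v) with v in the fibre over b.  A
   topological F-vector bundle on B is a family which is [locally_trivial];
   continuity of the fibrewise operations follows from local triviality. *)
Record vfamily (R : realType) (K : scalar_kind) (B : topologicalType) :=
  VFamily {
    vf_fib : B -> lmodType (scalars R K);
    vf_total : topologicalType;
    vf_enc : {b & vf_fib b} -> vf_total;
    vf_dec : vf_total -> {b & vf_fib b};
    vf_encK : cancel vf_enc vf_dec;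
    vf_decK : cancel vf_dec vf_enc;
    vf_proj_continuous : continuous (fun e => tag (vf_dec e) : B) }.

Section Bundles.
Context (R : realType) (K : scalar_kind) (B : topologicalType).
Local Notation F := (scalars R K).
Implicit Types E : vfamily R K B.

Definition vf_proj E (e : vf_total E) : B := tag (vf_dec e).
Definition vf_vec E (e : vf_total E) : vf_fib E (vf_proj e) :=
  tagged (vf_dec e).
Definition vf_point E b (v : vf_fib E b) : vf_total E :=
  vf_enc (existT _ b v).

(* Near each point, E is homeomorphic to a product U x F^k by fibrewise linear
   maps h, with inverses g.  The rank k may depend on the point. *)
Definition locally_trivial E :=
  forall b0, exists (U : set B) (k : nat)
      (h : forall b, vf_fib E b -> 'rV[F]_k)
      (g : forall b, 'rV[F]_k -> vf_fib E b),
    [/\ open_nbhs b0 U,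
        forall b, U b -> [/\ linear (h b), cancel (h b) (g b) &
          cancel (g b) (h b)],
        {within @vf_proj E @^-1` U, continuous (fun e => h _ (vf_vec e))} &
        {within U `*` setT,
          continuous (fun p : B * 'rV[F]_k => vf_point (g p.1 p.2))}].

Definition top_morphism E E' (phi : forall b, vf_fib E b -> vf_fib E' b) :=
  (forall b, linear (phi b)) /\
  continuous (fun e : vf_total E => vf_point (phi _ (vf_vec e))).

Definition top_isomorphic E E' :=
  exists (phi : forall b, vf_fib E b -> vf_fib E' b)
         (psi : forall b, vf_fib E' b -> vf_fib E b),
    [/\ top_morphism phi, top_morphism psi,
        forall b, cancel (phi b) (psi b) & forall b, cancel (psi b) (phi b)].

End Bundles.

Section Fibre.
Context (F : nzRingType) (n : nat) (W : submodClosed 'rV[F]_n).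

Record fibre := Fibre { fibre_val : 'rV[F]_n; _ : fibre_val \in W }.

HB.instance Definition _ := [isSub for fibre_val].
HB.instance Definition _ := [Choice of fibre by <:].
HB.instance Definition _ := [SubChoice_isSubLmodule of fibre by <:].

End Fibre.

Section Subbundles.
Context (R : realType) (K : scalar_kind) (V : funspace R).
Local Notation F := (scalars R K).

(* A family of F-subspaces of the product bundle with fibre F^n over X is
   encoded by xi : V -> submodClosed 'rV[F]_n; the values of xi off X are
   irrelevant, so that xi is also its own restriction to any subset of X. *)
Section Subfamily.
Context (n : nat) (xi : V -> submodClosed 'rV[F]_n) (X : set V).

Definition subfamily_incl
    (u : {b : set_type X & fibre (xi (set_val b))}) : V * 'rV[F]_n :=
  (set_val (tag u), fibre_val (tagged u)).

Fact subfamily_proj_continuous :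
  continuous (fun u : initial_topology subfamily_incl => tag u : set_type X).
Proof.
apply: continuous_comp_initial => u.
apply: (@continuous_comp (initial_topology subfamily_incl) (V * 'rV[F]_n)%type
  V subfamily_incl fst); first exact: initial_continuous.
exact: cvg_fst.
Qed.

Definition subfamily : vfamily R K (set_type X) :=
  @VFamily R K (set_type X) (fun b => fibre (xi (set_val b)))
    (initial_topology subfamily_incl) id id
    (fun=> erefl) (fun=> erefl) subfamily_proj_continuous.

End Subfamily.

Definition top_subbundle n (X : set V) (xi : V -> submodClosed 'rV[F]_n) :=
  locally_trivial (subfamily xi X).

(* The rows of s form a basis of the left vector space W. *)
Definition is_frame k n (s : 'M[F]_(k, n)) (W : submodClosed 'rV[F]_n) :=
  (forall v, v \in W <-> exists c : 'rV[F]_k, v = c *m s) /\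
  injective (fun c : 'rV[F]_k => c *m s).

(* For W Zariski locally closed. *)
Definition alg_subbundle n (W : set V) (xi : V -> submodClosed 'rV[F]_n) :=
  forall x, W x -> exists (U : set V) (k : nat) (s : V -> 'M[F]_(k, n)),
    [/\ fs_zopen U, U x,
        forall i j l,
          regular_on (W `&` U) (fun y => real_coord (s y i j) ord0 l) &
        forall y, W y -> U y -> is_frame (s y) (xi y)].

(* The variety V x F^n, with V affine: its algebra consists of the polynomials
   in the real coordinates of F^n with coefficients regular on V. *)
Definition prod_space n : funspace R :=
  algebra_space [set f : V * 'rV[F]_n -> R |
    exists k (a : 'I_k -> V -> R)
           (p : mpoly.mpoly (k + n * real_dim K) R),
      (forall i, fs_reg setT (a i)) /\
      forall x v, f (x, v) =
        poly_eval p (row_mx (\row_i a i x) (real_vec_coord v))].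

(* phi x is the map induced on the fibres over x.  The component of the map of
   total spaces in V is the projection, so only the component in F^q has to be
   required to be regular. *)
Definition alg_morphism_on n q (W : set V)
    (xi : V -> submodClosed 'rV[F]_n) (eta : V -> submodClosed 'rV[F]_q)
    (phi : V -> 'rV[F]_n -> 'rV[F]_q) :=
  (forall x, W x ->
    [/\ (forall v, v \in xi x -> phi x v \in eta x) &
        (forall a u v, u \in xi x -> v \in xi x ->
           phi x (a *: u + v) = a *: phi x u + phi x v)]) /\
  (forall j l, @regular_on R (prod_space n)
     [set p | W p.1 /\ p.2 \in xi p.1]
     (fun p => real_coord (phi p.1 p.2 ord0 j) ord0 l)).

Definition znbhd_in_closure (X Z0 : set V) :=
  X `<=` Z0 /\ exists2 U, fs_zopen U & Z0 = zclosure X `&` U.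

Definition alg_extension n (X : set V) (xi : V -> submodClosed 'rV[F]_n)
    (Z0 : set V) (xi' : V -> submodClosed 'rV[F]_n) :=
  [/\ znbhd_in_closure X Z0, alg_subbundle Z0 xi' &
      forall x, X x -> xi' x =i xi x].

Definition alg_bundle n (X : set V) (xi : V -> submodClosed 'rV[F]_n) :=
  top_subbundle X xi /\ exists Z0 xi', alg_extension X xi Z0 xi'.

Definition sub_map n q (X : set V)
    (xi : V -> submodClosed 'rV[F]_n) (eta : V -> submodClosed 'rV[F]_q) :=
  forall b, vf_fib (subfamily xi X) b -> vf_fib (subfamily eta X) b.

Definition alg_morphism n q (X : set V)
    (xi : V -> submodClosed 'rV[F]_n) (eta : V -> submodClosed 'rV[F]_q)
    (phi : sub_map X xi eta) :=
  top_morphism phi /\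
  exists Z0 xi' eta' phi',
    [/\ alg_extension X xi Z0 xi', alg_extension X eta Z0 eta',
        alg_morphism_on Z0 xi' eta' phi' &
        forall b v, phi' (set_val b) (fibre_val v) = fibre_val (phi b v)].

Definition incl (Y X : set V) (YX : Y `<=` X) (b : set_type Y) : set_type X :=
  exist _ (set_val b) (mem_set (YX _ (set_mem (valP b)))).

Definition restrict_map n q (Y X : set V) (YX : Y `<=` X)
    (xi : V -> submodClosed 'rV[F]_n) (eta : V -> submodClosed 'rV[F]_q)
    (phi : sub_map X xi eta) : sub_map Y xi eta :=
  fun b => phi (incl YX b).

Definition component_of (A C : set V) :=
  exists2 x, A x & C = connected_component A x.

Definition pw_bundle n (SS : set (set V)) (X : set V)
    (xi : V -> submodClosed 'rV[F]_n) :=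
  top_subbundle X xi /\
  forall S C, SS S -> component_of (X `&` S) C -> alg_bundle C xi.

Definition pw_morphism n q (SS : set (set V)) (X : set V)
    (xi : V -> submodClosed 'rV[F]_n) (eta : V -> submodClosed 'rV[F]_q)
    (phi : sub_map X xi eta) :=
  top_morphism phi /\
  forall S C (CX : C `<=` X), SS S -> component_of (X `&` S) C ->
    alg_morphism (restrict_map CX phi).

Definition pw_isomorphic n q (SS : set (set V)) (X : set V)
    (xi : V -> submodClosed 'rV[F]_n) (eta : V -> submodClosed 'rV[F]_q) :=
  exists (phi : sub_map X xi eta) (psi : sub_map X eta xi),
    [/\ pw_morphism SS phi, pw_morphism SS psi,
        forall b, cancel (phi b) (psi b) & forall b, cancel (psi b) (phi b)].

End Subbundles.

(* Main.v *)
(* F^n is identified with R^(n d), d = dim F, so that an F-linear map becomes a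
   real matrix commuting with the matrices of the scalars.  A topological bundle
   over the compact set X embeds in a trivial one and is then the image of a
   continuous field of orthogonal projections; it is algebraic where the entries
   of the projections are quotients of polynomials.

   Local contractibility gives finitely many polynomials f_i whose sets f_i < 0
   cover X and whose sublevel sets f_i <= 0 contract to a point in X, so that
   every bundle is trivial over each of these.  A stratum is the set where a
   prescribed subfamily of the f_i vanishes; the f_i keep their signs on the
   connected components of its intersection with X.

   The algebraic model of a bundle is extended over one sublevel set after
   another.  Let k >= 0 vanish where the projection p is already good and let
   d = max(f_i, 0).  A regular approximation of the gluing isomorphism, plus
   L (k + d) times the inclusion of a new block of coordinates, is a frame; with
   q the projection onto its span, p + k / (k + d) (q - p) is the next
   projection.  It is piecewise regular, since the signs of k and d are constant
   on the pieces.

   For uniqueness, a topological isomorphism between two piecewise algebraic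
   bundles with projections P and Q is replaced by P Phi Q for a regular
   approximation Phi of its matrix; the inverse is a Gram pseudo-inverse, which
   is regular as well. *)

Require Import Defs.
From HB Require Import structures.
From mathcomp Require Import all_boot all_order all_algebra.
From mathcomp Require Import ring lra complex.
From mathcomp Require Import all_classical all_reals all_analysis.
From mathcomp Require Import (canonicals) mpoly.

Set Implicit Arguments.
Unset Strict Implicit.
Unset Printing Implicit Defensive.

Import Order.TTheory GRing.Theory Num.Theory.
Import numFieldNormedType.Exports.

Local Open Scope classical_set_scope.
Local Open Scope ring_scope.

(** * Orthogonal projections and Gram pseudo-inverses *)

(** Injectivity of a frame is measured by a margin: [entry_norm v <= C * entry_norm (v *m A)] on the
    image of a projection. It survives perturbations of size 1 / (2 C), so close approximations of
    isomorphisms are isomorphisms. This dictates the order of choices in an extension step: the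
    margin of the new frame must be known before the accuracy, whence the constant of
    [extend_frame], which does not depend on [e]. The isomorphisms over the old set and over the new
    sublevel set agree only approximately on the overlap. They are not corrected: the approximation
    lemma accepts functions whose local oscillation is less than [e], so the glued map is
    approximated as it is. The interpolated matrix is a projection only where k d vanishes, and
    merely symmetric and equivariant elsewhere. Each stage therefore claims the identities of a
    projection on the sublevel sets treated so far, and carries a regular [u] such that [u *m p]
    identifies the original bundle with the image of [p] there. Since k / (k + d) is 0 / 0 on the
    overlap, q must equal p there; the coefficient of the new block vanishes exactly on that
    overlap. *)

Section RealMatrices.
Context (R : realFieldType).

Definition entry_norm m n (A : 'M[R]_(m, n)) : R := \sum_i \sum_j `|A i j|.

Lemma entry_norm_ge0 m n (A : 'M[R]_(m, n)) : 0 <= entry_norm A.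
Proof. by apply: sumr_ge0 => i _; apply: sumr_ge0. Qed.

Lemma entry_norm_ge m n (A : 'M[R]_(m, n)) i j : `|A i j| <= entry_norm A.
Proof.
rewrite /entry_norm (bigD1 i) //= (bigD1 j) //= -addrA lerDl addr_ge0 //.
  by apply: sumr_ge0.
by apply: sumr_ge0 => ? _; apply: sumr_ge0.
Qed.

Lemma entry_norm0 m n : entry_norm (0 : 'M[R]_(m, n)) = 0.
Proof. by apply: big1 => i _; apply: big1 => j _; rewrite mxE normr0. Qed.

Lemma entry_norm_eq0 m n (A : 'M[R]_(m, n)) : entry_norm A <= 0 -> A = 0.
Proof.
move=> A0; apply/matrixP => i j; rewrite mxE; apply/eqP.
by rewrite -normr_le0 (le_trans (entry_norm_ge A i j)).
Qed.

Lemma entry_normD m n (A B : 'M[R]_(m, n)) :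
  entry_norm (A + B) <= entry_norm A + entry_norm B.
Proof.
rewrite /entry_norm -big_split; apply: ler_sum => i _ /=.
by rewrite -big_split; apply: ler_sum => j _; rewrite mxE ler_normD.
Qed.

Lemma entry_normN m n (A : 'M[R]_(m, n)) : entry_norm (- A) = entry_norm A.
Proof.
by apply: eq_bigr => i _; apply: eq_bigr => j _; rewrite mxE normrN.
Qed.

Lemma entry_normB m n (A B : 'M[R]_(m, n)) :
  entry_norm A <= entry_norm B + entry_norm (A - B).
Proof. by rewrite -{1}(subrKC B A) entry_normD. Qed.

Lemma entry_normM m n p (A : 'M[R]_(m, n)) (B : 'M[R]_(n, p)) :
  entry_norm (A *m B) <= entry_norm A * entry_norm B.
Proof.
rewrite /entry_norm mulr_suml; apply: ler_sum => i _.
rewrite mulr_suml.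
apply: (@le_trans _ _ (\sum_j \sum_k `|A i k| * `|B k j|)).
  apply: ler_sum => j _; rewrite mxE (le_trans (ler_norm_sum _ _ _)) //.
  by apply: ler_sum => k _; rewrite normrM.
rewrite exchange_big /=; apply: ler_sum => k _; rewrite -mulr_sumr.
apply: ler_wpM2l => //; rewrite (bigD1 k) //= lerDl.
by apply: sumr_ge0 => ? _; apply: sumr_ge0.
Qed.

Lemma entry_norm_le m n (A : 'M[R]_(m, n)) e :
  (forall i j, `|A i j| <= e) -> entry_norm A <= m%:R * n%:R * e.
Proof.
move=> Ae; apply: (@le_trans _ _ (\sum_(i < m) \sum_(j < n) e)).
  by apply: ler_sum => i _; apply: ler_sum => j _.
by rewrite !sumr_const !card_ord -[_ *+ m]mulr_natl -[e *+ n]mulr_natl mulrA.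
Qed.

(** Matrices act on row vectors from the right, so the image of [P] is the set of [v] with
    [v *m P = v]. *)
Definition orthproj n (P : 'M[R]_n) := P^T = P /\ P *m P = P.

Definition injective_on m n (P : 'M[R]_m) (A : 'M[R]_(m, n)) :=
  forall v : 'rV_m, v *m P = v -> v *m A = 0 -> v = 0.

Lemma dot_eq0 n (v : 'rV[R]_n) : v *m v^T = 0 -> v = 0.
Proof.
move/matrixP => /(_ 0 0); rewrite !mxE => vv0.
apply/rowP => i; rewrite mxE; apply/eqP; rewrite -sqrf_eq0.
move/eqP: vv0; rewrite psumr_eq0; last first.
  by move=> j _; rewrite mxE -expr2 sqr_ge0.
by move/allP/(_ i (mem_index_enum _)) => /=; rewrite mxE -expr2.
Qed.

Lemma unitmx_inj n (A : 'M[R]_n) :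
  (forall v : 'rV_n, v *m A = 0 -> v = 0) -> A \in unitmx.
Proof.
move=> Ainj; rewrite -row_free_unit -kermx_eq0; apply/eqP/row_matrixP => i.
by rewrite row0; apply: Ainj; rewrite -row_mul mulmx_ker row0.
Qed.

(** Idempotence and symmetry make [P i i] the sum of the squares of row [i]. So it is at most 1 and
    bounds the square of every entry of the row. *)
Lemma orthproj_entry n (P : 'M[R]_n) i j : orthproj P -> `|P i j| <= 1.
Proof.
move=> [PT PP].
have Pii k : P k k = \sum_l P k l ^+ 2.
  by rewrite -{1}PP mxE; apply: eq_bigr => l _; rewrite -{2}PT mxE expr2.
have Pge k l : P k l ^+ 2 <= P k k.
  by rewrite Pii (bigD1 l) //= lerDl; apply: sumr_ge0 => ? _; rewrite sqr_ge0.
have Pi0 : 0 <= P i i by rewrite Pii; apply: sumr_ge0 => ? _; rewrite sqr_ge0.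
have Pi1 : P i i <= 1.
  rewrite leNgt; apply/negP => Pi1; have := Pge i i.
  by apply/negP; rewrite -ltNge expr2 ltr_pMr // (lt_trans _ Pi1).
rewrite -(@ler_pXn2r _ 2) ?nnegrE // expr1n real_normK ?num_real //.
exact: le_trans (Pge i j) _.
Qed.

Lemma orthproj_entry_norm n (P : 'M[R]_n) :
  orthproj P -> entry_norm P <= n%:R * n%:R.
Proof.
by move=> PP; rewrite -[leRHS]mulr1 entry_norm_le // => i j; exact: orthproj_entry.
Qed.

Lemma orthproj_compl n (P : 'M[R]_n) : orthproj P -> P *m (1%:M - P) = 0.
Proof. by move=> [_ PP]; rewrite mulmxBr PP mulmx1 subrr. Qed.

Section Gram.
Context (m n : nat) (P : 'M[R]_m) (A : 'M[R]_(m, n)).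
Hypotheses (oP : orthproj P) (PA : P *m A = A) (iA : injective_on P A).

(** [A *m A^T] is invertible on the image of [P] only. The summand [1%:M - P] is the identity on the
    orthogonal complement, so that a determinant and a full inverse can be used. *)
Definition gram := A *m A^T + (1%:M - P).

Lemma trmx_gram : gram^T = gram.
Proof.
by case: oP => PT _; rewrite /gram linearD linearB /= trmx_mul trmxK trmx1 PT.
Qed.

Lemma gram_unit : gram \in unitmx.
Proof.
case: (oP) => PT PP; apply: unitmx_inj => v vG.
have vAP : v *m A *m A^T *m P = v *m A *m A^T.
  by rewrite -[in LHS](trmxK P) -mulmxA -trmx_mul PT PA.
have v0 : v *m (1%:M - P) = 0.
  have : v *m gram *m (1%:M - P) = 0 by rewrite vG mul0mx.
  rewrite /gram (mulmxDr v) mulmxDl (mulmxA v) (mulmxBr (v *m A *m A^T)) mulmx1.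
  rewrite vAP subrr add0r -mulmxA (mulmxBl 1%:M) mul1mx orthproj_compl //.
  by rewrite subr0.
have vPv : v *m P = v.
  by move/eqP: v0; rewrite mulmxBr mulmx1 subr_eq0 => /eqP.
apply: iA => //; apply: dot_eq0.
rewrite trmx_mul !mulmxA; suff -> : v *m A *m A^T = 0 by rewrite mul0mx.
by move: vG; rewrite /gram mulmxDr v0 addr0 mulmxA.
Qed.

(** The Moore-Penrose inverse of [A]: its products with [A] are the orthogonal projections [P] and
    [rowproj]. *)
Definition pinv := A^T *m invmx gram.

Lemma mulmx_pinv : A *m pinv = P.
Proof.
case: (oP) => PT PP; rewrite /pinv mulmxA.
have CG : (1%:M - P) *m gram = 1%:M - P.
  rewrite /gram mulmxDr mulmxA mulmxBl mul1mx PA subrr mul0mx add0r.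
  by rewrite mulmxBr mulmx1 mulmxBl mul1mx PP subrr subr0.
have -> : A *m A^T = gram - (1%:M - P) by rewrite /gram addrK.
rewrite mulmxBl mulmxV ?gram_unit // -[in X in _ - X]CG mulmxK ?gram_unit //.
by rewrite opprB addrC subrK.
Qed.

Definition rowproj := pinv *m A.

Lemma rowproj_orth : orthproj rowproj.
Proof.
split; last by rewrite /rowproj mulmxA -(mulmxA _ A) mulmx_pinv -mulmxA PA.
by rewrite /rowproj /pinv !trmx_mul trmxK trmx_inv trmx_gram mulmxA.
Qed.

Lemma mulmx_rowproj : A *m rowproj = A.
Proof. by rewrite /rowproj mulmxA mulmx_pinv PA. Qed.

Lemma rank_rowproj : \rank rowproj = \rank P.
Proof.
apply/eqP; rewrite eqn_leq; apply/andP; split.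
  by rewrite /rowproj -PA mulmxA (leq_trans (mxrankM_maxl _ _)) ?mxrankM_maxr.
rewrite -mulmx_pinv -{1}mulmx_rowproj -mulmxA.
by rewrite (leq_trans (mxrankM_maxr _ _)) ?mxrankM_maxl.
Qed.

Lemma pinvP : pinv *m P = pinv.
Proof.
case: (oP) => PT PP.
have GP : gram *m P = P *m gram.
  rewrite /gram mulmxDl mulmxDr mulmxA PA -mulmxA.
  have -> : A^T *m P = A^T by rewrite -[in RHS]PA trmx_mul PT.
  by congr (_ + _); rewrite mulmxBl mulmxBr mul1mx mulmx1.
have GiP : invmx gram *m P = P *m invmx gram.
  apply: (can_inj (mulKmx gram_unit)).
  by rewrite mulKVmx ?gram_unit // mulmxA GP mulmxK ?gram_unit.
by rewrite /pinv -mulmxA GiP mulmxA; congr (_ *m _); rewrite -[in RHS]PA trmx_mul PT.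
Qed.

Lemma rowprojP (w : 'rV[R]_n) : w *m rowproj = w <-> exists v, w = v *m A.
Proof.
split=> [<-|[v ->]]; first by exists (w *m pinv); rewrite mulmxA.
by rewrite -mulmxA mulmx_rowproj.
Qed.

End Gram.

(** The converse of [gram_unit]. Injectivity becomes the nonvanishing of a determinant, which is
    continuous or regular along with [P] and [A]. *)
Lemma gram_unit_injective m n (P : 'M[R]_m) (A : 'M[R]_(m, n)) :
  gram P A \in unitmx -> injective_on P A.
Proof.
move=> uG v vP vA; rewrite -(mulmxK uG v) /gram mulmxDr mulmxA vA mul0mx add0r.
by rewrite mulmxBr mulmx1 vP subrr mul0mx.
Qed.

Lemma injective_on_rank m n (P : 'M[R]_m) (A : 'M[R]_(m, n)) :
  P *m P = P -> injective_on P A -> \rank (P *m A) = \rank P.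
Proof.
move=> PP iA; rewrite -[RHS](mxrank_mul_ker P A).
suff -> : (P :&: kermx A)%MS = 0 by rewrite mxrank0 addn0.
apply/row_matrixP => i; rewrite row0; apply: iA.
  have /submxP[w ->] : (row i (P :&: kermx A)%MS <= P)%MS.
    by rewrite (submx_trans (row_sub _ _)) // capmxSl.
  by rewrite -mulmxA PP.
by apply/sub_kermxP; rewrite (submx_trans (row_sub _ _)) // capmxSr.
Qed.

Lemma injective_on_rank_le m n (P : 'M[R]_m) (Q : 'M[R]_n) (A : 'M[R]_(m, n)) :
  P *m P = P -> injective_on P A -> A *m Q = A -> (\rank P <= \rank Q)%N.
Proof.
move=> PP iA AQ; rewrite -(injective_on_rank PP iA) -AQ mulmxA.
exact: mxrankM_maxr.
Qed.

(** [P *m Q = P] places the image of [P] in that of [Q]. Equal ranks make them coincide, and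
    transposition identifies the projections. *)
Lemma orthproj_eq n (P Q : 'M[R]_n) : orthproj P -> orthproj Q ->
  P *m Q = P -> \rank P = \rank Q -> P = Q.
Proof.
move=> [PT PP] [QT QQ] PQ rPQ.
have QP : Q *m P = Q.
  have /andP[_ /submxP[D QD]] : (P == Q)%MS.
    by rewrite -(geq_leqif (mxrank_leqif_eq _)) ?rPQ // -PQ submxMl.
  by rewrite QD -mulmxA PP.
by rewrite -PT -PQ trmx_mul QT PT QP.
Qed.

Lemma orthproj_uniq n (P Q : 'M[R]_n) : orthproj P -> orthproj Q ->
  (forall v : 'rV_n, v *m P = v <-> v *m Q = v) -> P = Q.
Proof.
move=> [PT PP] [QT QQ] PQ.
have sub (A B : 'M[R]_n) : A *m A = A ->
    (forall v : 'rV_n, v *m A = v -> v *m B = v) -> A *m B = A.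
  move=> AA AB; apply/row_matrixP => i; rewrite row_mul AB // -row_mul.
  by rewrite AA.
have PQP : P *m Q = P by apply: sub => // v /PQ.
have QPQ : Q *m P = Q by apply: sub => // v /PQ.
by rewrite -PT -PQP trmx_mul QT PT QPQ.
Qed.

(** In a rank factorization P = c r idempotence forces r c = 1, and c r has the same trace as r c.
    The rank of a projection thus becomes an algebraic function of its entries. *)
Lemma idem_trace n (P : 'M[R]_n) : P *m P = P -> \tr P = (\rank P)%:R.
Proof.
move=> PP; rewrite -{1}(mulmx_base P) mxtrace_mulC.
suff -> : row_base P *m col_base P = 1%:M by rewrite mxtrace1.
have /row_freeP[C CR] : row_free (row_base P) by exact: row_base_free.
have /row_fullP[B BC] : row_full (col_base P) by exact: col_base_full.
have := mulmx_base P; move: (col_base P) (row_base P) BC CR => c r BC CR crP.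
have : B *m (c *m r) *m (c *m r) *m C = B *m (c *m r) *m C.
  by rewrite crP -(mulmxA B) PP.
by rewrite !mulmxA BC !mul1mx -!mulmxA CR mulmx1.
Qed.

(** The norm of [v *m (B - A)] is at most that of [v] divided by 2 C, so half of the margin of [A]
    remains for [B]. *)
Lemma injective_on_perturb m n (P : 'M[R]_m) (A B : 'M[R]_(m, n)) C :
  (forall v : 'rV_m, v *m P = v -> entry_norm v <= C * entry_norm (v *m A)) ->
  0 <= C -> 2 * C * entry_norm (B - A) <= 1 ->
  forall v : 'rV_m, v *m P = v -> entry_norm v <= 2 * C * entry_norm (v *m B).
Proof.
move=> HA C0 BA v vP; have := HA v vP.
have := entry_normB (v *m A) (v *m B); rewrite -mulmxBr -opprB mulmxN entry_normN.
have := entry_normM v (B - A); have := entry_norm_ge0 v.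
have := entry_norm_ge0 (B - A); have := entry_norm_ge0 (v *m B).
set a := entry_norm v; set b := entry_norm (B - A).
set c := entry_norm (v *m A); set d := entry_norm (v *m B).
set e := entry_norm (v *m (B - A)).
move=> d0 b0 a0 eab cde aCc.
have h1 : C * c <= C * d + C * (a * b).
  by rewrite -mulrDr ler_wpM2l // (le_trans cde) // lerD2l.
have h2 : 2 * (C * (a * b)) <= a.
  by rewrite [leLHS](_ : _ = a * (2 * C * b)); [rewrite -[leRHS]mulr1 ler_wpM2l|ring].
by rewrite -mulrA; lra.
Qed.

Lemma margin_injective m n (P : 'M[R]_m) (A : 'M[R]_(m, n)) C :
  (forall v : 'rV_m, v *m P = v -> entry_norm v <= C * entry_norm (v *m A)) ->
  injective_on P A.
Proof.
move=> H v vP vA0; apply: entry_norm_eq0; rewrite (le_trans (H v vP)) // vA0.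
by rewrite entry_norm0 mulr0.
Qed.

End RealMatrices.

(** * Matrices of functions *)

(* [S] is a ring of functions only whose values on [D] matter, in which
   functions without zeros on [D] are invertible. *)
Record funring (R : realType) (T : Type) (D : set T) (S : set (T -> R)) := {
  fr_cst : forall c, S (fun=> c);
  fr_add : forall f g, S f -> S g -> S (fun x => f x + g x);
  fr_mul : forall f g, S f -> S g -> S (fun x => f x * g x);
  fr_inv : forall f, S f -> (forall x, D x -> f x != 0) -> S (fun x => (f x)^-1);
  fr_ext : forall f g, S f -> (forall x, D x -> f x = g x) -> S g }.

Section MatrixFunctions.
Context (R : realType) (T : Type) (D : set T) (S : set (T -> R)).
Hypothesis SR : funring D S.

(** With an abstract [S] the calculus below applies to continuous functions, to global and local
    fractions, and to piecewise regular functions. *)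
Definition mxfun m n (A : T -> 'M[R]_(m, n)) := forall i j, S (fun x => A x i j).

Lemma fr_sum I (r : seq I) (P : pred I) (f : I -> T -> R) :
  (forall i, S (f i)) -> S (fun x => \sum_(i <- r | P i) f i x).
Proof.
move=> Sf; elim: r => [|i r IH].
  by apply: (fr_ext SR (fr_cst SR 0)) => x _; rewrite big_nil.
have [Pi|Pi] := boolP (P i).
  by apply: (fr_ext SR (fr_add SR (Sf i) IH)) => x _; rewrite big_cons Pi.
by apply: (fr_ext SR IH) => x _; rewrite big_cons (negPf Pi).
Qed.

Lemma fr_prod I (r : seq I) (f : I -> T -> R) :
  (forall i, S (f i)) -> S (fun x => \prod_(i <- r) f i x).
Proof.
move=> Sf; elim: r => [|i r IH].
  by apply: (fr_ext SR (fr_cst SR 1)) => x _; rewrite big_nil.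
by apply: (fr_ext SR (fr_mul SR (Sf i) IH)) => x _; rewrite big_cons.
Qed.

Lemma fr_opp f : S f -> S (fun x => - f x).
Proof.
move=> Sf; apply: (fr_ext SR (fr_mul SR (fr_cst SR (-1)) Sf)) => x _.
by rewrite mulN1r.
Qed.

Lemma mxfun_ext m n (A B : T -> 'M[R]_(m, n)) :
  mxfun A -> (forall x, D x -> A x = B x) -> mxfun B.
Proof. by move=> SA AB i j; apply: (fr_ext SR (SA i j)) => x Dx; rewrite AB. Qed.

Lemma mxfun_cst m n (A : 'M[R]_(m, n)) : mxfun (fun=> A).
Proof. by move=> i j; exact: (fr_cst SR). Qed.

Lemma mxfunD m n (A B : T -> 'M[R]_(m, n)) :
  mxfun A -> mxfun B -> mxfun (fun x => A x + B x).
Proof.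
move=> SA SB i j; apply: (fr_ext SR (fr_add SR (SA i j) (SB i j))) => x _.
by rewrite mxE.
Qed.

Lemma mxfunN m n (A : T -> 'M[R]_(m, n)) : mxfun A -> mxfun (fun x => - A x).
Proof.
by move=> SA i j; apply: (fr_ext SR (fr_opp (SA i j))) => x _; rewrite mxE.
Qed.

Lemma mxfunB m n (A B : T -> 'M[R]_(m, n)) :
  mxfun A -> mxfun B -> mxfun (fun x => A x - B x).
Proof. by move=> SA SB; apply: mxfunD => //; exact: mxfunN. Qed.

Lemma mxfunZ m n f (A : T -> 'M[R]_(m, n)) :
  S f -> mxfun A -> mxfun (fun x => f x *: A x).
Proof.
by move=> Sf SA i j; apply: (fr_ext SR (fr_mul SR Sf (SA i j))) => x _; rewrite mxE.
Qed.

Lemma mxfunM m n p (A : T -> 'M[R]_(m, n)) (B : T -> 'M[R]_(n, p)) :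
  mxfun A -> mxfun B -> mxfun (fun x => A x *m B x).
Proof.
move=> SA SB i j; apply: (fr_ext SR (f := fun x => \sum_k A x i k * B x k j)).
  by apply: fr_sum => k; apply: (fr_mul SR).
by move=> x _; rewrite mxE.
Qed.

Lemma mxfun_tr m n (A : T -> 'M[R]_(m, n)) : mxfun A -> mxfun (fun x => (A x)^T).
Proof. by move=> SA i j; apply: (fr_ext SR (SA j i)) => x _; rewrite mxE. Qed.

Lemma fr_det n (A : T -> 'M[R]_n) : mxfun A -> S (fun x => \det (A x)).
Proof.
move=> SA; apply: fr_sum => s; apply: (fr_mul SR); first exact: (fr_cst SR).
by apply: fr_prod => i; exact: SA.
Qed.

(** Cramer's rule: ring operations and one division by a determinant without zeros on [D]. *)
Lemma mxfun_inv n (A : T -> 'M[R]_n) :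
  mxfun A -> (forall x, D x -> A x \in unitmx) -> mxfun (fun x => invmx (A x)).
Proof.
move=> SA uA; apply: (@mxfun_ext _ _ (fun x => (\det (A x))^-1 *: \adj (A x))).
  apply: mxfunZ.
    by apply: (fr_inv SR (fr_det SA)) => x /uA; rewrite unitmxE unitfE.
  move=> i j; apply: (fr_ext SR (f := fun x => cofactor (A x) j i)).
    apply: (fr_mul SR); first exact: (fr_cst SR).
    apply: fr_det => k l; apply: (fr_ext SR (SA (lift j k) (lift i l))) => x _.
    by rewrite !mxE.
  by move=> x _; rewrite mxE.
by move=> x /uA uAx; rewrite /invmx uAx.
Qed.

Lemma mxfun_gram m n (P : T -> 'M[R]_m) (A : T -> 'M[R]_(m, n)) :
  mxfun P -> mxfun A -> mxfun (fun x => gram (P x) (A x)).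
Proof.
move=> SP SA; apply: mxfunD; first exact/mxfunM/mxfun_tr.
by apply: mxfunB => //; exact: mxfun_cst.
Qed.

Lemma mxfun_pinv m n (P : T -> 'M[R]_m) (A : T -> 'M[R]_(m, n)) :
  mxfun P -> mxfun A -> (forall x, D x -> gram (P x) (A x) \in unitmx) ->
  mxfun (fun x => pinv (P x) (A x)).
Proof.
move=> SP SA uG; apply: mxfunM; first exact: mxfun_tr.
by apply: mxfun_inv => //; exact: mxfun_gram.
Qed.

Lemma mxfun_rowproj m n (P : T -> 'M[R]_m) (A : T -> 'M[R]_(m, n)) :
  mxfun P -> mxfun A -> (forall x, D x -> gram (P x) (A x) \in unitmx) ->
  mxfun (fun x => rowproj (P x) (A x)).
Proof. by move=> SP SA uG; apply: mxfunM => //; exact: mxfun_pinv. Qed.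

End MatrixFunctions.

Section ContinuousFunctions.
Context (R : realType) (T : topologicalType).
Implicit Types (D : set T) (f : T -> R).

Definition cts_on D : set (T -> R) :=
  [set f : T -> R | forall x, D x -> f @ within D (nbhs x) --> (f x : R)].

Lemma cts_on_funring D : funring D (cts_on D).
Proof.
split.
- by move=> c x Dx; exact: cvg_cst.
- by move=> f g cf cg x Dx; apply: cvgD; [exact: cf|exact: cg].
- by move=> f g cf cg x Dx; apply: cvgM; [exact: cf|exact: cg].
- by move=> f cf f0 x Dx; apply: cvgV; [exact: f0|exact: cf].
- move=> f g cf fg x Dx; rewrite -fg //.
  by apply: cvg_trans (cf x Dx); apply: fmap_within_eq => y; rewrite inE => /fg.
Qed.

Lemma cts_onT f : cts_on setT f <-> continuous f.
Proof.
have wT (x : T) : within setT (nbhs x) = nbhs x.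
  by apply/seteqP; split=> A /=; rewrite /within /=; apply: filterS => y; [exact|].
by split=> cf x; have := cf x; rewrite ?wT //; exact.
Qed.

Lemma cts_onS D D' f : D' `<=` D -> cts_on D f -> cts_on D' f.
Proof.
move=> DD cf x D'x; apply: cvg_trans (cf x (DD _ D'x)).
apply: cvg_app => A; change (within D (nbhs x) A -> within D' (nbhs x) A).
by rewrite /within /=; apply: filterS => y + /DD; exact.
Qed.

Lemma cts_on_open D f : open D -> cts_on D f <-> (forall x, D x -> {for x, continuous f}).
Proof.
move=> oD; split=> cf x Dx.
  have := cf x Dx; rewrite within_interior //.
  by move: oD; rewrite openE; exact.
by apply: cvg_trans (cf x Dx); apply: cvg_app; exact: cvg_within.
Qed.

Lemma continuous_cts_on D f : continuous f -> cts_on D f.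
Proof. by move=> /cts_onT; apply: cts_onS. Qed.

Lemma cts_on_norm D f : cts_on D f -> cts_on D (fun x => `|f x|).
Proof. by move=> cf x Dx; apply: cvg_norm; exact: cf. Qed.

Lemma cts_on_entry_norm D m n (A : T -> 'M[R]_(m, n)) :
  mxfun (cts_on D) A -> cts_on D (fun x => entry_norm (A x)).
Proof.
move=> cA; apply: (fr_sum (cts_on_funring D)) => i.
by apply: (fr_sum (cts_on_funring D)) => j; exact: cts_on_norm.
Qed.

Lemma cts_on_near D f x (e : R) : cts_on D f -> D x -> 0 < e ->
  \forall y \near x, D y -> `|f y - f x| < e.
Proof.
move=> cf Dx e0; have := cf x Dx _ (nbhsx_ballx (f x) e e0).
move=> H; have : within D (nbhs x) (f @^-1` ball (f x) e) by exact: H.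
rewrite /within /=; apply: filterS => y /[apply].
by rewrite -ball_normE /= distrC.
Qed.

Lemma near_cts_on D f : (forall x, D x -> forall e : R, 0 < e ->
  \forall y \near x, D y -> `|f y - f x| < e) -> cts_on D f.
Proof.
move=> H x Dx A /nbhs_ballP[e /= e0 eA].
change (within D (nbhs x) (f @^-1` A)).
have := H x Dx e e0; rewrite /within /=; apply: filterS => y Hy /Hy yx.
by apply: eA; rewrite -ball_normE /= distrC.
Qed.

Lemma mxfun_near D m n (A : T -> 'M[R]_(m, n)) x (e : R) :
  mxfun (cts_on D) A -> D x -> 0 < e ->
  \forall y \near x, D y -> entry_norm (A y - A x) < e.
Proof.
move=> cA Dx e0.
have := @cts_on_near D (fun y => entry_norm (A y - A x)) x e _ Dx e0.
rewrite subrr entry_norm0 => H; have {}H := H _.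
have /H : cts_on D (fun y => entry_norm (A y - A x)).
  apply: cts_on_entry_norm; apply: (mxfunB (cts_on_funring D)) => //.
  exact: (mxfun_cst (cts_on_funring D)).
apply: filterS => y /[apply]; rewrite subr0 ger0_norm //; exact: entry_norm_ge0.
Qed.

(** Applied with [F] at infinity or at 0 from the right, this picks one real parameter that works on
    a whole compact set. *)
Lemma compact_near D (I : Type) (F : set_system I) (P : I -> T -> Prop) :
  Filter F -> compact D ->
  (forall x, D x -> \forall x' \near x & i \near F, D x' -> P i x') ->
  \forall i \near F, forall x, D x -> P i x.
Proof.
move=> FF /compact_near_coveringP/near_covering_withinP cD H.
exact: (cD I F P FF H).
Qed.

(** Small local oscillation replaces continuity, as it does in [approx]. *)
Lemma near_bounded D f e : compact D ->
  (forall a, D a -> \forall x \near a, D x -> `|f x - f a| < e) ->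
  exists2 C, 0 < C & forall x, D x -> `|f x| <= C.
Proof.
move=> cD fe.
have H : \forall C \near +oo, forall x, D x -> `|f x| <= C.
  apply: (@compact_near D R +oo%R (fun C x => `|f x| <= C)) => // x Dx.
  exists ([set y | D y -> `|f y - f x| < e], [set C | `|f x| + e <= C]) => /=.
    by split; [exact: fe|apply: nbhs_pinfty_ge; exact: num_real].
  move=> [y C] /= [fy xC] /fy {}fy; apply: le_trans xC.
  by rewrite -(subrKC (f x) (f y)) (le_trans (ler_normD _ _)) // lerD2l ltW.
have [C [C0 HC]] : exists C : R, 0 < C /\ forall x, D x -> `|f x| <= C.
  by apply: (@filter_ex _ +oo%R); apply: filterI H; apply: nbhs_pinfty_gt; exact: num_real.
by exists C.
Qed.

Lemma mxfun_bounded D m n (A : T -> 'M[R]_(m, n)) : compact D ->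
  mxfun (cts_on D) A -> exists2 C, 0 < C & forall x, D x -> entry_norm (A x) <= C.
Proof.
move=> cD cA; have cn := cts_on_entry_norm cA.
have [C C0 HC] := near_bounded cD (fun a Da => cts_on_near cn Da ltr01).
exists C => // x Dx; apply: le_trans (HC x Dx); exact: ler_norm.
Qed.

(* The margin [1 / C] of injectivity makes it an open condition, uniformly
   over a compact set. *)
Lemma mxfun_margin D m n (P : T -> 'M[R]_m) (A : T -> 'M[R]_(m, n)) :
  compact D -> mxfun (cts_on D) P -> mxfun (cts_on D) A ->
  (forall x, D x -> [/\ orthproj (P x), P x *m A x = A x & injective_on (P x) (A x)]) ->
  exists2 C, 0 < C & forall x, D x -> forall v : 'rV_m, v *m P x = v ->
    entry_norm v <= C * entry_norm (v *m A x).
Proof.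
move=> cD cP cA H.
have [] := @mxfun_bounded D _ _ (fun x => pinv (P x) (A x)) cD.
  apply: (mxfun_pinv (cts_on_funring D)) => // x /H[oP PA iA].
  exact: gram_unit.
move=> C C0 HC; exists C => // x Dx v vP.
have [oP PA iA] := H x Dx.
rewrite -{1}vP -(mulmx_pinv oP PA iA) mulmxA mulrC.
rewrite (le_trans (entry_normM _ _)) // ler_wpM2l ?entry_norm_ge0 //.
exact: HC.
Qed.

End ContinuousFunctions.

Lemma compact_union_ind (T : topologicalType) (Y : set T) (P : set T -> Prop) :
  compact Y -> P set0 -> (forall A B, P A -> P B -> P (A `|` B)) ->
  (forall x, Y x -> exists2 A, nbhs x A & P A) ->
  exists2 A, P A & Y `<=` A.
Proof.
move=> cY P0 PU Pn.
(* The sets with [P] are directed by inclusion, being stable under unions; this is the filter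
   generated by their upper cones. *)
pose F : set_system (set T) :=
  [set S | exists2 A, P A & forall B, P B -> A `<=` B -> S B].
have FF : Filter F.
  split; first by exists set0.
    move=> S S' [A PA AS] [A' PA' AS']; exists (A `|` A'); first exact: PU.
    move=> B PB AB; split; [apply: AS|apply: AS'] => // x Ax; apply: AB.
      by left.
    by right.
  by move=> S S' SS [A PA AS]; exists A => // B PB /AS - /(_ PB) /SS.
have [|A PA AY] := @compact_near T Y (set T) F (fun A x => A x) FF cY.
  move=> x /Pn[A xA PA]; exists (A, [set B | A `<=` B]) => /=.
    by split=> //; exists A.
  by move=> [y B] /= [Ay AB] _; exact: AB.
by exists A => //; apply: AY.
Qed.

Lemma compact_seq_cover (T : topologicalType) (I : Type) (i0 : I) (Y : set T)
    (ok : I -> Prop) (Z : I -> set T) : compact Y ->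
  (forall x, Y x -> exists2 i, ok i & nbhs x (Z i)) ->
  exists s : seq I, (forall j, (j < size s)%N -> ok (nth i0 s j)) /\
    forall x, Y x -> exists2 j, (j < size s)%N & Z (nth i0 s j) x.
Proof.
move=> cY HY; pose P (W : set T) := exists s : seq I,
  (forall j, (j < size s)%N -> ok (nth i0 s j)) /\
  forall x, W x -> exists2 j, (j < size s)%N & Z (nth i0 s j) x.
have [|||W [s [oks sW]] YW] := @compact_union_ind T Y P cY.
- by exists [::]; split.
- move=> W W' [s [oks sW]] [s' [oks' sW']]; exists (s ++ s'); split.
    move=> j; rewrite size_cat nth_cat; case: (ltnP j (size s)) => [js _|sj jst].
      exact: oks.
    by apply: oks'; rewrite ltn_subLR.
  move=> x [/sW|/sW'] [j js Zj].
    by exists j; rewrite ?size_cat ?(ltn_addr _ js) // nth_cat js.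
  exists (size s + j)%N; first by rewrite size_cat ltn_add2l.
  by rewrite nth_cat ltnNge leq_addr /= addKn.
- move=> x /HY[i oki xZ]; exists (Z i) => //; exists [:: i].
  by split=> [[]//|y Zy]; exists 0%N.
- by exists s; split=> // x Yx; exact/sW/YW.
Qed.

Record function_algebra (R : realType) (T : Type) (A : set (T -> R)) := {
  alg_cst : forall c, A (fun=> c);
  alg_add : forall f g, A f -> A g -> A (fun x => f x + g x);
  alg_mul : forall f g, A f -> A g -> A (fun x => f x * g x) }.

Section Quotients.
Context (R : realType) (T : Type) (A : set (T -> R)).
Hypothesis hA : function_algebra A.

Lemma alg_prod (I : Type) (r : seq I) (P : pred I) (f : I -> T -> R) :
  (forall i, P i -> A (f i)) -> A (fun x => \prod_(i <- r | P i) f i x).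
Proof.
move=> Af; elim: r => [|i r IH].
  by under eq_fun do rewrite big_nil; exact: (alg_cst hA).
have [Pi|Pi] := boolP (P i); last by under eq_fun do rewrite big_cons (negPf Pi).
by under eq_fun do rewrite big_cons Pi; apply: (alg_mul hA) => //; exact: Af.
Qed.

(** One fraction serves the whole of [D], whereas [locally_quotient] allows one fraction per point.
    A global fraction extends from [X] to a Zariski neighbourhood, see [quotients_lift]. *)
Definition quotients (D : set T) : set (T -> R) :=
  [set f | exists n q, [/\ A n, A q &
    forall x, D x -> q x != 0 /\ f x = n x / q x]].

Lemma quotients_funring D : funring D (quotients D).
Proof.
split.
- move=> k; exists (fun=> k), (fun=> 1); split=> //; try exact: (alg_cst hA).
  by move=> x _; rewrite oner_neq0 divr1.
- move=> f g [n [q [An Aq fE]]] [n' [q' [An' Aq' gE]]].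
  exists (fun x => n x * q' x + n' x * q x), (fun x => q x * q' x); split.
  + by apply: (alg_add hA); apply: (alg_mul hA).
  + exact: (alg_mul hA).
  + move=> x Dx; have [q0 ->] := fE x Dx; have [q'0 ->] := gE x Dx.
    by rewrite mulf_neq0 // addf_div.
- move=> f g [n [q [An Aq fE]]] [n' [q' [An' Aq' gE]]].
  exists (fun x => n x * n' x), (fun x => q x * q' x); split.
  + exact: (alg_mul hA).
  + exact: (alg_mul hA).
  + move=> x Dx; have [q0 ->] := fE x Dx; have [q'0 ->] := gE x Dx.
    by rewrite mulf_neq0 // mulf_div.
- move=> f [n [q [An Aq fE]]] f0; exists q, n; split=> // x Dx.
  have [q0 fx] := fE x Dx; have := f0 x Dx.
  by rewrite fx mulf_eq0 negb_or invf_div => /andP[].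
- move=> f g [n [q [An Aq fE]]] fg; exists n, q; split=> // x Dx.
  by have := fE x Dx; rewrite -fg.
Qed.

Lemma quotients_alg D f : A f -> quotients D f.
Proof.
move=> Af; exists f, (fun=> 1); split=> // [|x _]; first exact: (alg_cst hA).
by rewrite oner_neq0 divr1.
Qed.

Lemma quotients_exp D f k : quotients D f -> quotients D (fun x => f x ^+ k).
Proof.
have F := quotients_funring D => Qf.
apply: (fr_ext F (f := fun x => \prod_(i <- iota 0 k) f x)).
  exact: (fr_prod F).
by move=> x _; rewrite big_const_seq count_predT size_iota -Monoid.iteropE.
Qed.

Lemma quotientsS D D' f : D' `<=` D -> quotients D f -> quotients D' f.
Proof.
move=> DD [n [q [An Aq fE]]]; exists n, q; split=> // x D'x; exact/fE/DD.
Qed.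

End Quotients.

(** [alg_sep] abstracts the squared distance to [a] in an ambient affine space. *)
Record separating_algebra (R : realType) (T : topologicalType)
    (A : set (T -> R)) := {
  sep_alg :> function_algebra A;
  alg_cts : forall f, A f -> continuous f;
  alg_sep : forall a, exists rho, [/\ A rho, forall x, 0 <= rho x, rho a = 0 &
    forall x, x <> a -> 0 < rho x] }.

(** * Regular approximation *)

Section Approximation.
Context (R : realType) (T : topologicalType) (A : set (T -> R)).
Hypotheses (hA : separating_algebra A) (cT : compact [set: T]).
Let QR := quotients_funring hA setT.

Lemma quotients_continuous f : quotients A setT f -> continuous f.
Proof.
move=> [n [q [An Aq fE]]]; apply/cts_onT; have F := @cts_on_funring R T setT.
have cA g : A g -> cts_on setT g by move=> /(alg_cts hA)/cts_onT.
apply: (fr_ext F (fr_mul F (cA _ An) (fr_inv F (cA _ Aq) _))) => x /fE[]//.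
Qed.

(** By compactness [rho] has a positive lower bound off the neighbourhood [U], so its sublevel sets
    form a basis of neighbourhoods of [a]. *)
Lemma sublevel_nbhs (a : T) (U : set T) (rho : T -> R) : nbhs a U ->
  continuous rho -> rho a = 0 -> (forall x, x <> a -> 0 < rho x) ->
  exists2 r, 0 < r & forall x, rho x <= r -> U x.
Proof.
move=> aU crho rho0 rhop.
have : \forall r \near 0^'+, forall x, [set: T] x -> (rho x <= r -> U x).
  apply: (@compact_near T setT R (0^'+) (fun r x => rho x <= r -> U x)) => // x _.
  have [->|/eqP/rhop xa] := eqVneq x a.
    by exists (U, setT) => /=; [split=> //; exact: filterT|move=> [y r] /= []].
  exists ([set y | rho x / 2 < rho y], [set r | r < rho x / 2]) => /=.
    split; last by apply: nbhs_right_lt; rewrite divr_gt0.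
    have := @crho x; move=> /cvgrPdist_lt/(_ (rho x / 2)).
    rewrite divr_gt0 // => /(_ isT); apply: filterS => y.
    by rewrite ltr_distlC => /andP[+ _]; rewrite {1}(splitr (rho x)) addrK.
  move=> [y r] /= [xy rx] _ yr.
  by have := lt_trans xy (le_lt_trans yr rx); rewrite ltxx.
move=> H; have : \forall r \near 0^'+, 0 < r /\ forall x, rho x <= r -> U x.
  near=> r; split; first by near: r; exact: nbhs_right_gt.
  by move=> x; apply: (near H r).
by move/filter_ex => [r [r0 Hr]]; exists r.
Unshelve. all: by end_near. Qed.

Lemma geometric_lt (C e : R) : 0 < e -> exists N, C * (2 / 3) ^+ N < e.
Proof.
move=> e0; have : C *: ((2 / 3 : R) ^+ n) @[n --> \oo] --> C *: (0 : R).
  apply: cvgZr; apply: cvg_expr; rewrite ger0_norm //.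
  by rewrite ltr_pdivrMr // mul1r ltr_nat.
rewrite scaler0 => /cvgrPdist_lt/(_ e e0) /filter_ex[N].
by rewrite sub0r normrN => h; exists N; rewrite (le_lt_trans _ h) // ler_norm.
Qed.

(* Shepard interpolation with weights [h ^+ N]: only the nodes with [h x]
   at least [1 / 3] matter in the limit. *)
Lemma approx (Y : set T) (f : T -> R) (e : R) : compact Y -> 0 < e ->
  (forall a, Y a -> \forall x \near a, Y x -> `|f x - f a| < e) ->
  exists2 g, quotients A setT g & forall x, Y x -> `|g x - f x| < 2 * e.
Proof.
move=> cY e0 fe.
pose node (p : R * (T -> R)) := [/\ quotients A setT p.2, forall x, 0 < p.2 x &
  forall x, Y x -> 1 / 3 <= p.2 x -> `|p.1 - f x| <= e].
have [|s [ns sY]] := @compact_seq_cover T _ (0, fun=> 0) Y node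
    (fun p => [set x | 1 / 2 <= p.2 x]) cY.
  move=> a Ya; have [rho [Arho rho_ge0 rhoa rhop]] := alg_sep hA a.
  have crho := alg_cts hA Arho.
  have [r r0 Hr] := sublevel_nbhs (fe a Ya) crho rhoa rhop.
  (* [1 / 3 <= h x] amounts to [rho x <= r], and [1 / 2 <= h x] to [rho x <= r / 2]. *)
  pose h x := r / 2 / (r / 2 + rho x).
  have dh x : 0 < r / 2 + rho x by rewrite ltr_pwDl // divr_gt0.
  exists (f a, h); last first.
    have := crho a; move=> /cvgrPdist_lt/(_ (r / 2)).
    rewrite rhoa divr_gt0 // => /(_ isT); apply: filterS => x.
    rewrite sub0r normrN ger0_norm // => xr /=.
    by rewrite /h ler_pdivlMr // mul1r -[leLHS]mulrC ler_pdivrMr //; lra.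
  split=> /=.
  + apply: (fr_mul QR); first exact: (fr_cst QR).
    apply: (fr_inv QR); last by move=> x _; rewrite gt_eqF.
    apply: (fr_add QR); first exact: (fr_cst QR).
    exact: (quotients_alg hA).
  + by move=> x; rewrite !divr_gt0.
  + move=> x Yx; rewrite /h ler_pdivlMr // => hx; rewrite distrC ltW //.
    by apply: Hr => //; lra.
have [fC [C0 HC]] : exists C : R, 0 < C /\ forall x, Y x -> forall i,
    (i < size s)%N -> `|(nth (0, fun=> 0) s i).1 - f x| <= C.
  have [C C0 HC] := near_bounded cY fe.
  pose S := \sum_(i < size s) `|(nth (0, fun=> 0) s i).1|.
  exists (S + C); split.
    by rewrite ltr_wpDl //; apply: sumr_ge0.
  move=> x Yx i si; rewrite (le_trans (ler_normB _ _)) // lerD ?HC //.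
  by rewrite /S (bigD1 (Ordinal si)) //= lerDl; apply: sumr_ge0.
(* A node with [h x] below 1 / 3 weighs at most (1 / 3)^N, while the total weight is at least (1 /
   2)^N because some node has [h x] at least 1 / 2. This [N] keeps the far nodes' share of the error
   below [e]. *)
have [N HN] := geometric_lt ((size s)%:R * fC) e0.
have [s0|s0] := posnP (size s).
  exists (fun=> 0); first exact: (fr_cst QR).
  by move=> x Yx; case: (sY x Yx) => i; rewrite s0.
pose c i := (nth (0, fun=> 0) s i).1.
pose w i x := (nth (0, fun=> 0) s i).2 x ^+ N.
have w0 (i : 'I_(size s)) x : 0 < w i x.
  by have [_ h0 _] := ns i (ltn_ord i); rewrite exprn_gt0.
have W0 x : 0 < \sum_(i < size s) w i x.
  rewrite (bigD1 (Ordinal s0)) //= ltr_pwDl ?(w0 (Ordinal s0)) //.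
  by apply: sumr_ge0 => i _; rewrite ltW.
have Qw (i : 'I_(size s)) : quotients A setT (w i).
  by apply: (quotients_exp hA); have [] := ns i (ltn_ord i).
exists (fun x => (\sum_(i < size s) c i * w i x) * (\sum_(i < size s) w i x)^-1).
  apply: (fr_mul QR).
    apply: (fr_sum QR) => i; apply: (fr_mul QR) => //.
    exact: (fr_cst QR).
  apply: (fr_inv QR); last by move=> x _; rewrite gt_eqF.
  exact: (fr_sum QR).
move=> x Yx; set W := \sum_(i < _) w i x.
have Wne : W != 0 by rewrite gt_eqF // W0.
rewrite -[X in _ - X](mulfK Wne) -mulrBl normrM normfV (ger0_norm (ltW (W0 x))).
rewrite ltr_pdivrMr ?W0 // mulr_sumr -sumrB.
rewrite (le_lt_trans (ler_norm_sum _ _ _)) //.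
apply: (@le_lt_trans _ _ (\sum_(i < size s) (e * w i x + fC * (1 / 3) ^+ N))).
  apply: ler_sum => i _; rewrite -mulrBl normrM (ger0_norm (ltW (w0 i x))).
  have [_ h0 hN] := ns i (ltn_ord i).
  have [hi|hi] := leP (1 / 3) ((nth (0, fun=> 0) s i).2 x).
    rewrite ler_wpDr //; last by rewrite ler_wpM2r ?(ltW (w0 _ _)) // hN.
    by rewrite mulr_ge0 ?exprn_ge0 // ltW.
  rewrite ler_wpDl //; first by rewrite mulr_ge0 // ltW.
  rewrite ler_pM ?(ltW (w0 _ _)) ?HC ?ltn_ord //.
  by rewrite lerXn2r ?nnegrE // ltW.
rewrite big_split /= -mulr_sumr sumr_const card_ord -/W -[_ *+ size s]mulr_natl.
have WN : (1 / 2) ^+ N <= W.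
  have [i si hi] := sY x Yx.
  rewrite /W (bigD1 (Ordinal si)) //= ler_wpDr //.
    by apply: sumr_ge0 => j _; rewrite ltW.
  by rewrite lerXn2r ?nnegrE // ltW //; have [_ h0 _] := ns i si.
have -> : (1 / 3 : R) = (2 / 3) * (1 / 2) by field.
rewrite exprMn !mulrA.
have : (size s)%:R * fC * (2 / 3) ^+ N * (1 / 2) ^+ N < e * W.
  have p0 : 0 < (1 / 2 : R) ^+ N by apply: exprn_gt0; apply: divr_gt0.
  by apply: lt_le_trans (ler_wpM2l (ltW e0) WN); rewrite ltr_pM2r.
rewrite -!mulrA; lra.
Qed.

End Approximation.

(** * Equivariant matrices and nearby projections *)

Section Equivariance.
Context (R : realFieldType) (I : Type) (conj : I -> I).

(* Multiplication by scalars on the real space underlying an F-vector space: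
   [J a] is the matrix of the multiplication by [a], with adjoint [J (conj a)]. *)
Definition scalar_action n (J : I -> 'M[R]_n) := forall a, (J a)^T = J (conj a).

Definition equivariant m n (J : I -> 'M[R]_m) (J' : I -> 'M[R]_n)
  (A : 'M[R]_(m, n)) := forall a, J a *m A = A *m J' a.

Lemma equivariant1 n (J : I -> 'M[R]_n) : equivariant J J 1%:M.
Proof. by move=> a; rewrite mulmx1 mul1mx. Qed.

Lemma equivariant0 m n (J : I -> 'M[R]_m) (J' : I -> 'M[R]_n) :
  equivariant J J' 0.
Proof. by move=> a; rewrite mulmx0 mul0mx. Qed.

Context (m n p : nat) (J : I -> 'M[R]_m) (J' : I -> 'M[R]_n)
  (J'' : I -> 'M[R]_p).
Hypotheses (cJ : scalar_action J) (cJ' : scalar_action J').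

Lemma equivariantD (A B : 'M[R]_(m, n)) :
  equivariant J J' A -> equivariant J J' B -> equivariant J J' (A + B).
Proof. by move=> eA eB a; rewrite mulmxDr mulmxDl eA eB. Qed.

Lemma equivariantN (A : 'M[R]_(m, n)) :
  equivariant J J' A -> equivariant J J' (- A).
Proof. by move=> eA a; rewrite mulmxN mulNmx eA. Qed.

Lemma equivariantZ c (A : 'M[R]_(m, n)) :
  equivariant J J' A -> equivariant J J' (c *: A).
Proof. by move=> eA a; rewrite -scalemxAr -scalemxAl eA. Qed.

Lemma equivariantM (A : 'M[R]_(m, n)) (B : 'M[R]_(n, p)) :
  equivariant J J' A -> equivariant J' J'' B -> equivariant J J'' (A *m B).
Proof. by move=> eA eB a; rewrite mulmxA eA -mulmxA eB mulmxA. Qed.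

Lemma equivariant_tr (A : 'M[R]_(m, n)) :
  involutive conj -> equivariant J J' A -> equivariant J' J A^T.
Proof.
move=> cK eA a; apply: trmx_inj; rewrite !trmx_mul trmxK.
by rewrite cJ cJ' eA.
Qed.

Lemma equivariant_inv (A : 'M[R]_m) :
  A \in unitmx -> equivariant J J A -> equivariant J J (invmx A).
Proof.
move=> uA eA a; apply: (can_inj (mulKmx uA)).
by rewrite mulmxA -eA mulmxK // mulKVmx.
Qed.

End Equivariance.

Section EquivariantPinv.
Context (R : realFieldType) (I : Type) (conj : I -> I) (m n : nat).
Context (J : I -> 'M[R]_m) (J' : I -> 'M[R]_n).
Hypotheses (cK : involutive conj) (cJ : scalar_action conj J)
  (cJ' : scalar_action conj J').

Lemma equivariant_gram (P : 'M[R]_m) (A : 'M[R]_(m, n)) :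
  equivariant J J P -> equivariant J J' A -> equivariant J J (gram P A).
Proof.
move=> eP eA; apply: equivariantD.
  by apply: equivariantM => //; exact: equivariant_tr.
by apply: equivariantD; [exact: equivariant1|exact: equivariantN].
Qed.

Lemma equivariant_pinv (P : 'M[R]_m) (A : 'M[R]_(m, n)) :
  gram P A \in unitmx -> equivariant J J P -> equivariant J J' A ->
  equivariant J' J (pinv P A).
Proof.
move=> uG eP eA; apply: equivariantM; first exact: equivariant_tr.
by apply: equivariant_inv => //; exact: equivariant_gram.
Qed.

Lemma equivariant_rowproj (P : 'M[R]_m) (A : 'M[R]_(m, n)) :
  gram P A \in unitmx -> equivariant J J P -> equivariant J J' A ->
  equivariant J' J' (rowproj P A).
Proof. by move=> uG eP eA; apply: equivariantM => //; exact: equivariant_pinv. Qed.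

End EquivariantPinv.

Lemma orthproj_close (R : realFieldType) n (P Q : 'M[R]_n) :
  entry_norm (P - Q) < 1 -> injective_on P Q.
Proof.
move=> PQ v vP vQ; apply: entry_norm_eq0; rewrite leNgt; apply/negP => v0.
have : entry_norm v <= entry_norm v * entry_norm (P - Q).
  by rewrite -{1}(subr0 v) -{1}vP -vQ -mulmxBr; exact: entry_normM.
by apply/negP; rewrite -ltNge gtr_pMr.
Qed.

Lemma orthproj_close_rank (R : realFieldType) n (P Q : 'M[R]_n) :
  P *m P = P -> Q *m Q = Q -> entry_norm (P - Q) < 1 -> \rank P = \rank Q.
Proof.
move=> PP QQ PQ; apply/eqP; rewrite eqn_leq.
rewrite (injective_on_rank_le PP (orthproj_close PQ) QQ) /=.
apply: (injective_on_rank_le QQ _ PP); apply: orthproj_close.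
by rewrite -opprB entry_normN.
Qed.

(** * Paths of projections *)

Section Homotopy.
Context (R : realType) (T : topologicalType) (I : Type) (m : nat).
Context (J : I -> 'M[R]_m) (B : set T).
Local Notation I01 := (`[0, 1]%classic : set R).

(** [al] is a continuous isomorphism from the image of [P] to that of [Q], extended by 0 to the
    kernel of [P]. Equality of ranks stands for surjectivity. *)
Definition proj_iso (P Q : T -> 'M[R]_m) := exists al : T -> 'M[R]_m,
  mxfun (cts_on B) al /\ forall y, B y -> [/\ equivariant J J (al y),
    P y *m al y = al y, al y *m Q y = al y, injective_on (P y) (al y) &
    \rank (P y) = \rank (Q y)].

Lemma proj_iso_trans P Q S : proj_iso P Q -> proj_iso Q S -> proj_iso P S.
Proof.
move=> [al [cal Hal]] [be [cbe Hbe]]; exists (fun y => al y *m be y); split.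
  by apply: (mxfunM (@cts_on_funring R T B)).
move=> y By; have [e1 P1 Q1 i1 r1] := Hal y By.
have [e2 P2 Q2 i2 r2] := Hbe y By; split.
- exact: equivariantM e1 e2.
- by rewrite mulmxA P1.
- by rewrite -mulmxA Q2.
- move=> v vP; rewrite mulmxA => vab; apply: i1 => //; apply: i2 => //.
  by rewrite -mulmxA Q1.
- by rewrite r1.
Qed.

Lemma proj_iso_close (P Q : T -> 'M[R]_m) :
  mxfun (cts_on B) P -> mxfun (cts_on B) Q ->
  (forall y, B y -> [/\ orthproj (P y), orthproj (Q y), equivariant J J (P y),
     equivariant J J (Q y) & entry_norm (P y - Q y) < 1]) ->
  proj_iso P Q.
Proof.
move=> cP cQ H; exists (fun y => P y *m Q y); split.
  by apply: (mxfunM (@cts_on_funring R T B)).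
move=> y By; have [[PT PP] [QT QQ] eP eQ PQ] := H y By; split.
- exact: equivariantM eP eQ.
- by rewrite mulmxA PP.
- by rewrite -mulmxA QQ.
- by move=> v vP; rewrite mulmxA vP => vQ; exact: (orthproj_close PQ).
- exact: orthproj_close_rank.
Qed.

(* A path of projections is cut into steps shorter than [1], along which the
   product of the two ends is an isomorphism of images. *)
Lemma proj_iso_homotopy (G : T * R -> 'M[R]_m) : compact B ->
  mxfun (cts_on (B `*` I01)) G ->
  (forall y t, B y -> I01 t -> orthproj (G (y, t)) /\ equivariant J J (G (y, t))) ->
  proj_iso (fun y => G (y, 0)) (fun y => G (y, 1)).
Proof.
move=> cB cG oG.
have cBI : compact (B `*` I01).
  by apply: compact_setX => //; exact: segment_compact.
(* Uniform continuity in time, from compactness: a step shorter than [d] moves [G] by less than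
   1. *)
have : \forall d \near 0^'+, forall z : T * R, (B `*` I01) z ->
    forall s, I01 s -> `|s - z.2| < d -> entry_norm (G (z.1, s) - G z) < 1.
  apply: (@compact_near (T * R)%type _ R (0^'+) (fun d z =>
    forall s, I01 s -> `|s - z.2| < d -> entry_norm (G (z.1, s) - G z) < 1)).
  - exact: cBI.
  move=> [y0 t0] zB; have h2 : 0 < 1 / 2 :> R by [].
  have [[U V] /= [y0U /nbhs_ballP[eta /= eta0 etaV]] UV] := mxfun_near cG zB h2.
  exists (U `*` ball t0 (eta / 2), [set d | d < eta / 2]) => /=.
    split; last by apply: nbhs_right_lt; rewrite divr_gt0.
    exists (U, ball t0 (eta / 2)) => //=; split=> //.
    by apply: nbhsx_ballx; rewrite divr_gt0.
  move=> [[y t] d] /= [[Uy tt0] de] [By t01] s s01 sd.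
  have VV u : I01 u -> `|t0 - u| < eta -> entry_norm (G (y, u) - G (y0, t0)) < 1 / 2.
    move=> u01 tu; apply: (UV (y, u)) => //=; split=> //; apply: etaV.
    by rewrite -ball_normE.
  move: tt0; rewrite -ball_normE /= => tt0.
  have tN : entry_norm (G (y, t) - G (y0, t0)) < 1 / 2 by apply: VV => //; lra.
  have sN : entry_norm (G (y, s) - G (y0, t0)) < 1 / 2.
    apply: VV => //; rewrite -(subrKA t) (le_lt_trans (ler_normD _ _)) //.
    by rewrite (distrC t s); lra.
  rewrite -(subrKA (G (y0, t0))) (le_lt_trans (entry_normD _ _)) //.
  by rewrite -[X in _ + entry_norm X]opprB entry_normN; lra.
move=> /(filterI (nbhs_right_gt 0)) /filter_ex[d [d0 Hd]].
pose N := Num.bound d^-1.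
have dN : d^-1 < N%:R by apply: archi_boundP; rewrite invr_ge0 ltW.
have N0 : 0 < N%:R :> R by rewrite (lt_trans _ dN) // invr_gt0.
have iN (i : nat) : (i <= N)%N -> I01 (i%:R / N%:R).
  move=> iN; rewrite /= in_itv /= divr_ge0 ?ler0n //=.
  by rewrite ler_pdivrMr // mul1r ler_nat.
have cGt t : I01 t -> mxfun (cts_on B) (fun y => G (y, t)).
  move=> t01 i j; apply: near_cts_on => y By e e0.
  have yt : (B `*` I01) (y, t) by [].
  have [[U V] /= [yU tV] UV] := cts_on_near (cG i j) yt e0.
  apply: filterS yU => z Uz Bz; apply: (UV (z, t)) => //; split=> //=.
  exact: nbhs_singleton tV.
suff H i : (i <= N)%N -> proj_iso (fun y => G (y, 0)) (fun y => G (y, i%:R / N%:R)).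
  by have := H N (leqnn N); rewrite divff // gt_eqF.
elim: i => [|i IH] iN1.
  rewrite mul0r; apply: proj_iso_close; try exact/cGt/(iN 0%N).
    by have := cGt _ (iN 0%N isT); rewrite mul0r.
    by have := cGt _ (iN 0%N isT); rewrite mul0r.
  move=> y By; have [P0 e0] : orthproj (G (y, 0)) /\ equivariant J J (G (y, 0)).
    by apply: oG => //; have := iN 0%N isT; rewrite mul0r.
  by split=> //; rewrite subrr entry_norm0.
apply: (proj_iso_trans (IH (ltnW iN1))).
have i01 := iN i (ltnW iN1); have i101 := iN i.+1 iN1.
apply: proj_iso_close; [exact: cGt|exact: cGt|move=> y By].
have [P1 e1] := oG y _ By i01; have [P2 e2] := oG y _ By i101.
split=> //; apply: (Hd (y, i.+1%:R / N%:R)) => //=.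
rewrite -mulrBl normrM normfV (ger0_norm (ltW N0)) -natr1 opprD addrA subrr.
by rewrite sub0r normrN1 mul1r invf_plt ?posrE.
Qed.

End Homotopy.

Section Core.
Context (R : realType) (T : topologicalType) (A : set (T -> R)).
Hypotheses (hA : separating_algebra A) (cT : compact [set: T]).

Section EquivariantApproximation.
Context (I : Type) (m n : nat) (J : I -> 'M[R]_m) (J' : I -> 'M[R]_n).
Context (eqv : {linear 'M[R]_(m, n) -> 'M[R]_(m, n)}).
Hypotheses (eqvP : forall M, equivariant J J' (eqv M))
  (eqv_id : forall M, equivariant J J' M -> eqv M = M).

Lemma eqvE M : eqv M = \sum_i \sum_j M i j *: eqv (delta_mx i j).
Proof.
rewrite {1}(matrix_sum_delta M) linear_sum; apply: eq_bigr => i _.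
by rewrite linear_sum; apply: eq_bigr => j _; rewrite linearZ.
Qed.

Lemma mxfun_eqv D S (M : T -> 'M[R]_(m, n)) :
  funring D S -> mxfun S M -> mxfun S (fun x => eqv (M x)).
Proof.
move=> SR SM i j; apply: (fr_ext SR
  (f := fun x => \sum_k \sum_l M x k l * eqv (delta_mx k l) i j)).
  apply: (fr_sum SR) => k; apply: (fr_sum SR) => l; apply: (fr_mul SR) => //.
  exact: (fr_cst SR).
move=> x _; rewrite eqvE summxE; apply: eq_bigr => k _.
by rewrite summxE; apply: eq_bigr => l _; rewrite mxE.
Qed.

Lemma entry_norm_eqv : exists2 C : R, 0 < C &
  forall (M : 'M[R]_(m, n)) e, 0 <= e -> (forall i j, `|M i j| <= e) ->
  entry_norm (eqv M) <= C * e.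
Proof.
pose C := \sum_i \sum_j entry_norm (eqv (delta_mx i j)).
have C0 : 0 <= C.
  by apply: sumr_ge0 => i _; apply: sumr_ge0 => j _; exact: entry_norm_ge0.
exists (C + 1); first by rewrite ltr_wpDl.
move=> M e e0 Me.
apply: (@le_trans _ _ (C * e)); last by rewrite ler_wpM2r // lerDl.
rewrite eqvE /C mulr_suml.
have nsum (K : finType) (F : K -> 'M[R]_(m, n)) :
    entry_norm (\sum_k F k) <= \sum_k entry_norm (F k).
  elim/big_ind2: _ => [|x1 x2 y1 y2 h1 h2|//].
    by rewrite entry_norm0.
  by rewrite (le_trans (entry_normD _ _)) // lerD.
rewrite (le_trans (nsum _ _)) //; apply: ler_sum => k _.
rewrite (le_trans (nsum _ _)) // mulr_suml; apply: ler_sum => l _.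
rewrite /entry_norm mulr_suml; apply: ler_sum => i' _.
rewrite mulr_suml; apply: ler_sum => j' _.
by rewrite mxE normrM mulrC ler_wpM2l.
Qed.

(** The entries are approximated separately, then [eqv] restores equivariance and fixes [f]. The
    constant comes from [eqv] alone and precedes [e], so that [e] can be chosen from margins. Asking
    only for oscillation less than [e] admits the glued map of [extend_projection]. *)
Lemma mx_approx : exists2 C : R, 0 < C & forall (Y : set T) (f : T -> 'M[R]_(m, n)) e,
  compact Y -> 0 < e -> (forall x, Y x -> equivariant J J' (f x)) ->
  (forall a, Y a -> \forall x \near a, Y x -> entry_norm (f x - f a) < e) ->
  exists g : T -> 'M[R]_(m, n), [/\ mxfun (quotients A setT) g,
    forall x, equivariant J J' (g x) &
    forall x, Y x -> entry_norm (g x - f x) <= C * e].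
Proof.
have [C C0 HC] := entry_norm_eqv; exists (C * 2); first by rewrite mulr_gt0.
move=> Y f e cY e0 ef fe.
have H i j : exists g, quotients A setT g /\ forall x, Y x -> `|g x - f x i j| < 2 * e.
  have [|g Qg Hg] := @approx R T A hA cT Y (fun x => f x i j) e cY e0.
    move=> a Ya; apply: filterS (fe a Ya) => x /[apply]; apply: le_lt_trans.
    by have := entry_norm_ge (f x - f a) i j; rewrite !mxE.
  by exists g.
pose g i j := projT1 (cid (H i j)).
have Qg i j : quotients A setT (g i j) by rewrite /g; case: cid => ? [].
have Hg i j x : Y x -> `|g i j x - f x i j| < 2 * e.
  by rewrite /g; case: cid => /= ? [_]; exact.
exists (fun x => eqv (\matrix_(i, j) g i j x)); split.
- apply: (mxfun_eqv (quotients_funring hA setT)) => i j.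
  by apply: (fr_ext (quotients_funring hA setT) (Qg i j)) => x _; rewrite mxE.
- by move=> x; exact: eqvP.
- move=> x Yx; rewrite -[f x](eqv_id (ef x Yx)) -linearB -mulrA; apply: HC.
    by rewrite mulr_ge0 // ltW.
  by move=> i j; rewrite !mxE ltW // Hg.
Qed.

End EquivariantApproximation.

Section Cells.
Context (cells : Type) (cell : T -> cells).

Definition piecewise_regular : set (T -> R) :=
  [set f | continuous f /\ forall c, quotients A [set x | cell x = c] f].

Lemma piecewise_regular_funring : funring setT piecewise_regular.
Proof.
have F := @cts_on_funring R T setT; have G c := quotients_funring hA [set x | cell x = c].
split.
- by move=> k; split=> [|c]; [exact/cts_onT/(fr_cst F)|exact: (fr_cst (G c))].
- move=> f g [cf rf] [cg rg]; split=> [|c]; last exact: (fr_add (G c)).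
  by apply/cts_onT; apply: (fr_add F); exact/cts_onT.
- move=> f g [cf rf] [cg rg]; split=> [|c]; last exact: (fr_mul (G c)).
  by apply/cts_onT; apply: (fr_mul F); exact/cts_onT.
- move=> f [cf rf] f0; split=> [|c].
    by apply/cts_onT; apply: (fr_inv F) => //; exact/cts_onT.
  by apply: (fr_inv (G c)) => // x _; exact: f0.
- move=> f g [cf rf] fg; split=> [|c].
    by apply/cts_onT; apply: (fr_ext F) fg; exact/cts_onT.
  by apply: (fr_ext (G c) (rf c)) => x _; exact: fg.
Qed.

Lemma quotients_piecewise f : quotients A setT f -> piecewise_regular f.
Proof.
move=> Qf; split=> [|c]; first exact: quotients_continuous Qf.
exact: quotientsS Qf.
Qed.

(** That is, the zero set of [D] is a union of cells. *)
Definition saturated (D : T -> R) :=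
  forall x y, cell x = cell y -> D x = 0 -> D y = 0.

(* At common zeros of [D] and [D'] the quotient is [0 / 0 = 0]. *)
Lemma piecewise_cutoff D D' s : piecewise_regular D -> piecewise_regular D' ->
  (forall x, 0 <= D x) -> (forall x, 0 <= D' x) ->
  saturated D -> saturated D' -> piecewise_regular s ->
  (forall x, D x = 0 -> D' x = 0 -> s x = 0) ->
  piecewise_regular (fun x => D x / (D x + D' x) * s x).
Proof.
move=> pD pD' D0 D'0 sD sD' ps s0.
have F := @cts_on_funring R T setT; have G c := quotients_funring hA [set x | cell x = c].
have [cD rD] := pD; have [cD' rD'] := pD'; have [cs rs] := ps.
have eq0 x : D x + D' x = 0 -> D x = 0 /\ D' x = 0.
  by move/eqP; rewrite paddr_eq0 // => /andP[/eqP-> /eqP->].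
split=> [x|c].
  have [/eq0[Dx D'x]|t0] := eqVneq (D x + D' x) 0.
    (* At a common zero [s] tends to 0 while the cutoff factor stays between 0 and 1. *)
    have := cs x; rewrite /continuous_at (s0 x Dx D'x) mulr0.
    move=> /cvgr0Pnorm_lt H; apply/cvgr0Pnorm_lt => e e0.
    apply: filterS (H e e0) => y; apply: le_lt_trans.
    rewrite normrM ler_piMl //.
    rewrite ger0_norm ?divr_ge0 ?addr_ge0 //.
    have [->|ty] := eqVneq (D y + D' y) 0; first by rewrite invr0 mulr0.
    by rewrite ler_pdivrMr ?mul1r ?lerDl // lt_def ty addr_ge0.
  apply: cvgM; last exact: cs.
  by apply: cvgM; [exact: cD|apply: cvgV => //; apply: cvgD; [exact: cD|exact: cD']].
(* By saturation [D] vanishes on the whole of a cell that meets the common zeros; on any other cell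
   the denominator has no zero. *)
have [[x [xc /eq0[Dx D'x]]]|nc] := pselect (exists x, cell x = c /\ D x + D' x = 0).
  apply: (fr_ext (G c) (fr_cst (G c) 0)) => y yc.
  have Dy : D y = 0 by apply: sD Dx; rewrite xc yc.
  by rewrite Dy mul0r mul0r.
apply: (fr_mul (G c)) => //; apply: (fr_mul (G c)) => //.
apply: (fr_inv (G c)); first exact: (fr_add (G c)).
by move=> x xc; apply/eqP => tx; apply: nc; exists x.
Qed.

End Cells.
End Core.

(** * Extension of piecewise regular projections *)

Section Extension.
Context (R : realType) (T : topologicalType) (A : set (T -> R)).
Hypotheses (hA : separating_algebra A) (cT : compact [set: T]).
Context (cells : Type) (cell : T -> cells).
Local Notation S := (piecewise_regular A cell).
Let SR : funring setT S := piecewise_regular_funring hA cell.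

Lemma zeros_closed d : S d -> closed [set x | d x = 0].
Proof.
by move=> [cd _]; apply: (@preimage_closed _ _ d [set 0]) => //; exact: closed_eq.
Qed.

Lemma zeros_compact d : S d -> compact [set x | d x = 0].
Proof. by move=> Sd; apply: (subclosed_compact _ cT) => //; exact: zeros_closed. Qed.

Lemma mxfun_cts_on D m n (M : T -> 'M[R]_(m, n)) :
  mxfun S M -> mxfun (cts_on D) M.
Proof. by move=> SM i j; apply: continuous_cts_on; have [] := SM i j. Qed.

Context (sc : Type) (conj : sc -> sc) (a r : nat).
Context (Ja : sc -> 'M[R]_a) (Jr : sc -> 'M[R]_r).
Hypotheses (conjK : involutive conj) (cJa : scalar_action conj Ja)
  (cJr : scalar_action conj Jr).
Context (eqv : {linear 'M[R]_(a, r) -> 'M[R]_(a, r)}).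
Hypotheses (eqvP : forall M, equivariant Ja Jr (eqv M))
  (eqv_id : forall M, equivariant Ja Jr M -> eqv M = M).

(** Equal ranks make [al] a bijection from the image of [P] onto that of [P0], and the
    pseudo-inverse is then the inverse isomorphism. *)
Lemma pinv_iso (P P0 al : 'M[R]_a) : orthproj P -> orthproj P0 ->
  P *m al = al -> al *m P0 = al -> injective_on P al -> \rank P = \rank P0 ->
  [/\ al *m pinv P al = P, P0 *m pinv P al = pinv P al,
      pinv P al *m P = pinv P al & injective_on P0 (pinv P al)].
Proof.
move=> oP oP0 Pal alP0 ial rPP0; split.
- exact: mulmx_pinv.
- rewrite /pinv mulmxA; congr (_ *m _).
  by rewrite -[in RHS]alP0 trmx_mul; case: oP0 => ->.
- exact: pinvP.
- move=> v vP0 vbe.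
  have alle : (al <= P0)%MS by rewrite -alP0 submxMl.
  have /andP[_ /submxP[E P0E]] : (al == P0)%MS.
    rewrite -(geq_leqif (mxrank_leqif_eq alle)) -rPP0 -[X in (_ <= \rank X)%N]Pal.
    by rewrite injective_on_rank //; case: oP.
  have vE : v *m E *m P = 0.
    by rewrite -(mulmx_pinv oP Pal ial) mulmxA -(mulmxA v) -P0E vP0.
  by rewrite -vP0 P0E -Pal !mulmxA vE mul0mx.
Qed.

Section Frame.
Context (k d : T -> R).
Hypotheses (Sk : S k) (Sd : S d) (k0 : forall x, 0 <= k x)
  (d0 : forall x, 0 <= d x).
Let Q := [set x | d x = 0].
Let K := [set x | k x = 0].
Context (P0 : 'M[R]_a) (al : T -> 'M[R]_a).
Hypotheses (oP0 : orthproj P0) (eP0 : equivariant Ja Ja P0)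
  (cal : mxfun (cts_on Q) al).
Context (p : T -> 'M[R]_r) (M : T -> 'M[R]_(a, r)) (io : 'M[R]_(a, r)).
Hypotheses (Sp : mxfun S p) (ep : forall x, equivariant Jr Jr (p x))
  (op : forall x, K x -> orthproj (p x)).
Hypotheses (eio : equivariant Ja Jr io) (pio : forall x, p x *m io^T = 0)
  (ioio : io *m io^T = 1%:M).
Hypotheses (cM : mxfun (cts_on (K `&` Q)) M)
  (eM : forall x, (K `&` Q) x -> equivariant Ja Jr (M x))
  (P0M : forall x, (K `&` Q) x -> P0 *m M x = M x)
  (Mp : forall x, (K `&` Q) x -> M x *m p x = M x)
  (iM : forall x, (K `&` Q) x -> injective_on P0 (M x)).

Let F D := @cts_on_funring R T D.
Let cQ : compact Q. Proof. exact: zeros_compact. Qed.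
Let cKQ : compact (K `&` Q).
Proof. by apply: compact_closedI; [exact: zeros_compact|exact: zeros_closed]. Qed.

(* [Phi] approximates [M] on [K `&` Q]; the summand [L (k + d) io], which lives
   in coordinates unused by [p], makes the frame injective off [K `&` Q]. *)
Lemma extend_frame : exists2 C : R, 0 < C & forall e, 0 < e ->
  exists B : T -> 'M[R]_(a, r), [/\ mxfun S B,
    forall x, [/\ equivariant Ja Jr (B x), P0 *m B x = B x &
      injective_on P0 (B x)],
    forall (io' : 'M[R]_(a, r)) x, p x *m io'^T = 0 -> io *m io'^T = 0 ->
      B x *m io'^T = 0,
    forall x, (K `&` Q) x -> B x *m p x = B x /\
      entry_norm (al x *m (B x - M x)) <= e &
    forall x, Q x -> forall v : 'rV_a, v *m P0 = v ->
      entry_norm v <= C * entry_norm (v *m B x)].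
Proof.
have [|C1 C10 HC1] := @mxfun_margin R T (K `&` Q) a r (fun=> P0) M cKQ
    (mxfun_cst (F _) P0) cM.
  by move=> x KQx; split=> //; [exact: P0M|exact: iM].
have [Ca Ca0 HCa] := mxfun_bounded cQ cal.
have [Ce Ce0 HCe] := mx_approx hA cT eqvP eqv_id.
pose c' := entry_norm (1%:M - io^T *m io).
pose ci := entry_norm io^T.
have c'0 : 0 <= c' by exact: entry_norm_ge0.
have ci0 : 0 <= ci by exact: entry_norm_ge0.
(* The first term is the constant near the common zeros of [k] and [d], and [ci] is the one where
   the [io] block dominates. Neither depends on [e]. *)
exists (4 * C1 * c' + ci + 1); first by rewrite ltr_wpDl // addr_ge0 // !mulr_ge0 // ltW.
move=> e e0.
pose g : R := a%:R * a%:R * (r%:R * r%:R) + 1.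
have g0 : 0 < g by rewrite ltr_wpDl // !mulr_ge0.
(* The first bound makes [al *m (B - M)] at most [e], the second keeps [B0] within 1 / (2 C1) of
   [M]. *)
pose e1 := Num.min (e / (Ca * g * Ce)) (1 / (2 * C1 * g * Ce)).
have e10 : 0 < e1.
  by rewrite lt_min !divr_gt0 ?mulr_gt0.
have [||Phi [SPhi ePhi HPhi]] := HCe (K `&` Q) M e1 cKQ e10.
- exact: eM.
- by move=> y KQy; exact: mxfun_near.
have {}SPhi : mxfun S Phi by move=> i j; exact: (quotients_piecewise hA).
pose B0 x := P0 *m Phi x *m p x.
have SB0 : mxfun S B0.
  by apply: (mxfunM SR) => //; apply: (mxfunM SR) => //; exact: (mxfun_cst SR).
have B0M x : (K `&` Q) x -> entry_norm (B0 x - M x) <= g * (Ce * e1).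
  move=> KQx; have [Kx Qx] := KQx.
  have -> : B0 x - M x = P0 *m (Phi x - M x) *m p x.
    by rewrite mulmxBr mulmxBl P0M // Mp.
  rewrite (le_trans (entry_normM _ _)) //.
  rewrite (le_trans (ler_wpM2r (entry_norm_ge0 _) (entry_normM _ _))) //.
  have h1 := orthproj_entry_norm oP0; have h2 := orthproj_entry_norm (op Kx).
  have h3 := HPhi x KQx; have h4 := entry_norm_ge0 (Phi x - M x).
  rewrite mulrAC (le_trans (ler_pM _ _ (ler_pM _ _ h1 h2) h3)) //.
  - by rewrite mulr_ge0 // entry_norm_ge0.
  - exact: entry_norm_ge0.
  - exact: entry_norm_ge0.
  - by apply: ler_wpM2r; [rewrite mulr_ge0 // ltW|rewrite /g lerDl].
have c10 : 0 <= 2 * C1 by rewrite mulr_ge0 // ltW.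
have c20 : 0 <= 2 * (2 * C1) by rewrite mulr_ge0.
have c40 : 0 <= 4 * C1 * c' by rewrite mulr_ge0 // mulr_ge0 // ltW.
have B0marg x (KQx : (K `&` Q) x) : forall v : 'rV_a, v *m P0 = v ->
    entry_norm v <= 2 * C1 * entry_norm (v *m B0 x).
  apply: (injective_on_perturb (HC1 x KQx)); first exact: ltW.
  apply: (le_trans (ler_wpM2l c10 (B0M x KQx))).
  have : e1 <= 1 / (2 * C1 * g * Ce) by rewrite ge_min lexx orbT.
  rewrite ler_pdivlMr ?mulr_gt0 // => h; apply: le_trans h.
  by rewrite le_eqVlt; apply/predU1P; left; ring.
pose t x := k x + d x.
have t0 x : 0 <= t x by rewrite addr_ge0.
have St : S t by exact: (fr_add SR).
pose B (L : R) x := B0 x + (L * t x) *: (P0 *m io).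
have Bio L x : B L x *m io^T = (L * t x) *: P0.
  by rewrite mulmxDl -(mulmxA _ (p x)) pio mulmx0 add0r -scalemxAl -mulmxA ioio mulmx1.
(* The [io] component of [v *m B L x] is [L * t x] times [v]; removing it recovers [B0], so the
   margin of [B0] passes to [B L] for every [L]. *)
have BB0 L x (v : 'rV_a) : v *m P0 = v -> v *m B0 x = v *m B L x *m (1%:M - io^T *m io).
  move=> vP0; rewrite (mulmxBr (v *m B L x)) mulmx1 (mulmxA (v *m B L x)).
  rewrite -(mulmxA v (B L x)) Bio -(scalemxAr _ v) vP0.
  rewrite /B mulmxDr -(scalemxAr _ v) (mulmxA v P0) vP0 -(scalemxAl _ v).
  by rewrite addrK.
have : \forall L \near +oo, forall x, Q x -> (fun L x => forall v : 'rV_a, v *m P0 = v ->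
    entry_norm v <= (4 * C1 * c' + ci + 1) * entry_norm (v *m B L x)) L x.
  apply: (@compact_near T Q R +oo%R (fun L x => forall v : 'rV_a, v *m P0 = v ->
    entry_norm v <= (4 * C1 * c' + ci + 1) * entry_norm (v *m B L x))) => // x Qx.
  (* Near a common zero the perturbed [B0] is injective by itself, whatever [L] is. At the other
     points of [Q] the value [t x] is positive, and [L] beyond 2 / t x makes [L * t] at least 1
     nearby. *)
  have [kx|kx] := eqVneq (k x) 0.
    have KQx : (K `&` Q) x by [].
    have e4 : 0 < 1 / (4 * C1) by rewrite divr_gt0 // mulr_gt0.
    have := mxfun_near (mxfun_cts_on (D := setT) SB0) (I : setT x) e4.
    move=> H; exists ([set y | setT y -> entry_norm (B0 y - B0 x) < 1 / (4 * C1)], setT) => /=.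
      by split=> //; exact: filterT.
    move=> [y L] /= [/(_ I) yx _] Qy v vP0.
    have nBA : 2 * (2 * C1) * entry_norm (B0 y - B0 x) <= 1.
      move: yx; rewrite ltr_pdivlMr ?mulr_gt0 // => /ltW h; apply: le_trans h.
      by rewrite le_eqVlt; apply/predU1P; left; ring.
    apply: (le_trans (injective_on_perturb (B0marg x KQx) c10 nBA vP0)).
    rewrite (BB0 L) //.
    have nB : entry_norm (v *m B L y *m (1%:M - io^T *m io)) <= entry_norm (v *m B L y) * c'.
      exact: entry_normM.
    apply: (le_trans (ler_wpM2l c20 nB)).
    rewrite mulrCA mulrC; apply: ler_wpM2r; first exact: entry_norm_ge0.
    have -> : 2 * (2 * C1) * c' = 4 * C1 * c' by ring.
    by rewrite -addrA lerDl addr_ge0.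
  have tx : 0 < t x.
    rewrite ltr_pwDl // ?d0 // lt_def kx; exact: k0.
  have ht2 : 0 < t x / 2 by rewrite divr_gt0.
  have ct : cts_on setT t by apply: continuous_cts_on; case: St.
  have := cts_on_near ct (I : setT x) ht2 => H.
  exists ([set y | setT y -> `|t y - t x| < t x / 2], [set L | 2 / t x < L]) => /=.
    by split=> //; apply: nbhs_pinfty_gt; exact: num_real.
  move=> [y L] /= [/(_ I) yx xL] Qy v vP0.
  have ty : t x / 2 < t y.
    by move: yx; rewrite ltr_distl => /andP[+ _]; rewrite {1}(splitr (t x)) addrK.
  have Lt1 : 1 <= L * t y.
    have L0 : 0 < L by rewrite (lt_trans _ xL) // divr_gt0.
    apply: (@le_trans _ _ (L * (t x / 2))); last by rewrite ler_wpM2l // ltW.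
    by rewrite mulrA ler_pdivlMr // mul1r -ler_pdivrMr // ltW.
  have vn : entry_norm v <= entry_norm ((L * t y) *: v).
    rewrite /entry_norm; apply: ler_sum => i _; apply: ler_sum => j _.
    rewrite mxE normrM ler_peMl // (le_trans Lt1) // ler_norm //.
  apply: (le_trans vn).
  have -> : (L * t y) *: v = v *m B L y *m io^T.
    by rewrite -mulmxA Bio -scalemxAr vP0.
  rewrite (le_trans (entry_normM _ _)) // mulrC ler_wpM2r ?entry_norm_ge0 //.
  by rewrite addrAC lerDr addr_ge0.
move=> HL; have [L [L0 {}HL]] : exists L : R, 0 < L /\ forall x, Q x ->
    forall v : 'rV_a, v *m P0 = v ->
    entry_norm v <= (4 * C1 * c' + ci + 1) * entry_norm (v *m B L x).
  by apply: (@filter_ex _ +oo%R); apply: filterI HL; apply: nbhs_pinfty_gt; exact: num_real.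
have Lt_gt0 x : ~ (K `&` Q) x -> 0 < L * t x.
  move=> nKQ; rewrite mulr_gt0 // lt_def t0 andbT; apply/eqP => /eqP.
  by rewrite paddr_eq0 // => /andP[/eqP kx /eqP dx]; exact: nKQ.
exists (B L); split.
- apply: (mxfunD SR) => //; apply: (mxfunZ SR).
    by apply: (fr_mul SR) => //; exact: (fr_cst SR).
  exact: (mxfun_cst SR).
- move=> x; split.
  + apply: equivariantD.
      by apply: equivariantM (ep x); apply: equivariantM eP0 (ePhi x).
    by apply: equivariantZ; apply: equivariantM eP0 eio.
  + case: oP0 => _ PP; by rewrite /B /B0 mulmxDr -scalemxAr !mulmxA PP.
  + move=> v vP0 vB; have [KQx|nKQ] := pselect ((K `&` Q) x).
      by apply: (margin_injective (B0marg x KQx)) => //; rewrite (BB0 L) // vB mul0mx.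
    have : v *m B L x *m io^T = 0 by rewrite vB mul0mx.
    rewrite -mulmxA Bio -scalemxAr vP0 => /eqP; rewrite scaler_eq0.
    by rewrite gt_eqF ?Lt_gt0 //= => /eqP.
- move=> io' x pio' ioio'; rewrite mulmxDl -(mulmxA _ (p x)) pio' mulmx0 add0r.
  by rewrite -scalemxAl -mulmxA ioio' mulmx0 scaler0.
- move=> x KQx; have [Kx Qx] := KQx; have BE : B L x = B0 x.
    by rewrite /B /t Kx Qx addr0 mulr0 scale0r addr0.
  rewrite BE; split; first by case: (op Kx) => _ pp; rewrite /B0 -mulmxA pp.
  rewrite (le_trans (entry_normM _ _)) //.
  rewrite (le_trans (ler_pM _ _ (HCa x Qx) (B0M x KQx))) ?entry_norm_ge0 //.
  have : e1 <= e / (Ca * g * Ce) by rewrite ge_min lexx.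
  rewrite ler_pdivlMr ?mulr_gt0 // => h; apply: le_trans h.
  by rewrite le_eqVlt; apply/predU1P; left; ring.
- exact: HL.
Qed.

End Frame.
End Extension.

(** * Passage to one more sublevel set *)

Section Step.
Context (R : realType) (T : topologicalType) (A : set (T -> R)).
Hypotheses (hA : separating_algebra A) (cT : compact [set: T]).
Context (cells : Type) (cell : T -> cells).
Local Notation S := (piecewise_regular A cell).
Let SR : funring setT S := piecewise_regular_funring hA cell.
Context (sc : Type) (adj : sc -> sc) (a r : nat).
Context (Ja : sc -> 'M[R]_a) (Jr : sc -> 'M[R]_r).
Hypotheses (adjK : involutive adj) (cJa : scalar_action adj Ja)
  (cJr : scalar_action adj Jr).
Context (eqv : {linear 'M[R]_(a, r) -> 'M[R]_(a, r)}).
Hypotheses (eqvP : forall M, equivariant Ja Jr (eqv M))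
  (eqv_id : forall M, equivariant Ja Jr M -> eqv M = M).
Context (pi : T -> 'M[R]_a).
Hypotheses (cpi : mxfun (cts_on setT) pi) (opi : forall x, orthproj (pi x))
  (epi : forall x, equivariant Ja Ja (pi x)).

(** A single [u'] approximates the isomorphism from [pi] to [p'] over the zeros of [k] and of [d]
    together. The block of [io] is used up in the step, while the blocks orthogonal to it and to [p]
    remain free for later ones. *)
Lemma extend_projection (k d : T -> R) (P0 : 'M[R]_a) (p : T -> 'M[R]_r)
    (u : T -> 'M[R]_(a, r)) (io : 'M[R]_(a, r)) :
  S k -> S d -> (forall x, 0 <= k x) -> (forall x, 0 <= d x) ->
  saturated cell k -> saturated cell d ->
  orthproj P0 -> equivariant Ja Ja P0 ->
  proj_iso Ja [set x | d x = 0] pi (fun=> P0) ->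
  mxfun S p -> mxfun S u ->
  (forall x, [/\ (p x)^T = p x, equivariant Jr Jr (p x) &
    equivariant Ja Jr (u x)]) ->
  equivariant Ja Jr io -> (forall x, p x *m io^T = 0) -> io *m io^T = 1%:M ->
  (forall x, k x = 0 -> [/\ p x *m p x = p x, \rank (p x) = \rank (pi x) &
    injective_on (pi x) (u x *m p x)]) ->
  exists (p' : T -> 'M[R]_r) (u' : T -> 'M[R]_(a, r)),
  [/\ mxfun S p', mxfun S u',
    forall x, [/\ (p' x)^T = p' x, equivariant Jr Jr (p' x) &
      equivariant Ja Jr (u' x)],
    forall (io' : 'M[R]_(a, r)) x, p x *m io'^T = 0 -> io *m io'^T = 0 ->
      p' x *m io'^T = 0 &
    forall x, k x * d x = 0 -> [/\ p' x *m p' x = p' x,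
      \rank (p' x) = \rank (pi x) & injective_on (pi x) (u' x *m p' x)]].
Proof.
move=> Sk Sd k0 d0 sk sd oP0 eP0 [al [cal Hal]] Sp Su pu eio pio ioio HK.
have F D := @cts_on_funring R T D.
pose Q := [set x | d x = 0]; pose K := [set x | k x = 0].
have cK : compact K by exact: zeros_compact Sk.
have cQ : compact Q by exact: zeros_compact Sd.
have clK : closed K by exact: zeros_closed Sk.
have clQ : closed Q by exact: zeros_closed Sd.
have cpiD D : mxfun (cts_on D) pi.
  by move=> i j; apply: (cts_onS _ (@cpi i j)).
have ep x : equivariant Jr Jr (p x) by case: (pu x).
have eu x : equivariant Ja Jr (u x) by case: (pu x).
have op x : K x -> orthproj (p x).
  by move=> /HK[pp _ _]; split=> //; case: (pu x).
have [be [cbe ebe beP]] : exists be : T -> 'M[R]_a, [/\ mxfun (cts_on Q) be,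
    forall x, Q x -> equivariant Ja Ja (be x) &
    forall x, Q x -> [/\ al x *m be x = pi x, P0 *m be x = be x,
      be x *m pi x = be x & injective_on P0 (be x)]].
  have ug x : Q x -> gram (pi x) (al x) \in unitmx.
    by move=> /Hal[_ ? ? ? ?]; exact: gram_unit.
  exists (fun x => pinv (pi x) (al x)); split.
  - by apply: (mxfun_pinv (F Q)).
  - move=> x Qx; have [? _ _ _ _] := Hal x Qx.
    by apply: (equivariant_pinv adjK) => //; exact: ug.
  - by move=> x /Hal[_ ? ? ? ?]; exact: pinv_iso.
(* The gluing isomorphism: on the overlap it leads from [P0] back to [pi] by [be], then to [p] by
   [u]. *)
have [M [cM eM P0M] [Mp iM alM]] : exists2 M : T -> 'M[R]_(a, r),
    [/\ mxfun (cts_on (K `&` Q)) M,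
      forall x, (K `&` Q) x -> equivariant Ja Jr (M x) &
      forall x, (K `&` Q) x -> P0 *m M x = M x] &
    [/\ forall x, (K `&` Q) x -> M x *m p x = M x,
      forall x, (K `&` Q) x -> injective_on P0 (M x) &
      forall x, (K `&` Q) x -> al x *m M x = pi x *m u x *m p x].
  exists (fun x => be x *m u x *m p x); split.
  - apply: (mxfunM (F _)); last exact: mxfun_cts_on Sp.
    apply: (mxfunM (F _)); last exact: mxfun_cts_on Su.
    by move=> i j; apply: (cts_onS _ (@cbe i j)) => x [].
  - move=> x [Kx Qx]; apply: equivariantM (ep x).
    by apply: equivariantM (eu x); exact: ebe.
  - by move=> x [Kx /beP[_ h _ _]]; rewrite !mulmxA h.
  - by move=> x [/HK[pp _ _] _]; rewrite -mulmxA pp.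
  - move=> x [/HK[pp _ iu] /beP[_ _ bepi ibe]] v vP0 vM.
    apply: ibe => //; apply: iu; first by rewrite -mulmxA bepi.
    by rewrite -vM !mulmxA.
  - by move=> x [Kx /beP[h _ _ _]]; rewrite !mulmxA h.
have [C2 C20 HC2] := extend_frame hA cT eqvP eqv_id Sk Sd k0 d0
  oP0 eP0 cal Sp ep op eio pio ioio cM eM P0M Mp iM.
have [C3 C30 HC3] : exists2 C : R, 0 < C & forall x, K x ->
    forall v : 'rV_a, v *m pi x = v ->
    entry_norm v <= C * entry_norm (v *m (pi x *m u x *m p x)).
  apply: (@mxfun_margin R T K) => // [|x /HK[_ _ iu]].
    apply: (mxfunM (F _)); last exact: mxfun_cts_on Sp.
    by apply: (mxfunM (F _)); last exact: mxfun_cts_on Su.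
  split=> //; first by rewrite !mulmxA; case: (opi x) => _ ->.
  by move=> v vpi h; apply: iu => //; rewrite -h !mulmxA vpi.
have [C4 C40 HC4] := mxfun_margin cQ (cpiD Q) cal
  (fun x Qx => let: And5 _ h _ h' _ := Hal x Qx in And3 (opi x) h h').
have [Ce Ce0 HCe] := mx_approx hA cT eqvP eqv_id.
(* Inverse margin of the glued map [f] below: [C3] on [K], and [C4 * C2] on [Q], where [f] is [al]
   followed by the frame [B]. *)
pose C5 := C3 + C4 * C2.
have C50 : 0 < C5 by rewrite addr_gt0 // mulr_gt0.
pose g : R := r%:R * r%:R + 1.
have g0 : 0 < g by rewrite ltr_wpDl // mulr_ge0.
(* With this accuracy [u' *m p'] lies within 1 / (2 C5) of [f]. *)
pose e := 1 / (2 * C5 * g * Ce).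
have e0 : 0 < e by rewrite divr_gt0 ?mulr_gt0.
have e20 : 0 < e / 2 by rewrite divr_gt0.
have [B [SB HB Bio KQB HBm]] := HC2 _ e20.
have eB x : equivariant Ja Jr (B x) by case: (HB x).
have PB x : P0 *m B x = B x by case: (HB x).
have iB x : injective_on P0 (B x) by case: (HB x).
pose q x := rowproj P0 (B x).
have oq x : orthproj (q x) by exact: rowproj_orth.
have Sq : mxfun S q.
  apply: (mxfun_rowproj SR) => //; first exact: (mxfun_cst SR).
  by move=> x _; exact: gram_unit.
have eq x : equivariant Jr Jr (q x).
  by apply: (equivariant_rowproj adjK cJa cJr) => //; exact: gram_unit.
have Bq x : B x *m q x = B x by exact: mulmx_rowproj.
(* The frame lies in the image of [p] here, so [q] and [p] have nested images of equal rank. *)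
have qp x : (K `&` Q) x -> q x = p x.
  move=> [Kx Qx]; have [_ rp _] := HK x Kx; apply: orthproj_eq => //; first exact: op.
    by have [Bp _] := KQB x (conj Kx Qx); rewrite /q /rowproj -mulmxA Bp.
  by rewrite rank_rowproj // rp; case: (Hal x Qx).
pose p' x := p x + (k x / (k x + d x)) *: (q x - p x).
have p'K x : K x -> p' x = p x.
  by move=> kx; rewrite /p' (_ : k x = 0) // mul0r scale0r addr0.
have p'Q x : Q x -> p' x = q x.
  move=> dx; have [kx|kx] := eqVneq (k x) 0; first by rewrite p'K // qp.
  by rewrite /p' (_ : d x = 0) // addr0 divff // scale1r addrC subrK.
have Sp' : mxfun S p'.
  apply: (mxfunD SR) => // i j.
  apply: (fr_ext SR (f := fun x => k x / (k x + d x) * (q x - p x) i j)).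
    apply: (piecewise_cutoff hA) => //; first exact: (mxfunB SR).
    by move=> x kx dx; rewrite qp // subrr mxE.
  by move=> x _; rewrite [RHS]mxE.
(* On the overlap the two branches differ by [al *m (M - B)], of norm at most [e / 2]. So [f],
   though possibly discontinuous, has local oscillation less than [e]. *)
pose f x := if k x == 0 then pi x *m u x *m p x else al x *m B x.
have [|x KQx|x0 KQx0|u' [Su' eu' Hu']] := HCe (K `|` Q) f e _ e0.
- exact: compactU.
- rewrite /f; case: eqVneq KQx => [kx _|kx [/eqP|Qx]]; last 2 first.
  + by rewrite (negPf kx).
  + by apply: equivariantM (eB x); case: (Hal x Qx).
  by apply: equivariantM (ep x); apply: equivariantM (eu x).
- have caB : mxfun (cts_on Q) (fun x => al x *m B x).
    by apply: (mxfunM (F _)) => //; exact: mxfun_cts_on SB.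
  have cpup : mxfun (cts_on K) (fun x => pi x *m u x *m p x).
    apply: (mxfunM (F _)); last exact: mxfun_cts_on Sp.
    by apply: (mxfunM (F _)); last exact: mxfun_cts_on Su.
  have [Kx0|nKx0] := pselect (K x0); last first.
    have Qx0 : Q x0 by case: KQx0.
    have nK : \forall x \near x0, ~ K x.
      by apply: open_nbhs_nbhs; split=> //; exact: closed_openC.
    apply: filterS2 nK (mxfun_near caB Qx0 e0) => x nKx H [//|Qx].
    by rewrite /f !ifN; [exact: H|apply/eqP|apply/eqP].
  have f0 : f x0 = pi x0 *m u x0 *m p x0 by rewrite /f (_ : k x0 = 0) // eqxx.
  have nearK := mxfun_near cpup Kx0 e0.
  have [Qx0|nQx0] := pselect (Q x0); last first.
    have nQ : \forall x \near x0, ~ Q x.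
      by apply: open_nbhs_nbhs; split=> //; exact: closed_openC.
    apply: filterS2 nQ nearK => x nQx H [Kx|//].
    by rewrite f0 /f (_ : k x = 0) // eqxx; exact: H.
  apply: filterS2 nearK (mxfun_near caB Qx0 e20) => x HK' HQ' KQx.
  rewrite f0 /f; case: eqVneq KQx => [kx _|kx [/eqP|Qx]]; last 2 first.
  + by rewrite (negPf kx).
  + have [_ Bx0] := KQB x0 (Logic.conj Kx0 Qx0).
    rewrite -(subrKA (al x0 *m B x0)) (le_lt_trans (entry_normD _ _)) //.
    rewrite [ltRHS]splitr ltr_leD ?HQ' // -alM // -mulmxBr; exact: Bx0.
  exact: HK'.
have {}Su' : mxfun S u' by move=> i j; exact: (quotients_piecewise hA).
have fp' x : (K `|` Q) x -> f x *m p' x = f x.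
  rewrite /f; case: eqVneq => [kx _|kx [//|Qx]].
    by case: (HK x kx) => pp _ _; rewrite p'K // -mulmxA pp.
    by move/eqP: kx.
  by rewrite p'Q // -mulmxA Bq.
have fm x : (K `|` Q) x -> forall v : 'rV_a, v *m pi x = v ->
    entry_norm v <= C5 * entry_norm (v *m f x).
  move=> KQx v vpi; rewrite /C5 mulrDl; move: KQx; rewrite /f.
  have n0 := entry_norm_ge0.
  case: eqVneq => [kx _|kx [/eqP|Qx]]; last 2 first.
  - by rewrite (negPf kx).
  - have [_ _ alP0 _ _] := Hal x Qx.
    apply: ler_wpDl; first by apply: mulr_ge0; rewrite ?n0 ?ltW.
    apply: (le_trans (HC4 x Qx v vpi)); rewrite -mulrA; apply: ler_wpM2l.
      exact: ltW.
    by rewrite mulmxA; apply: HBm => //; rewrite -mulmxA alP0.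
  apply: ler_wpDr; last exact: HC3.
  by apply: mulr_ge0; rewrite ?n0 ?mulr_ge0 ?ltW.
have op' x : (K `|` Q) x -> orthproj (p' x).
  by move=> [Kx|Qx]; [rewrite p'K //; exact: op|rewrite p'Q].
exists p', u'; split=> //.
- move=> x; split=> //.
    by rewrite /p' linearD linearZ linearB /=; case: (pu x) => -> _ _; case: (oq x) => ->.
  apply: equivariantD => //; apply: equivariantZ; apply: equivariantD => //.
  exact: equivariantN.
- move=> io' x pio' ioio'; rewrite mulmxDl pio' add0r -scalemxAl mulmxBl pio' subr0.
  by rewrite /q /rowproj -mulmxA Bio // mulmx0 scaler0.
- move=> x /eqP; rewrite mulf_eq0 => kd.
  have KQx : (K `|` Q) x by case/orP: kd => /eqP; [left|right].
  split; first by case: (op' x KQx).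
    case: KQx => [Kx|Qx]; first by rewrite p'K //; case: (HK x Kx).
    by rewrite p'Q // rank_rowproj //; case: (Hal x Qx).
  have C5ge : 0 <= C5 by exact: ltW.
  apply: (margin_injective (injective_on_perturb (fm x KQx) C5ge _)).
  rewrite -[X in _ - X](fp' x KQx) -mulmxBl.
  have h1 := orthproj_entry_norm (op' x KQx).
  have h2 := Hu' x KQx.
  have h3 : entry_norm ((u' x - f x) *m p' x) <= Ce * e * g.
    rewrite (le_trans (entry_normM _ _)) // ler_pM ?entry_norm_ge0 //.
    by rewrite (le_trans h1) // lerDl.
  have c0 : 0 <= 2 * C5 by rewrite mulr_ge0.
  apply: (le_trans (ler_wpM2l c0 h3)).
  have : e <= 1 / (2 * C5 * g * Ce) by [].
  rewrite ler_pdivlMr ?mulr_gt0 // => h; apply: le_trans h.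
  by rewrite le_eqVlt; apply/predU1P; left; ring.
Qed.

(** The product of the first [j] functions serves as [k]: its zero set is the union of the first [j]
    sublevel sets, and everything for [j = N]. The blocks [io i] with [i] at least [j] stay
    orthogonal to [p], one for each remaining step. *)
Lemma piecewise_projection (N : nat) (D : nat -> T -> R) (io : nat -> 'M[R]_(a, r)) :
  (forall i, (i < N)%N -> [/\ S (D i), forall x, 0 <= D i x,
    saturated cell (D i) & exists P0, [/\ orthproj P0, equivariant Ja Ja P0 &
      proj_iso Ja [set x | D i x = 0] pi (fun=> P0)]]) ->
  (forall i, (i < N)%N -> equivariant Ja Jr (io i) /\ io i *m (io i)^T = 1%:M) ->
  (forall i j, (i < j)%N -> (j < N)%N -> io i *m (io j)^T = 0) ->
  (forall x, exists2 i, (i < N)%N & D i x = 0) ->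
  exists (p : T -> 'M[R]_r) (u : T -> 'M[R]_(a, r)),
  [/\ mxfun S p, mxfun S u &
    forall x, [/\ orthproj (p x), equivariant Jr Jr (p x),
      equivariant Ja Jr (u x), \rank (p x) = \rank (pi x) &
      injective_on (pi x) (u x *m p x)]].
Proof.
move=> HD Hio ioio cover.
pose good j := exists (p : T -> 'M[R]_r) (u : T -> 'M[R]_(a, r)),
  [/\ mxfun S p, mxfun S u,
    forall x, [/\ (p x)^T = p x, equivariant Jr Jr (p x) &
      equivariant Ja Jr (u x)],
    forall i x, (j <= i < N)%N -> p x *m (io i)^T = 0 &
    forall x, \prod_(i < j) D i x = 0 -> [/\ p x *m p x = p x,
      \rank (p x) = \rank (pi x) & injective_on (pi x) (u x *m p x)]].
have H j : (j <= N)%N -> good j.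
  elim: j => [_|j IH jN].
    (* The empty product is 1 and has no zeros, so zero matrices are a valid start. *)
    exists (fun=> 0), (fun=> 0); split.
    - exact: (mxfun_cst SR).
    - exact: (mxfun_cst SR).
    - by move=> x; rewrite trmx0; split=> //; exact: equivariant0.
    - by move=> i x _; rewrite mul0mx.
    - by move=> x /eqP; rewrite big_ord0 oner_eq0.
  have [p [u [Sp Su pu pio Hpu]]] := IH (ltnW jN).
  have [Sd d0 sd [P0 [oP0 eP0 iso]]] := HD j jN.
  have [eio ioj] := Hio j jN.
  have DS (i : 'I_j) : (i < N)%N by rewrite (ltn_trans _ jN).
  have Sk : S (fun x => \prod_(i < j) D i x).
    apply: (fr_prod SR) => i; by case: (HD i (DS i)).
  have k0 x : 0 <= \prod_(i < j) D i x.
    by apply: prodr_ge0 => i _; case: (HD i (DS i)).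
  have sk : saturated cell (fun x => \prod_(i < j) D i x).
    move=> x y xy /eqP/prodf_eq0[i _ /eqP Dx]; apply/eqP/prodf_eq0.
    by exists i => //; apply/eqP; case: (HD i (DS i)) => _ _ sD _; exact: sD Dx.
  have pioj x : p x *m (io j)^T = 0 by apply: pio; rewrite leqnn.
  have [p' [u' [Sp' Su' pu' pio' Hpu']]] :=
    extend_projection Sk Sd k0 d0 sk sd oP0 eP0 iso Sp Su pu eio pioj ioj Hpu.
  exists p', u'; split=> // [i x /andP[ji iN]|x].
    by apply: pio'; [apply: pio; rewrite (ltnW ji)|exact: ioio].
  by rewrite big_ord_recr /=; exact: Hpu'.
have [p [u [Sp Su pu _ Hpu]]] := H N (leqnn N).
exists p, u; split=> // x; have [pT ep eu] := pu x.
have [i iN Dix] := cover x.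
have [] := Hpu x; first by apply/eqP/prodf_eq0; exists (Ordinal iN) => //; apply/eqP.
by move=> pp rp iu; split.
Qed.

End Step.

(** * F-linear algebra in real coordinates *)

Section ScalarCoordinates.
Context (R : realType) (K : scalar_kind).
Local Notation F := (scalars R K).
Local Notation rc := (@real_coord R K).

Definition coord_scalar : 'rV[R]_(real_dim K) -> F :=
  match K return 'rV[R]_(real_dim K) -> scalars R K with
  | RealF => fun w => w 0 0
  | ComplexF => fun w => (w 0 0 +i* w 0 1)%C
  | QuaternionF => fun w =>
      Quat (w 0 0) (w 0 1) (w 0 (inord 2)) (w 0 (inord 3))
  end.

Definition real_scalar (c : R) : F :=
  match K return scalars R K with
  | RealF => c
  | ComplexF => (c +i* 0)%C
  | QuaternionF => Quat c 0 0 0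
  end.

Definition scalar_conj : F -> F :=
  match K return scalars R K -> scalars R K with
  | RealF => id
  | ComplexF => fun z => let: (a +i* b)%C := z in (a +i* (- b))%C
  | QuaternionF => fun z => let: Quat a b c d := z in Quat a (- b) (- c) (- d)
  end.

Lemma real_coordD x y : rc (x + y) = rc x + rc y.
Proof.
rewrite /real_coord; move: x y; case: K => [x y|[a b] [c d]|[a b c d] [a' b' c' d']];
  apply/rowP => l; rewrite !mxE //.
  by case: l => [[|[|l]]] //.
by case: l => [[|[|[|[|l]]]]] //.
Qed.

Lemma real_coord0 : rc 0 = 0.
Proof. by apply: (addrI (rc 0)); rewrite -real_coordD !addr0. Qed.

Lemma real_coordK : cancel rc coord_scalar.
Proof.
rewrite /real_coord /coord_scalar; case: K => [x|[a b]|[a b c d]]; rewrite !mxE //=.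
by rewrite !inordK.
Qed.

Lemma coord_scalarK : cancel coord_scalar rc.
Proof.
rewrite /real_coord /coord_scalar; case: K => w; apply/rowP => l; rewrite !mxE /=.
- by rewrite [l]ord1.
- by case: l => [[|[|l]]] //= h; congr (w _ _); apply/val_inj.
- by case: l => [[|[|[|[|l]]]]] //= h; congr (w _ _); apply/val_inj; rewrite /= ?inordK.
Qed.

Lemma real_coordZ c x : rc (real_scalar c * x) = c *: rc x.
Proof.
rewrite /real_coord /real_scalar; move: x.
case: K => [x|[a b]|[a b e d]]; apply/rowP => l; rewrite !mxE //.
  by case: l => [[|[|l]]] //= _; ring.
by case: l => [[|[|[|[|l]]]]] //= _; ring.
Qed.

Lemma scalar_conjK : involutive scalar_conj.
Proof.
by rewrite /scalar_conj; case: K => [x|[a b]|[a b c d]] //=; rewrite !opprK.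
Qed.

Lemma real_coord_dot a x y :
  rc (a * x) *m (rc y)^T = rc x *m (rc (scalar_conj a * y))^T.
Proof.
rewrite /real_coord /scalar_conj; move: a x y.
case: K => [x y z|[a b] [c d] [e f]|[a b c d] [a' b' c' d'] [e f g h]];
  apply/matrixP => i j; rewrite !mxE !big_ord_recl !big_ord0 !mxE /=; ring.
Qed.

(** The inverse is the conjugate divided by the square of the norm, which is the dot product of the
    real coordinates with themselves. *)
Lemma scalar_left_inverse (a : F) : a != 0 -> exists b, b * a = 1.
Proof.
move=> a0; exists (real_scalar ((rc a *m (rc a)^T) 0 0)^-1 * scalar_conj a).
have n0 : (rc a *m (rc a)^T) 0 0 != 0.
  apply: contra a0 => /eqP n0; rewrite -(real_coordK a).
  have -> : rc a = 0 by apply: dot_eq0; apply/matrixP => i j; rewrite !ord1 n0 mxE.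
  by rewrite -real_coord0 real_coordK.
apply: (can_inj real_coordK); rewrite -mulrA real_coordZ.
apply: (canLR (scalerK n0)) => {n0}.
rewrite /real_coord /scalar_conj; move: a {a0}.
case: K => [x|[a b]|[a b c d]]; apply/rowP => l; rewrite !mxE !big_ord_recl !big_ord0 !mxE /=.
- ring.
- by case: l => [[|[|l]]] //= _; ring.
- by case: l => [[|[|[|[|l]]]]] //= _; ring.
Qed.

End ScalarCoordinates.

Lemma mxvec_dot (R : comRingType) m n (A B : 'M[R]_(m, n)) :
  mxvec A *m (mxvec B)^T = (\sum_i \sum_j A i j * B i j)%:M.
Proof.
apply/matrixP => i j; rewrite !ord1 !mxE /= mulr1n.
rewrite (reindex _ (curry_mxvec_bij _ _)) /= pair_bigA /=.
by apply: eq_bigr => -[k l] _ /=; rewrite mxE !mxvecE.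
Qed.

Lemma mx_row_eq (R : nzRingType) m n (A B : 'M[R]_(m, n)) :
  (forall v : 'rV_m, v *m A = v *m B) -> A = B.
Proof. by move=> AB; apply/row_matrixP => i; rewrite !rowE AB. Qed.

Section LinearFunctions.
Context (S : nzRingType) (U V : lmodType S) (f : U -> V).
Hypothesis lf : linear f.

Lemma linear_fun0 : f 0 = 0.
Proof. by have := lf (-1) 0 0; rewrite scaler0 addr0 scaleN1r addNr. Qed.

Lemma linear_funD u w : f (u + w) = f u + f w.
Proof. by have := lf 1 u w; rewrite !scale1r. Qed.

Lemma linear_funZ c u : f (c *: u) = c *: f u.
Proof. by have := lf c u 0; rewrite linear_fun0 !addr0. Qed.

End LinearFunctions.

Section RealCoordinates.
Context (R : realType) (K : scalar_kind).
Local Notation F := (scalars R K).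
Local Notation d := (real_dim K).
Local Notation rc := (@real_coord R K).
Local Notation rvc := (@real_vec_coord R K _).
Local Notation rs := (@real_scalar R K).

Lemma real_scalarC c (x : F) : rs c * x = x * rs c.
Proof.
rewrite /real_scalar; move: x; case: K => [x|[a b]|[a b e g]].
- exact: mulrC.
- exact: mulrC.
- by congr Quat; ring.
Qed.

Lemma real_scalar1 : rs 1 = 1.
Proof.
rewrite -[LHS]mulr1; apply: (can_inj (@real_coordK R K)).
by rewrite real_coordZ scale1r.
Qed.

Definition coord_vec n (w : 'rV[R]_(n * d)) : 'rV[F]_n :=
  \row_i coord_scalar (row i (vec_mx w)).

Lemma real_vec_coordK n : cancel (@real_vec_coord R K n) (@coord_vec n).
Proof.
move=> v; apply/rowP => i; rewrite mxE mxvecK -[RHS]real_coordK; congr coord_scalar.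
by apply/rowP => l; rewrite !mxE.
Qed.

Lemma coord_vecK n : cancel (@coord_vec n) (@real_vec_coord R K n).
Proof.
move=> w; rewrite /real_vec_coord -[RHS]vec_mxK; congr mxvec.
by apply/matrixP => i l; rewrite !mxE coord_scalarK !mxE.
Qed.

Lemma real_vec_coordD n (u v : 'rV[F]_n) : rvc (u + v) = rvc u + rvc v.
Proof.
rewrite /real_vec_coord -linearD; congr mxvec.
by apply/matrixP => i l; rewrite !mxE real_coordD mxE.
Qed.

Lemma real_vec_coordZ n c (v : 'rV[F]_n) : rvc (rs c *: v) = c *: rvc v.
Proof.
rewrite /real_vec_coord -linearZ; congr mxvec.
by apply/matrixP => i l; rewrite !mxE real_coordZ mxE.
Qed.

Lemma real_vec_coord0 n : rvc (0 : 'rV[F]_n) = 0.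
Proof. by apply: (addrI (rvc 0)); rewrite -real_vec_coordD !addr0. Qed.

Lemma real_vec_coord_sum n I (r : seq I) (P : pred I) (v : I -> 'rV[F]_n) :
  rvc (\sum_(i <- r | P i) v i) = \sum_(i <- r | P i) rvc (v i).
Proof.
by apply: (big_morph _ (@real_vec_coordD n) (@real_vec_coord0 n)).
Qed.

Lemma coord_vecD n (u v : 'rV[R]_(n * d)) :
  coord_vec (u + v) = coord_vec u + coord_vec v.
Proof.
apply: (can_inj (@real_vec_coordK n)).
by rewrite real_vec_coordD !coord_vecK.
Qed.

Lemma coord_vecZ n c (v : 'rV[R]_(n * d)) :
  coord_vec (c *: v) = rs c *: coord_vec v.
Proof.
apply: (can_inj (@real_vec_coordK n)).
by rewrite real_vec_coordZ !coord_vecK.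
Qed.

Lemma real_vec_coordE n (v : 'rV[F]_n) i l :
  rvc v 0 (mxvec_index i l) = rc (v 0 i) 0 l.
Proof. by rewrite mxvecE mxE. Qed.

Lemma coord_vecE n (w : 'rV[R]_(n * d)) i l :
  rc (coord_vec w 0 i) 0 l = w 0 (mxvec_index i l).
Proof. by rewrite -real_vec_coordE coord_vecK. Qed.

Lemma real_vec_coord_dot n (u v : 'rV[F]_n) :
  rvc u *m (rvc v)^T = \sum_i rc (u 0 i) *m (rc (v 0 i))^T.
Proof.
rewrite mxvec_dot; apply/matrixP => i j; rewrite !ord1 !mxE /= mulr1n summxE.
apply: eq_bigr => k _; rewrite mxE; apply: eq_bigr => l _.
by rewrite !mxE.
Qed.

(** Left multiplication by a quaternion is not linear over the quaternions. It still has a real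
    matrix, which this weaker notion provides. *)
Definition real_linear n q (f : 'rV[F]_n -> 'rV[F]_q) :=
  forall c u v, f (rs c *: u + v) = rs c *: f u + f v.

Lemma linear_real_linear n q (f : 'rV[F]_n -> 'rV[F]_q) :
  linear f -> real_linear f.
Proof. by move=> lf c u v; rewrite lf. Qed.

Definition realmx n q (f : 'rV[F]_n -> 'rV[F]_q) : 'M[R]_(n * d, q * d) :=
  \matrix_i rvc (f (coord_vec (delta_mx 0 i))).

Lemma realmxE n q (f : 'rV[F]_n -> 'rV[F]_q) v : real_linear f ->
  rvc v *m realmx f = rvc (f v).
Proof.
move=> lf; have f0 : f 0 = 0.
  by have := lf 1 0 0; rewrite real_scalar1 !scale1r addr0 -{1}[f 0]addr0 => /addrI.
have fD u w : f (u + w) = f u + f w by have := lf 1 u w; rewrite real_scalar1 !scale1r.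
have fZ c u : f (rs c *: u) = rs c *: f u.
  by rewrite -[rs c *: u]addr0 lf f0 addr0.
rewrite -{2}(real_vec_coordK v) (row_sum_delta (rvc v)).
have -> : coord_vec (\sum_j rvc v 0 j *: delta_mx 0 j) =
    \sum_j rs (rvc v 0 j) *: coord_vec (delta_mx 0 j).
  have cv0 : @coord_vec n 0 = 0.
    by apply: (can_inj (@real_vec_coordK n)); rewrite coord_vecK real_vec_coord0.
  rewrite (big_morph _ (@coord_vecD n) cv0).
  by apply: eq_bigr => j _; rewrite coord_vecZ.
rewrite (big_morph f fD f0) real_vec_coord_sum mulmx_suml.
apply: eq_bigr => j _; rewrite fZ real_vec_coordZ -scalemxAl; congr (_ *: _).
by rewrite -rowE rowK.
Qed.

Lemma real_vec_mx_eq n q (A B : 'M[R]_(n * d, q)) :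
  (forall v : 'rV[F]_n, rvc v *m A = rvc v *m B) -> A = B.
Proof. by move=> AB; apply: mx_row_eq => w; rewrite -(coord_vecK w). Qed.

Definition scalar_mx n (a : F) : 'M[R]_(n * d) := realmx (fun v : 'rV[F]_n => a *: v).

Lemma scalar_mxE n (a : F) (v : 'rV[F]_n) : rvc v *m scalar_mx n a = rvc (a *: v).
Proof.
apply: realmxE => c u w; rewrite scalerDr !scalerA; congr (_ *: _ + _).
by rewrite real_scalarC.
Qed.

Lemma scalar_mx_action n : scalar_action (@scalar_conj R K) (scalar_mx n).
Proof.
move=> a; apply: trmx_inj; rewrite trmxK; apply: real_vec_mx_eq => v.
apply: trmx_inj; apply: real_vec_mx_eq => w.
apply: trmx_inj; rewrite !trmx_mul !trmxK.
rewrite scalar_mxE -mulmxA -trmx_mul scalar_mxE !real_vec_coord_dot.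
by apply: eq_bigr => i _; rewrite !mxE real_coord_dot.
Qed.

Lemma equivariant_realmx n q (f : 'rV[F]_n -> 'rV[F]_q) : linear f ->
  equivariant (@scalar_mx n) (@scalar_mx q) (realmx f).
Proof.
move=> lf a; apply: real_vec_mx_eq => v.
have rf := linear_real_linear lf.
by rewrite !mulmxA scalar_mxE !(realmxE _ rf) scalar_mxE (linear_funZ lf).
Qed.

Definition coordmap n q (A : 'M[R]_(n * d, q * d)) (v : 'rV[F]_n) : 'rV[F]_q :=
  coord_vec (rvc v *m A).

Lemma coordmapE n q (A : 'M[R]_(n * d, q * d)) v : rvc (coordmap A v) = rvc v *m A.
Proof. exact: coord_vecK. Qed.

Lemma coordmap_linear n q (A : 'M[R]_(n * d, q * d)) :
  equivariant (@scalar_mx n) (@scalar_mx q) A -> linear (coordmap A).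
Proof.
move=> eA a u v; apply: (can_inj (@real_vec_coordK q)).
rewrite coordmapE !real_vec_coordD -!scalar_mxE !coordmapE mulmxDl.
by rewrite -!mulmxA eA.
Qed.

Definition scalarmx n q (A : 'M[R]_(n * d, q * d)) : 'M[F]_(n, q) :=
  \matrix_i coordmap A (delta_mx 0 i).

Lemma linear_mxE n q (f : 'rV[F]_n -> 'rV[F]_q) v : linear f ->
  f v = v *m \matrix_i f (delta_mx 0 i).
Proof.
move=> lf; rewrite {1}(row_sum_delta v) mulmx_sum_row.
rewrite (big_morph f (linear_funD lf) (linear_fun0 lf)).
by apply: eq_bigr => j _; rewrite (linear_funZ lf) rowK.
Qed.

Lemma mulmx_linear n q (s : 'M[F]_(n, q)) : linear (fun v : 'rV[F]_n => v *m s).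
Proof. by move=> a u v; rewrite mulmxDl scalemxAl. Qed.

(** The F-linear map that agrees with [A] on the standard basis of F^n. This is a real linear
    retraction onto the equivariant matrices. *)
Definition equivariantize n q (A : 'M[R]_(n * d, q * d)) : 'M[R]_(n * d, q * d) :=
  realmx (fun v => v *m scalarmx A).

Lemma equivariantizeP n q (A : 'M[R]_(n * d, q * d)) :
  equivariant (@scalar_mx n) (@scalar_mx q) (equivariantize A).
Proof. exact/equivariant_realmx/mulmx_linear. Qed.

Lemma equivariantize_id n q (A : 'M[R]_(n * d, q * d)) :
  equivariant (@scalar_mx n) (@scalar_mx q) A -> equivariantize A = A.
Proof.
move=> eA; apply: real_vec_mx_eq => v; rewrite realmxE.
  by rewrite -linear_mxE ?coordmapE //; exact: coordmap_linear.
exact/linear_real_linear/mulmx_linear.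
Qed.

Lemma equivariantize_linear n q : linear (@equivariantize n q).
Proof.
move=> c A B; apply: real_vec_mx_eq => v.
rewrite mulmxDr -scalemxAr !realmxE; try exact/linear_real_linear/mulmx_linear.
rewrite -real_vec_coordZ -real_vec_coordD; congr real_vec_coord.
have -> : scalarmx (c *: A + B) = rs c *: scalarmx A + scalarmx B.
  apply/row_matrixP => i; rewrite rowK linearD linearZ /= !rowK /coordmap.
  by rewrite mulmxDr -scalemxAr coord_vecD coord_vecZ.
rewrite mulmxDr; congr (_ + _).
apply/rowP => j; rewrite !mxE mulr_sumr; apply: eq_bigr => k _.
by rewrite mxE !mulrA real_scalarC.
Qed.

HB.instance Definition _ n q :=
  GRing.isLinear.Build R _ _ _ (@equivariantize n q) (@equivariantize_linear n q).

(** A natural number as index fits the induction on blocks; for [i] at least [N] the map is 0. *)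
Definition block_incl N n (i : nat) (v : 'rV[F]_n) : 'rV[F]_(N * n) :=
  mxvec (\matrix_(k < N, l < n) (if i == k then v 0 l else 0)).

Definition block_mx_incl N n i := realmx (@block_incl N n i).

Lemma block_incl_linear N n i : linear (@block_incl N n i).
Proof.
move=> a u v; rewrite /block_incl -linearZ -linearD; congr mxvec.
by apply/matrixP => k l; rewrite !mxE; case: eqP => // _; rewrite mulr0 addr0.
Qed.

Lemma block_mx_incl_dot N n i j : (i < N)%N ->
  @block_mx_incl N n i *m (block_mx_incl N n j)^T = if i == j then 1%:M else 0.
Proof.
move=> iN; apply: real_vec_mx_eq => v.
apply: trmx_inj; apply: real_vec_mx_eq => w; apply: trmx_inj.
rewrite !trmx_mul !trmxK -!mulmxA -trmx_mul mulmxA.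
have bl k := linear_real_linear (@block_incl_linear N n k).
rewrite !realmxE // real_vec_coord_dot.
rewrite (reindex _ (curry_mxvec_bij _ _)) /=.
transitivity (\sum_k \sum_l rc (block_incl N i v 0 (mxvec_index k l)) *m
    (rc (block_incl N j w 0 (mxvec_index k l)))^T).
  by rewrite pair_bigA; apply: eq_bigr => -[k l] _.
rewrite (bigD1 (Ordinal iN)) //= [X in _ + X]big1 ?addr0; last first.
  move=> k ki; apply: big1 => l _; rewrite !mxvecE !mxE ifN ?real_coord0 ?mul0mx //.
  by apply: contra ki => /eqP ki; apply/eqP/val_inj.
case: (eqVneq i j) => [<-|ij].
  rewrite mul1mx real_vec_coord_dot; apply: eq_bigr => l _.
  by rewrite !mxvecE !mxE eqxx.
rewrite mul0mx mulmx0; apply: big1 => l _.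
by rewrite !mxvecE !mxE (eq_sym j) (negPf ij) real_coord0 trmx0 mulmx0.
Qed.

End RealCoordinates.

(** * Subspaces of F^n, their frames and their orthogonal projections *)

Section Frames.
Context (R : realType) (K : scalar_kind).
Local Notation F := (scalars R K).
Local Notation d := (real_dim K).
Local Notation rvc := (@real_vec_coord R K _).
Local Notation eqvar n q := (equivariant (@scalar_mx R K n) (@scalar_mx R K q)).

Lemma real_dim_gt0 : (0 < d)%N. Proof. by case: K. Qed.

Lemma rvc_inj n : injective (@real_vec_coord R K n).
Proof. exact: can_inj (@real_vec_coordK R K n). Qed.

Definition is_proj n (P : 'M[R]_(n * d)) (W : {pred 'rV[F]_n}) :=
  orthproj P /\ forall v, v \in W <-> rvc v *m P = rvc v.

(** Uniqueness lets the continuity or regularity of a field of projections be checked locally, with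
    any frame. *)
Lemma is_proj_uniq n (P Q : 'M[R]_(n * d)) (W W' : {pred 'rV[F]_n}) :
  W =i W' -> is_proj P W -> is_proj Q W' -> P = Q.
Proof.
move=> WW' [oP PW] [oQ QW]; apply: orthproj_uniq => // w.
by rewrite -(coord_vecK w) -PW -QW WW'.
Qed.

(** Stability of [W] under scalars gives P J P = P J for each scalar matrix J. As the transpose of J
    is again a scalar matrix, transposition gives P J P = J P as well. *)
Lemma is_proj_equivariant n (P : 'M[R]_(n * d)) (W : submodClosed 'rV[F]_n) :
  is_proj P W -> eqvar n n P.
Proof.
move=> [[PT PP] PW].
have PJ a : P *m scalar_mx n a *m P = P *m scalar_mx n a.
  apply: real_vec_mx_eq => v; rewrite !mulmxA.
  have PvW : coord_vec (rvc v *m P) \in W.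
    by apply/PW; rewrite coord_vecK -mulmxA PP.
  have /PW : a *: coord_vec (rvc v *m P) \in W by exact: rpredZ.
  by rewrite -scalar_mxE coord_vecK.
move=> a; rewrite -[RHS]PJ; apply: trmx_inj.
have := PJ (scalar_conj a); rewrite -(scalar_mx_action n a) => PJa.
by rewrite !trmx_mul PT mulmxA PJa.
Qed.

Lemma realmx_injective k n (s : 'M[F]_(k, n)) :
  injective (fun c : 'rV[F]_k => c *m s) ->
  injective_on 1%:M (realmx (fun c => c *m s)).
Proof.
move=> is' w _; rewrite -(coord_vecK w) realmxE => [ws|]; last first.
  exact/linear_real_linear/mulmx_linear.
suff -> : coord_vec w = 0 by rewrite real_vec_coord0.
apply: is'; apply: (@rvc_inj n); rewrite ws mul0mx.
by rewrite real_vec_coord0.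
Qed.

Lemma orthproj1 n : orthproj (1%:M : 'M[R]_n).
Proof. by split; rewrite ?trmx1 ?mulmx1. Qed.

Lemma gram1_unit n k (S : 'M[R]_(n, k)) :
  injective_on 1%:M S -> gram 1%:M S \in unitmx.
Proof. by apply: gram_unit; rewrite ?mul1mx //; exact: orthproj1. Qed.

Lemma is_frame_proj k n (s : 'M[F]_(k, n)) (W : submodClosed 'rV[F]_n) :
  is_frame s W -> is_proj (rowproj 1%:M (realmx (fun c => c *m s))) W.
Proof.
move=> [Ws is']; have i1 := realmx_injective is'.
have o1 := orthproj1 (k * d); have ls := linear_real_linear (mulmx_linear s).
split=> [|v]; first by apply: rowproj_orth; rewrite ?mul1mx.
rewrite rowprojP ?mul1mx // Ws; split=> -[c cs].
  by exists (rvc c); rewrite realmxE // cs.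
exists (coord_vec c); apply: (@rvc_inj n).
by rewrite cs -(realmxE (coord_vec c) ls) coord_vecK.
Qed.

Lemma is_frame_rank k n (s : 'M[F]_(k, n)) (W : submodClosed 'rV[F]_n) P :
  is_frame s W -> is_proj P W -> \rank P = (k * d)%N.
Proof.
move=> fs pP; rewrite (is_proj_uniq _ pP (is_frame_proj fs)) //.
rewrite rank_rowproj ?mxrank1 ?mul1mx //; first exact: orthproj1.
by apply: realmx_injective; case: fs.
Qed.

Lemma injective_row_le k n (s : 'M[F]_(k, n)) :
  injective (fun c : 'rV[F]_k => c *m s) -> (k <= n)%N.
Proof.
move=> /realmx_injective is'; have := injective_on_rank (mulmx1 _) is'.
rewrite mul1mx mxrank1 => rs; have := rank_leq_col (realmx (fun c => c *m s)).
by rewrite rs leq_pmul2r ?real_dim_gt0.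
Qed.

Lemma injective_row_extend k n (s : 'M[F]_(k, n)) (v : 'rV[F]_n) :
  injective (fun c : 'rV[F]_k => c *m s) -> (forall c, v <> c *m s) ->
  injective (fun c : 'rV[F]_(k + 1) => c *m col_mx s v).
Proof.
move=> is' vs.
have ker0 (c : 'rV[F]_(k + 1)) : c *m col_mx s v = 0 -> c = 0.
  rewrite -(hsubmxK c) mul_row_col; move: (lsubmx c) (rsubmx c) => c1 c2 {c}.
  have -> : c2 *m v = c2 0 0 *: v.
    by apply/rowP => j; rewrite !mxE big_ord1.
  move=> cv0; have [c20|c20] := eqVneq (c2 0 0) 0.
    move: cv0; rewrite c20 scale0r addr0 => c1s.
    have -> : c1 = 0 by apply: is'; rewrite c1s mul0mx.
    have -> : c2 = 0 by apply/rowP => j; rewrite ord1 c20 mxE.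
    by rewrite row_mx0.
  have [b ba] := scalar_left_inverse c20.
  exfalso; apply: (vs (- (b *: c1))); rewrite mulNmx -scalemxAl.
  move/eqP: cv0; rewrite addrC addr_eq0 => /eqP cv.
  by rewrite -scalerN -cv scalerA ba scale1r.
move=> u w /= uw; apply/eqP; rewrite -subr_eq0; apply/eqP/ker0.
by rewrite mulmxBl uw subrr.
Qed.

(** An independent family in [W] is enlarged until it spans. A vector outside the span is
    independent of it because nonzero scalars are invertible, and real ranks bound the length by
    [n]. *)
Lemma frame_exists n (W : submodClosed 'rV[F]_n) :
  exists k (s : 'M[F]_(k, n)), is_frame s W.
Proof.
suff H m k (s : 'M[F]_(k, n)) : (n - k <= m)%N ->
    injective (fun c : 'rV[F]_k => c *m s) -> (forall i, row i s \in W) ->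
    exists k (s : 'M[F]_(k, n)), is_frame s W.
  apply: (H n 0%N 0); rewrite ?subn0 //; last by case.
  by move=> u v _; apply/rowP => -[].
elim: m k s => [|m IH] k s nk is' Ws;
  have [sp|/existsNP[v /not_implyP[vW vs]]] :=
    pselect (forall v, v \in W -> exists c : 'rV[F]_k, v = c *m s).
- exists k, s; split=> // v; split=> [/sp//|[c ->]].
  by rewrite mulmx_sum_row; apply: rpred_sum => i _; exact: rpredZ.
- have /injective_row_le : injective (fun c : 'rV[F]_(k + 1) => c *m col_mx s v).
    by apply: injective_row_extend => // c vc; apply: vs; exists c.
  by rewrite addn1 ltnNge -subn_eq0 -leqn0 nk.
- exists k, s; split=> // v; split=> [/sp//|[c ->]].
  by rewrite mulmx_sum_row; apply: rpred_sum => i _; exact: rpredZ.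
- apply: (IH _ (col_mx s v)).
  + by rewrite addn1 subnS; case: (n - k)%N nk.
  + by apply: injective_row_extend => // c vc; apply: vs; exists c.
  + move=> i; case: (split_ordP i) => j ->; first by rewrite rowKu.
    by rewrite rowKd; suff -> : row j v = v by []; apply/rowP => l; rewrite mxE ord1.
Qed.

(** [S] projects the frame of [W0] into [W]; as it is injective, equality of ranks makes it span
    [W]. *)
Lemma is_frame_near k n (s : 'M[F]_(k, n)) (W0 W : submodClosed 'rV[F]_n) P0 P :
  is_frame s W0 -> is_proj P0 W0 -> is_proj P W -> \rank P = \rank P0 ->
  let S := realmx (fun c => c *m s) *m P in
  injective_on 1%:M S -> is_frame (scalarmx S) W /\ rowproj 1%:M S = P.
Proof.
move=> fs pP0 pP rP S iS; have [[PT PP] PW] := pP.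
have eS : eqvar k n S.
  apply: equivariantM (is_proj_equivariant pP).
  exact/equivariant_realmx/mulmx_linear.
have SE c : c *m scalarmx S = coordmap S c.
  by rewrite [RHS](linear_mxE _ (coordmap_linear eS)).
have S1 : 1%:M *m S = S by rewrite mul1mx.
have o1 := orthproj1 (k * d).
have SP : rowproj 1%:M S = P.
  apply: orthproj_eq => //; first exact: rowproj_orth.
    by rewrite /rowproj -mulmxA -(mulmxA _ P) PP.
  by rewrite rank_rowproj // mxrank1 rP (is_frame_rank fs pP0).
split=> //; split.
  move=> v; rewrite PW -SP rowprojP //; split=> -[c cS].
    exists (coord_vec c); apply: (@rvc_inj n).
    by rewrite SE coordmapE coord_vecK.
  by exists (rvc c); rewrite cS SE coordmapE.
move=> c c' /=; rewrite !SE => cc'; apply: (@rvc_inj k); apply/eqP.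
rewrite -subr_eq0; apply/eqP; apply: iS; first by rewrite mulmx1.
by rewrite mulmxBl -!coordmapE cc' subrr.
Qed.

Section FixedVectors.
Context (n : nat) (P : 'M[R]_(n * d)).

(** Quantifying over the scalar makes this a submodule for every matrix [P]; for an equivariant [P]
    it is just the space of fixed vectors. *)
Definition fixed_vectors : pred 'rV[F]_n :=
  fun v => `[< forall a : F, rvc (a *: v) *m P = rvc (a *: v) >].

Fact fixed_vectors_closed : submod_closed fixed_vectors.
Proof.
split; first by apply/asboolP => a; rewrite scaler0 real_vec_coord0 mul0mx.
move=> b u v /asboolP hu /asboolP hv; apply/asboolP => a.
by rewrite scalerDr real_vec_coordD mulmxDl hv scalerA hu.
Qed.

HB.instance Definition _ :=
  GRing.isSubmodClosed.Build F 'rV[F]_n fixed_vectors fixed_vectors_closed.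

Definition fixed_space : submodClosed 'rV[F]_n :=
  GRing.SubmodClosed.clone F 'rV[F]_n fixed_vectors _.

Lemma fixed_space_proj : orthproj P -> eqvar n n P -> is_proj P fixed_space.
Proof.
move=> oP eP; split=> // v; split=> [/asboolP/(_ 1)|vP]; first by rewrite !scale1r.
by apply/asboolP => a; rewrite -scalar_mxE -mulmxA eP mulmxA vP.
Qed.

End FixedVectors.

End Frames.

Lemma mx_entry_continuous (T : topologicalType) m n (i : 'I_m) (j : 'I_n) :
  continuous (fun M : 'M[T]_(m, n) => M i j).
Proof.
move=> M A /= MA; exists (fun k l => if (k == i) && (l == j) then A else setT).
  by move=> k l; case: ifP => [/andP[/eqP-> /eqP->]//|_]; exact: filterT.
by move=> N /(_ i j); rewrite !eqxx.
Qed.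

Lemma mx_cvg (X T : topologicalType) m n (F : set_system X) (f : X -> 'M[T]_(m, n))
  (M : 'M[T]_(m, n)) : Filter F ->
  (forall i j, (fun x => f x i j) @ F --> M i j) -> f @ F --> M.
Proof.
move=> FF fM A [P MP PA].
have : \forall x \near F, forall i j, P i j (f x i j).
  have : \forall x \near F, forall ij : 'I_m * 'I_n, P ij.1 ij.2 (f x ij.1 ij.2).
    by apply: filter_forall => ij; exact: fM (MP ij.1 ij.2).
  by apply: filterS => x H i j; exact: (H (i, j)).
by apply: filterS => x H; apply: PA.
Qed.

(** * Bundles and fields of projections *)

Section VectorTopology.
Context (R : realType) (K : scalar_kind).
Local Notation F := (scalars R K).
Local Notation d := (real_dim K).
Local Notation rvc := (@real_vec_coord R K _).

Lemma real_coord_continuous : continuous (@real_coord R K).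
Proof. exact: (@initial_continuous F 'rV[R]_d (@real_coord R K)). Qed.

Lemma coord_scalar_continuous : continuous (@coord_scalar R K).
Proof.
apply: (@continuous_comp_initial F _ _ (@real_coord R K)).
have -> : @real_coord R K \o @coord_scalar R K = id.
  by apply/funext => w; rewrite /= coord_scalarK.
by move=> x; exact: cvg_id.
Qed.

Lemma real_vec_coord_continuous n j : continuous (fun v : 'rV[F]_n => rvc v 0 j).
Proof.
move=> v; case/mxvec_indexP: j => i l.
rewrite /continuous_at real_vec_coordE.
under [X in X @ _]eq_fun do rewrite real_vec_coordE.
apply: (@continuous_comp _ _ _ (fun v : 'rV[F]_n => real_coord (v 0 i))
  (fun w : 'rV[R]_d => w 0 l)); last exact: mx_entry_continuous.
apply: (@continuous_comp _ _ _ (fun v : 'rV[F]_n => v 0 i) (@real_coord R K)).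
  exact: mx_entry_continuous.
exact: real_coord_continuous.
Qed.

Lemma coord_vec_cvg (X : topologicalType) n (G : set_system X) (FF : Filter G)
  (f : X -> 'rV[F]_n) (v : 'rV[F]_n) :
  (forall j, (fun x => rvc (f x) 0 j) @ G --> rvc v 0 j) -> f @ G --> v.
Proof.
move=> fv; apply: mx_cvg => i j; rewrite (ord1 i) => {i}.
rewrite -(real_coordK (v 0 j)).
under [X in X @ _]eq_fun do rewrite -(real_coordK (f _ 0 j)).
apply: (@cvg_comp _ _ _ (fun x => real_coord (f x 0 j)) (@coord_scalar R K) G
  (nbhs (real_coord (v 0 j)))); last exact: coord_scalar_continuous.
apply: mx_cvg => i l; rewrite (ord1 i) -real_vec_coordE.
by under [X in X @ _]eq_fun do rewrite -real_vec_coordE; exact: fv.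
Qed.

Lemma vec_continuous (X : topologicalType) n (f : X -> 'rV[F]_n) :
  (forall j, continuous (fun x => rvc (f x) 0 j)) -> continuous f.
Proof. by move=> cf x; apply: coord_vec_cvg => j; exact: cf. Qed.

End VectorTopology.

Lemma open_setXT (X Y : topologicalType) (U : set X) :
  open U -> open (U `*` (setT : set Y)).
Proof.
move=> oU; have -> : U `*` (setT : set Y) = fst @^-1` U.
  by apply/seteqP; split=> [[x y] []|[x y]].
by apply: open_comp => // -[x y] _; exact: cvg_fst.
Qed.

Lemma continuous_pairl (X Y : topologicalType) (y : Y) :
  continuous (fun x : X => (x, y)).
Proof.
move=> x A [[P Q] [/= xP yQ] PQA]; apply: filterS xP => z Pz.
by apply: PQA; split=> //=; exact: nbhs_singleton yQ.
Qed.

Section FamiliesIntoProduct.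
Context (R : realType) (K : scalar_kind) (B : topologicalType).
Local Notation F := (scalars R K).
Local Notation d := (real_dim K).
Local Notation rvc := (@real_vec_coord R K _).
Local Notation eqvar n q := (equivariant (@scalar_mx R K n) (@scalar_mx R K q)).
Context (E : vfamily R K B) (n : nat) (th : forall b, vf_fib E b -> 'rV[F]_n).

Definition family_embedding := [/\ forall b, linear (@th b),
  forall b, injective (@th b) &
  continuous (fun e : vf_total E => th (vf_vec e))].

Hypotheses (lE : locally_trivial E) (hth : family_embedding).

Lemma th_point (b : B) (v : vf_fib E b) : th (vf_vec (vf_point v)) = th v.
Proof. by rewrite /vf_vec /vf_proj /vf_point vf_encK. Qed.

(** [S b] is the real matrix of [th] composed with the trivialization [g b]; through it an abstract
    bundle enters the matrix calculus. *)
Lemma local_frame b0 : exists (U : set B) (k : nat)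
    (h : forall b, vf_fib E b -> 'rV[F]_k) (g : forall b, 'rV[F]_k -> vf_fib E b)
    (S : B -> 'M[R]_(k * d, n * d)),
  [/\ open_nbhs b0 U,
    forall b, U b -> [/\ linear (h b), cancel (h b) (g b) & cancel (g b) (h b)],
    {within @vf_proj R K B E @^-1` U, continuous (fun e => h _ (vf_vec e))},
    {within U `*` setT, continuous (fun p : B * 'rV[F]_k => vf_point (g p.1 p.2))} &
    mxfun (cts_on U) S /\ forall b, U b -> [/\ eqvar k n (S b),
      injective_on 1%:M (S b) &
      forall v : 'rV[F]_k, rvc (th (g b v)) = rvc v *m S b]].
Proof.
have [lth ith cth] := hth.
have [U [k [h [g [bU hg ch cg]]]]] := lE b0; have [oU _] := bU.
pose f b (v : 'rV[F]_k) := th (g b v).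
have lf b : U b -> linear (f b).
  move=> /hg[lh hK gK] a u v; rewrite /f -lth; congr th.
  by apply: (can_inj hK); rewrite lh !gK.
exists U, k, h, g, (fun b => realmx (f b)); split=> //; split=> [i j|b Ub].
  apply/(cts_on_open _ oU) => b Ub.
  pose G (p : B * 'rV[F]_k) := rvc (th (vf_vec (vf_point (g p.1 p.2)))) 0 j.
  have -> : (fun b => realmx (f b) i j) = (fun b => G (b, coord_vec (delta_mx 0 i))).
    by apply/funext => c; rewrite /G th_point !mxE.
  have oUT : open (U `*` (setT : set 'rV[F]_k)).
    exact: open_setXT.
  have UTb (v : 'rV[F]_k) : (U `*` setT) (b, v) by [].
  apply: (@continuous_comp _ _ _ (fun b => (b, coord_vec (delta_mx 0 i))) G).
    exact: continuous_pairl.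
  apply: (@continuous_comp _ _ _ (fun p : B * 'rV[F]_k => vf_point (g p.1 p.2))
    (fun e => rvc (th (vf_vec e)) 0 j)).
    move: cg; rewrite continuous_open_subspace //.
    by move=> /(_ (b, coord_vec (delta_mx 0 i))); apply; rewrite inE.
  apply: (@continuous_comp _ _ _ (fun e => th (vf_vec e)) (fun v => rvc v 0 j)).
    exact: cth.
  exact: real_vec_coord_continuous.
have lfb := lf b Ub; have rf := linear_real_linear lfb.
split.
- exact: equivariant_realmx.
- move=> w _; rewrite -(coord_vecK w) realmxE // => fw.
  have : f b (coord_vec w) = 0.
    by apply: (@rvc_inj R K n); rewrite fw real_vec_coord0.
  rewrite -(linear_fun0 lfb) => /ith; have [_ _ gK] := hg b Ub.
  by move/(can_inj gK) => ->; rewrite real_vec_coord0.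
- by move=> v; rewrite realmxE.
Qed.

Context (W : B -> submodClosed 'rV[F]_n).
Hypothesis WE : forall b v, v \in W b <-> exists u, @th b u = v.

Lemma image_frame (b : B) k (g : 'rV[F]_k -> vf_fib E b) (h : vf_fib E b -> 'rV[F]_k)
    (S : 'M[R]_(k * d, n * d)) : cancel h g -> injective_on 1%:M S ->
  (forall v : 'rV[F]_k, rvc (th (g v)) = rvc v *m S) ->
  is_proj (rowproj 1%:M S) (W b).
Proof.
move=> hK iS gS; have o1 := orthproj1 R (k * d).
split=> [|v]; first by apply: rowproj_orth; rewrite ?mul1mx.
rewrite rowprojP ?mul1mx // WE; split=> [[u <-]|[w vw]].
  by exists (rvc (h u)); rewrite -gS hK.
by exists (g (coord_vec w)); apply: (@rvc_inj R K n); rewrite gS coord_vecK.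
Qed.

(** Over a trivializing set the projection is the [rowproj] of the continuous [S]. *)
Lemma image_projection : exists P : B -> 'M[R]_(n * d),
  mxfun (cts_on setT) P /\ forall b, is_proj (P b) (W b).
Proof.
have ex b : exists P, is_proj P (W b).
  have [U [k [h [g [S [[_ Ub] hg _ _ [_ HS]]]]]]] := local_frame b.
  have [_ hK _] := hg b Ub; have [_ iS gS] := HS b Ub.
  by exists (rowproj 1%:M (S b)); exact: image_frame hK iS gS.
pose P b := projT1 (cid (ex b)).
have PW b : is_proj (P b) (W b) by rewrite /P; case: cid.
exists P; split=> // i j; apply/cts_onT => b.
have [U [k [h [g [S [[oU Ub] hg _ _ [cS HS]]]]]]] := local_frame b.
have F := @cts_on_funring R B U.
have : mxfun (cts_on U) P.
  apply: (mxfun_ext F (A := fun b => rowproj 1%:M (S b))).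
    apply: (mxfun_rowproj F) => //; first exact: (mxfun_cst F).
    move=> c Uc; have [_ iS _] := HS c Uc.
    by exact: gram1_unit.
  move=> c Uc; have [_ hK _] := hg c Uc; have [_ iS gS] := HS c Uc.
  exact: (is_proj_uniq _ (image_frame hK iS gS) (PW c)).
by move=> /(_ i j)/(cts_on_open _ oU); exact.
Qed.

End FamiliesIntoProduct.

Lemma cvg_finsum (R : realType) (Y : Type) (G : set_system Y) (I : finType)
    (f : I -> Y -> R) (a : I -> R) : Filter G ->
  (forall i, f i @ G --> a i) -> (fun y => \sum_i f i y) @ G --> \sum_i a i.
Proof.
move=> FG fa; elim: (index_enum I) => [|i r IH].
  by rewrite big_nil; under [X in X @ _]eq_fun do rewrite big_nil; exact: cvg_cst.
rewrite big_cons; under [X in X @ _]eq_fun do rewrite big_cons.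
by apply: cvgD.
Qed.

Lemma continuous_near_eq (X Y : topologicalType) (f g : X -> Y) x :
  (\forall z \near x, f z = g z) -> {for x, continuous g} ->
  {for x, continuous f}.
Proof.
move=> fg cg; rewrite /prop_for /continuous_at (nbhs_singleton fg).
apply: cvg_trans cg; apply: near_eq_cvg.
by apply: filterS fg.
Qed.

Lemma continuous_pair_at (X Y Z : topologicalType) (f : X -> Y) (g : X -> Z) x :
  {for x, continuous f} -> {for x, continuous g} ->
  {for x, continuous (fun z => (f z, g z))}.
Proof.
move=> cf cg A [[P Q] [/= fP gQ] PQA].
have h1 : \forall z \near x, P (f z) by exact: cf.
have h2 : \forall z \near x, Q (g z) by exact: cg.
by apply: filterS2 h1 h2 => z Pz Qz; exact: (PQA (_, _)).
Qed.

Section Subfamilies.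
Context (R : realType) (K : scalar_kind) (V : funspace R) (X : set V).
Local Notation F := (scalars R K).
Local Notation d := (real_dim K).
Local Notation rvc := (@real_vec_coord R K _).
Local Notation eqvar n q := (equivariant (@scalar_mx R K n) (@scalar_mx R K q)).
Local Notation T := (set_type X).

Definition sub_vec n (xi : V -> submodClosed 'rV[F]_n) (b : T)
  (v : vf_fib (subfamily xi X) b) : 'rV[F]_n := fibre_val v.

Lemma sub_vec_embedding n (xi : V -> submodClosed 'rV[F]_n) :
  family_embedding (@sub_vec n xi).
Proof.
split=> [b a u v//|b|]; first exact: val_inj.
move=> e; apply: (@continuous_comp _ _ _ (fun e : vf_total (subfamily xi X) =>
  subfamily_incl (e : {b & _})) snd); last exact: cvg_snd.
exact: (@initial_continuous _ _ (@subfamily_incl R K V n xi X)).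
Qed.

Lemma sub_vec_image n (xi : V -> submodClosed 'rV[F]_n) (b : T) v :
  v \in xi (set_val b) <-> exists u, @sub_vec n xi b u = v.
Proof.
by split=> [vx|[[u ux] <-]]; [exists (Fibre vx)|].
Qed.

Lemma into_subfamily (Y : topologicalType) n (xi : V -> submodClosed 'rV[F]_n)
    (G : Y -> vf_total (subfamily xi X)) y :
  {for y, continuous (fun z => vf_proj (G z))} ->
  {for y, continuous (fun z => sub_vec (vf_vec (G z)))} -> {for y, continuous G}.
Proof.
move=> cp cv A [? /= [[W oW <-]]] /= Wy /filterS; apply.
have : nbhs (subfamily_incl (G y : {b & _})) W by exact: open_nbhs_nbhs.
move=> [[P Q] /= [Py Qy] PQ].
have cP : \forall z \near y, P (set_val (vf_proj (G z))).
  apply: (@continuous_comp _ _ _ (fun z => vf_proj (G z)) (fun b : T => set_val b)).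
  - exact: cp.
  - exact: (@initial_continuous T V set_val).
  - exact: Py.
have cQ : \forall z \near y, Q (sub_vec (vf_vec (G z))) by exact: cv.
by apply: filterS2 cP cQ => z Pz Qz; exact: (PQ (_, _)).
Qed.

Lemma sub_cts_mul (Y : topologicalType) n q (D : set T) (A : T -> 'M[R]_(n * d, q * d))
    (bf : Y -> T) (vf : Y -> 'rV[F]_n) (y : Y) : open D -> D (bf y) ->
  mxfun (cts_on D) A -> {for y, continuous bf} -> {for y, continuous vf} ->
  {for y, continuous (fun z => coordmap (A (bf z)) (vf z))}.
Proof.
move=> oD Dy cA cb cv; apply: coord_vec_cvg => j.
rewrite coordmapE; under [X in X @ _]eq_fun do rewrite coordmapE.
rewrite mxE; under [X in X @ _]eq_fun do rewrite mxE.
apply: cvg_finsum => k.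
apply: cvgM.
  apply: (@continuous_comp _ _ _ vf (fun v => rvc v 0 k)) => //.
  exact: real_vec_coord_continuous.
apply: (@continuous_comp _ _ _ bf (fun b => A b k j)) => //.
by have /(cts_on_open _ oD) := cA k j; apply.
Qed.

Lemma mxfun_ctsS m q (D : set T) (A : T -> 'M[R]_(m, q)) :
  mxfun (cts_on setT) A -> mxfun (cts_on D) A.
Proof. by move=> cA i j; apply: (cts_onS _ (@cA i j)). Qed.

Lemma image_subfamily (E : vfamily R K T) n (xi : V -> submodClosed 'rV[F]_n)
    (th : forall b, vf_fib E b -> 'rV[F]_n) :
  locally_trivial E -> family_embedding th ->
  (forall (b : T) v, v \in xi (set_val b) <-> exists u, @th b u = v) ->
  top_isomorphic E (subfamily xi X).
Proof.
move=> lE hth xiE; have [lth ith cth] := hth.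
have thxi b (v : vf_fib E b) : th b v \in xi (set_val b) by apply/xiE; exists v.
have ex b (w : vf_fib (subfamily xi X) b) : exists u, th b u = sub_vec w.
  by apply/xiE; case: w.
pose phi b (v : vf_fib E b) : vf_fib (subfamily xi X) b := Fibre (thxi b v).
pose psi b (w : vf_fib (subfamily xi X) b) : vf_fib E b := projT1 (cid (ex b w)).
have psiE b w : th b (@psi b w) = sub_vec w by rewrite /psi; case: cid.
exists phi, psi; split.
- split=> [b a u v|e]; first by apply: val_inj; rewrite /= lth.
  apply: into_subfamily; first exact: vf_proj_continuous.
  exact: cth.
- split=> [b a u v|e].
    by apply: (ith b); rewrite lth !psiE.
  have [U [k [h [g [S [[oU Ub] hg ch cg [cS HS]]]]]]] := local_frame lE hth (vf_proj e).
  have FU := @cts_on_funring R T U.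
  have uG b : U b -> gram 1%:M (S b) \in unitmx.
    move=> Ub'; have [_ iS _] := HS b Ub'.
    by exact: gram1_unit.
  (* Over [U] the inverse is [g] applied to these coordinates, which the pseudo-inverse of [S]
     computes continuously. *)
  pose c (z : vf_total (subfamily xi X)) : 'rV[F]_k :=
    coordmap (pinv 1%:M (S (vf_proj z))) (sub_vec (vf_vec z)).
  have oUe : \forall z \near e, U (vf_proj z).
    apply: (vf_proj_continuous (v := subfamily xi X)).
    exact: open_nbhs_nbhs.
  apply: (@continuous_near_eq _ _ _ (fun z => vf_point (g (vf_proj z) (c z)))).
    apply: filterS oUe => z Uz.
    congr vf_point; apply: (ith (vf_proj z)); rewrite psiE.
    have [_ hK _] := hg _ Uz; have [_ iS gS] := HS _ Uz.
    apply: (@rvc_inj R K n); rewrite gS coordmapE -mulmxA.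
    have [_ pW] := image_frame xiE hK iS gS.
    by apply/esym/pW; case: (vf_vec z).
  have cc : {for e, continuous c}.
    apply: (@sub_cts_mul _ _ _ U (fun b => pinv 1%:M (S b)) (@vf_proj _ _ _ _)
      (fun z => sub_vec (vf_vec z)) e oU Ub).
    - exact: (mxfun_pinv FU (mxfun_cst FU _) cS).
    - exact: (vf_proj_continuous (v := subfamily xi X)).
    - by have [_ _ csv] := sub_vec_embedding xi; exact: csv.
  apply: (@continuous_comp _ _ _ (fun z => (vf_proj z, c z))
    (fun p : T * 'rV[F]_k => vf_point (g p.1 p.2))).
    apply: continuous_pair_at; last exact: cc.
    exact: (vf_proj_continuous (v := subfamily xi X)).
  move: cg; rewrite continuous_open_subspace; last exact: open_setXT.
  by move=> /(_ (vf_proj e, c e)); apply; rewrite inE.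
- by move=> b v; apply: (ith b); rewrite psiE.
- by move=> b w; apply: val_inj; rewrite /= psiE.
Qed.

(** A frame of the fibre at [b0], projected by [P b], stays a frame nearby. The trivialization reads
    off coordinates in it with the pseudo-inverse. *)
Lemma proj_locally_trivial n (xi : V -> submodClosed 'rV[F]_n) (P : T -> 'M[R]_(n * d)) :
  mxfun (cts_on setT) P -> (forall b, is_proj (P b) (xi (set_val b))) ->
  locally_trivial (subfamily xi X).
Proof.
move=> cP HP b0; have [k [s fs]] := frame_exists (xi (set_val b0)).
have FT := @cts_on_funring R T setT.
pose S b := realmx (fun c => c *m s) *m P b.
have cS : mxfun (cts_on setT) S by apply: (mxfunM FT) => //; exact: (mxfun_cst FT).
have Sxi b (c : 'rV[F]_k) : coordmap (S b) c \in xi (set_val b).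
  by have [[_ PP] ->] := HP b; rewrite coordmapE -!mulmxA PP.
have S0 : S b0 = realmx (fun c => c *m s).
  apply: real_vec_mx_eq => c; rewrite mulmxA realmxE; last first.
    exact/linear_real_linear/mulmx_linear.
  by have [_ <-] := HP b0; have [-> _] := fs; exists c.
have eS b : eqvar k n (S b).
  apply: equivariantM (is_proj_equivariant (HP b)).
  exact/equivariant_realmx/mulmx_linear.
have cG : mxfun (cts_on setT) (fun b => gram 1%:M (S b)).
  by apply: (mxfun_gram FT) => //; exact: (mxfun_cst FT).
(* A nonzero Gram determinant keeps the projected frame independent; closeness below 1 keeps the
   rank of [P b], so that the frame also spans. *)
have [U [bU HU]] : exists U, open_nbhs b0 U /\ forall b, U b ->
    \det (gram 1%:M (S b)) != 0 /\ entry_norm (P b - P b0) < 1.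
  have g0 : 0 < `|\det (gram 1%:M (S b0))|.
    rewrite normr_gt0 -unitfE -unitmxE; apply: gram1_unit.
    by rewrite S0; apply: realmx_injective; case: fs.
  have n1 := cts_on_near (fr_det FT cG) (I : setT b0) g0.
  have n2 := mxfun_near cP (I : setT b0) ltr01.
  have : nbhs b0 [set b | \det (gram 1%:M (S b)) != 0 /\ entry_norm (P b - P b0) < 1].
    apply: filterS2 n1 n2 => b /(_ Logic.I) h1 /(_ Logic.I) h2; split=> //.
    by apply: contraTneq h1 => ->; rewrite sub0r normrN ltxx.
  by rewrite nbhsE => -[U bU HU]; exists U.
have [oU Ub0] := bU.
have HS b : U b -> injective_on 1%:M (S b) /\ rowproj 1%:M (S b) = P b.
  move=> /HU[g0 Pb].
  have iS : injective_on 1%:M (S b).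
    by apply: gram_unit_injective; rewrite unitmxE unitfE.
  split=> //; have [|_ //] := is_frame_near fs (HP b0) (HP b) _ iS.
  have [[_ PP] _] := HP b; have [[_ PP0] _] := HP b0.
  exact: orthproj_close_rank.
have FU := @cts_on_funring R T U.
have uG b : U b -> gram 1%:M (S b) \in unitmx.
  by move=> /HU[g0 _]; rewrite unitmxE unitfE.
have cpU : mxfun (cts_on U) (fun b => pinv 1%:M (S b)).
  apply: (mxfun_pinv FU (mxfun_cst FU _)) => //; exact: mxfun_ctsS.
pose h b (v : vf_fib (subfamily xi X) b) := coordmap (pinv 1%:M (S b)) (sub_vec v).
pose g b (c : 'rV[F]_k) : vf_fib (subfamily xi X) b := Fibre (Sxi b c).
exists U, k, h, g; split=> //.
- move=> b Ub; have [iS SP] := HS b Ub; split.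
  + move=> a u v; rewrite /h -(coordmap_linear _ a) //.
    apply: (equivariant_pinv (@scalar_conjK R K)) => //; try exact: scalar_mx_action.
      exact: uG.
    exact: equivariant1.
  + move=> v; apply: val_inj; apply: (@rvc_inj R K n).
    rewrite /= coordmapE coordmapE -mulmxA -[_ *m S b]/(rowproj _ _) SP.
    by have [_ <-] := HP b; case: v.
  + move=> c; apply: (@rvc_inj R K k); rewrite /h /sub_vec /= !coordmapE -mulmxA.
    by rewrite mulmx_pinv ?mulmx1 ?mul1mx //; exact: orthproj1.
- apply: continuous_in_subspaceT => e; rewrite inE => Ue.
  apply: (@sub_cts_mul _ _ _ U (fun b => pinv 1%:M (S b)) (@vf_proj _ _ _ _)
    (fun z => sub_vec (vf_vec z)) e oU Ue) => //.
    exact: (vf_proj_continuous (v := subfamily xi X)).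
  by have [_ _ csv] := sub_vec_embedding xi; exact: csv.
- apply: continuous_in_subspaceT => -[b c]; rewrite inE => -[/= Ub _].
  apply: into_subfamily; first exact: cvg_fst.
  apply: (@sub_cts_mul _ _ _ setT S fst snd); try exact: cvg_fst; try exact: cvg_snd.
  + exact: openT.
  + by [].
  + exact: cS.
Qed.

Lemma matrix_morphism n q (xi : V -> submodClosed 'rV[F]_n)
    (eta : V -> submodClosed 'rV[F]_q) (A : T -> 'M[R]_(n * d, q * d))
    (phi : Defs.sub_map X xi eta) :
  mxfun (cts_on setT) A -> (forall b, eqvar n q (A b)) ->
  (forall b v, rvc (fibre_val (phi b v)) = rvc (fibre_val v) *m A b) ->
  top_morphism phi.
Proof.
move=> cA eA phiE.
have phiA b v : fibre_val (phi b v) = coordmap (A b) (fibre_val v).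
  by apply: (@rvc_inj R K q); rewrite phiE coordmapE.
split=> [b a u v|e].
  by apply: val_inj; rewrite /= !phiA -(coordmap_linear (eA b) a).
apply: into_subfamily.
  exact: (vf_proj_continuous (v := subfamily xi X)).
have -> : (fun z => sub_vec (vf_vec (vf_point (phi _ (vf_vec z))))) =
    (fun z => coordmap (A (vf_proj z)) (sub_vec (vf_vec z))).
  by apply/funext => z; exact: phiA.
apply: (@sub_cts_mul _ _ _ setT A (@vf_proj _ _ _ _)
  (fun z => sub_vec (vf_vec z)) e openT) => //.
  exact: (vf_proj_continuous (v := subfamily xi X)).
by have [_ _ csv] := sub_vec_embedding xi; exact: csv.
Qed.

(** [phi] lives on the fibres only; preceded by the projection [P b] it becomes a linear map on the
    whole of F^n and so has a matrix. *)
Lemma morphism_matrix n q (xi : V -> submodClosed 'rV[F]_n)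
    (eta : V -> submodClosed 'rV[F]_q) (P : T -> 'M[R]_(n * d))
    (phi : Defs.sub_map X xi eta) :
  mxfun (cts_on setT) P -> (forall b, is_proj (P b) (xi (set_val b))) ->
  top_morphism phi ->
  exists A : T -> 'M[R]_(n * d, q * d), [/\ mxfun (cts_on setT) A,
    forall b, eqvar n q (A b), forall b, P b *m A b = A b &
    forall b v, rvc (fibre_val (phi b v)) = rvc (fibre_val v) *m A b].
Proof.
move=> cP HP [lphi cphi].
have Pxi b (v : 'rV[F]_n) : coordmap (P b) v \in xi (set_val b).
  by have [[_ PP] ->] := HP b; rewrite coordmapE -!mulmxA PP.
pose pt b v : vf_fib (subfamily xi X) b := Fibre (Pxi b v).
pose f b v := sub_vec (phi b (pt b v)).
have ptl b : linear (pt b).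
  move=> a u v; apply: val_inj => /=.
  by rewrite -(coordmap_linear (is_proj_equivariant (HP b)) a).
have lf b : linear (f b).
  by move=> a u v; rewrite /f ptl lphi.
have fE b v : rvc v *m realmx (f b) = rvc (f b v).
  exact/realmxE/linear_real_linear.
have ptE b (v : vf_fib (subfamily xi X) b) : pt b (fibre_val v) = v.
  apply: val_inj; apply: (@rvc_inj R K n); rewrite /= coordmapE.
  by have [_ <-] := HP b; case: v.
exists (fun b => realmx (f b)); split.
- move=> i j; apply/cts_onT => b.
  under [X in continuous_at _ X]eq_fun do rewrite mxE.
  pose v0 : 'rV[F]_n := coord_vec (delta_mx 0 i).
  apply: (@continuous_comp _ _ _ (fun b => f b v0) (fun w => rvc w 0 j)); last first.
    exact: real_vec_coord_continuous.
  have [_ _ csv] := @sub_vec_embedding q eta.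
  apply: (@continuous_comp _ _ _ (fun b : T => vf_point (phi b (pt b v0)))
    (fun e : vf_total (subfamily eta X) => sub_vec (vf_vec e))); last exact: csv.
  apply: (@continuous_comp _ _ _ (fun b : T => vf_point (pt b v0) : vf_total (subfamily xi X))
    (fun e : vf_total (subfamily xi X) => vf_point (phi _ (vf_vec e)))); last exact: cphi.
  apply: into_subfamily; first by move=> Z; exact.
  apply: (@sub_cts_mul _ _ _ setT P id (fun=> v0) b openT) => //.
  by apply: (@cst_continuous T 'rV[F]_n v0).
- by move=> b; exact: equivariant_realmx.
- move=> b; apply: real_vec_mx_eq => v; rewrite mulmxA -coordmapE !fE; congr rvc.
  by rewrite /f; congr (sub_vec (phi b _)); exact: (ptE b (pt b v)).
- by move=> b v; rewrite fE /f ptE.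
Qed.

End Subfamilies.

Lemma continuous_maxr0 (R : realType) (T : topologicalType) (f : T -> R) x :
  {for x, continuous f} -> {for x, continuous (fun y => Num.max (f y) 0)}.
Proof.
move=> cf; apply: (@continuous_max R T f (fun=> 0)); first exact: cf.
exact: cvg_cst.
Qed.

(** * Embedding of a bundle over a compact base into a product bundle *)

Section Embedding.
Context (R : realType) (K : scalar_kind) (T : topologicalType) (A : set (T -> R)).
Hypotheses (hA : separating_algebra A) (cT : compact [set: T]).
Local Notation F := (scalars R K).
Local Notation rvc := (@real_vec_coord R K _).
Context (E : vfamily R K T).
Hypothesis lE : locally_trivial E.

Let partial_embedding (Z : set T) := exists n (th : forall b, vf_fib E b -> 'rV[F]_n),
  [/\ forall b, linear (th b), continuous (fun e : vf_total E => th _ (vf_vec e)) &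
    forall b, Z b -> injective (th b)].

Lemma embedding_local (b0 : T) : exists2 Z : set T, nbhs b0 Z & partial_embedding Z.
Proof.
have [U [k [h [g [bU hg ch _]]]]] := lE b0; have [oU Ub0] := bU.
have [rho [Arho rho0 rhob0 rhop]] := alg_sep hA b0.
have crho := alg_cts hA Arho.
have [r r0 rU] := sublevel_nbhs cT (open_nbhs_nbhs bU) crho rhob0 rhop.
(* A bump function that vanishes off the sublevel set [rho <= r], which lies in [U]; the arbitrary
   values of [h] off [U] get multiplied by 0. *)
pose chi b := Num.max (r - rho b) 0.
have chiU b : chi b != 0 -> U b.
  move=> c0; apply: rU; apply: contraNT c0; rewrite -ltNge => rb.
  by rewrite /chi max_r // subr_le0 ltW.
have cchi : continuous chi.
  move=> b; apply: (@continuous_maxr0 R T (fun b => r - rho b)).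
  by apply: cvgB; [exact: cvg_cst|exact: crho].
exists [set b | rho b < r].
  have := crho b0; move=> /cvgrPdist_lt/(_ r r0); apply: filterS => b.
  by rewrite rhob0 sub0r normrN ger0_norm.
exists k, (fun b v => real_scalar K (chi b) *: h b v); split.
- move=> b a u v; have [->|/chiU Ub] := eqVneq (chi b) 0.
    have rs0 : real_scalar K (0 : R) = 0.
      rewrite -[LHS]mulr1; apply: (can_inj (@real_coordK R K)).
      by rewrite real_coordZ scale0r real_coord0.
    by rewrite rs0 !scale0r scaler0 addr0.
  have [lh _ _] := hg b Ub; rewrite lh scalerDr !scalerA.
  by rewrite real_scalarC.
- apply: vec_continuous => j e.
  under [X in continuous_at _ X]eq_fun do rewrite real_vec_coordZ mxE.
  have [Ue|nUe] := pselect (U (vf_proj e)).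
    apply: cvgM.
      apply: (@continuous_comp _ _ _ (@vf_proj R K T E) chi); last exact: cchi.
      exact: vf_proj_continuous.
    apply: (@continuous_comp _ _ _ (fun e => h _ (vf_vec e)) (fun v => rvc v 0 j));
      last exact: real_vec_coord_continuous.
    move: ch; rewrite continuous_open_subspace; last first.
      by apply: open_comp => // z _; exact: vf_proj_continuous.
    by apply; rewrite inE.
  have re : r < rho (vf_proj e).
    by rewrite ltNge; apply/negP => /rU.
  suff : {for e, continuous (fun z => chi (vf_proj z) * rvc (h _ (vf_vec z)) 0 j)} by [].
  apply: (@continuous_near_eq _ _ _ (fun=> 0)); last exact: cvg_cst.
  have : \forall z \near e, r < rho (vf_proj z).
    have crp : {for e, continuous (fun z : vf_total E => rho (vf_proj z))}.
      apply: (@continuous_comp _ _ _ (@vf_proj R K T E) rho); last exact: crho.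
      exact: vf_proj_continuous.
    have /cvgrPdist_lt/(_ (rho (vf_proj e) - r)) := crp.
    rewrite subr_gt0 => /(_ re); apply: filterS => z.
    rewrite ltr_distlC => /andP[h1 _]; move: h1; rewrite opprB; lra.
  apply: filterS => z rz; rewrite /chi max_r ?mul0r // subr_le0 ltW //.
- move=> b /= rb u v uv.
  have c0 : chi b != 0 by rewrite /chi max_l ?subr_ge0 ?(ltW rb) // subr_eq0 gt_eqF.
  have [_ hK _] := hg b (chiU b c0); apply: (can_inj hK).
  apply: (@rvc_inj R K k); apply: (scalerI c0).
  by rewrite -!real_vec_coordZ uv.
Qed.

Lemma embedding_union Z Z' : partial_embedding Z -> partial_embedding Z' ->
  partial_embedding (Z `|` Z').
Proof.
move=> [n [th [lth cth ith]]] [n' [th' [lth' cth' ith']]].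
exists (n + n')%N, (fun b v => row_mx (th b v) (th' b v)); split.
- by move=> b a u v; rewrite lth lth' scale_row_mx add_row_mx.
- move=> e; apply: mx_cvg => i j; rewrite mxE.
  under [X in X @ _]eq_fun do rewrite mxE.
  case: (fintype.split j) => l.
    apply: (@continuous_comp _ _ _ (fun e => th _ (vf_vec e)) (fun v => v i l)).
      exact: cth.
    exact: mx_entry_continuous.
  apply: (@continuous_comp _ _ _ (fun e => th' _ (vf_vec e)) (fun v => v i l)).
    exact: cth'.
  exact: mx_entry_continuous.
- move=> b [Zb|Zb] u v /eq_row_mx[]; first by move=> /ith -/(_ Zb).
  by move=> _ /ith' -/(_ Zb).
Qed.

Lemma embedding_exists :
  exists n (th : forall b, vf_fib E b -> 'rV[F]_n), family_embedding th.
Proof.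
have [||b _|Z [n [th [lth cth ith]]] TZ] :=
  @compact_union_ind T setT partial_embedding cT.
- exists 0%N, (fun b v => 0); split=> //.
    by move=> b a u v; rewrite scaler0 addr0.
  by move=> e; exact: cvg_cst.
- exact: embedding_union.
- exact: embedding_local.
- by exists n, th; split=> // b; apply: ith; exact: TZ.
Qed.

End Embedding.

(** * Regular functions and algebraic bundles *)

(* The algebra [A] of the functions induced by the polynomials of an ambient
   affine space determines the Zariski topology and the regular functions. *)
Record coordinate_algebra (R : realType) (V : funspace R) (A : set (V -> R)) := {
  ca_alg :> function_algebra A;
  ca_sep : forall a, exists rho, [/\ A rho, forall x, 0 <= rho x, rho a = 0 &
    forall x, x <> a -> 0 < rho x];
  ca_open : forall U, fs_zopen U <-> algebra_zopen A U;
  ca_reg : forall U g, fs_zopen U -> (fs_reg U g <-> forall x, U x ->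
    exists n q, [/\ A n, A q, q x != 0 &
      forall y, U y -> q y != 0 -> g y = n y / q y]) }.

Lemma algebra_zopenP (R : realType) (T : Type) (A : set (T -> R)) U x :
  algebra_zopen A U -> U x ->
  exists p, [/\ A p, p x != 0 & forall y, p y != 0 -> U y].
Proof.
move=> [P PA ->] /= /existsNP[p /not_implyP[Pp /eqP px]].
exists p; split=> //; first exact: PA.
by move=> y py /(_ p Pp) /eqP; apply/negP.
Qed.

Lemma algebra_zopen_basis (R : realType) (T : Type) (A : set (T -> R)) p :
  A p -> algebra_zopen A [set x | p x != 0].
Proof.
move=> Ap; exists [set p]; first by move=> _ ->.
apply/seteqP; split=> x /=; first by move=> px /(_ p erefl)/eqP; apply/negP.
by move=> px; apply/eqP => px0; apply: px => _ ->.
Qed.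

Section RealVariety.
Context (R : realType) (V : funspace R).

Lemma poly_evalM m (p q : mpoly.mpoly m R) (x : 'rV[R]_m) :
  poly_eval (p * q) x = poly_eval p x * poly_eval q x.
Proof. exact: mpoly.mevalM. Qed.

Lemma poly_evalD m (p q : mpoly.mpoly m R) (x : 'rV[R]_m) :
  poly_eval (p + q) x = poly_eval p x + poly_eval q x.
Proof. exact: mpoly.mevalD. Qed.

Lemma poly_evalC m c (x : 'rV[R]_m) : poly_eval (mpoly.mpolyC m c) x = c.
Proof. exact: mpoly.mevalC. Qed.

Lemma poly_evalX m (i : 'I_m) (x : 'rV[R]_m) :
  poly_eval (mpoly.mpolyX R (mpoly.mnm1 i)) x = x 0 i.
Proof. exact: mpoly.mevalXU. Qed.

Lemma coordinate_algebra_exists :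
  real_variety V -> exists A : set (V -> R), coordinate_algebra A.
Proof.
move=> [m [phi [iphi cphi oV rV]]].
pose A : set (V -> R) := [set f | exists p : mpoly.mpoly m R, f = poly_eval p \o phi].
pose Am : set ('rV[R]_m -> R) := [set f | exists p : mpoly.mpoly m R, f = poly_eval p].
have oA U : fs_zopen U <-> algebra_zopen A U.
  rewrite oV; split.
    move=> [W [P PA ->] ->]; exists [set f | exists2 p, P p & f = p \o phi].
      by move=> _ [p /PA[q ->] ->]; exists q.
    apply/seteqP; split=> x /= nP H; apply: nP => p.
      by move=> Pp; apply: (H (p \o phi)); exists p.
    by move=> [q Pq ->]; exact: H.
  move=> [P PA ->]; exists (~` [set x | forall p : mpoly.mpoly m R,
      P (poly_eval p \o phi) -> poly_eval p x = 0]).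
    exists [set f | exists2 p : mpoly.mpoly m R, P (poly_eval p \o phi) & f = poly_eval p].
      by move=> _ [p _ ->]; exists p.
    apply/seteqP; split=> x /= nP H; apply: nP => p.
      by move=> Pp; apply: H; exists p.
    by move=> [q Pq ->]; exact: H.
  apply/seteqP; split=> x /= nP H; apply: nP => p.
    by move=> Pp; have [q pq] := PA p Pp; rewrite pq /=; apply: H; rewrite -pq.
  by move=> Pp; exact: (H (poly_eval p \o phi)).
exists A; split=> //.
- split.
  + by move=> c; exists (mpoly.mpolyC m c); apply/funext => x; rewrite /= poly_evalC.
  + by move=> f g [p ->] [q ->]; exists (p + q); apply/funext => x; rewrite /= poly_evalD.
  + by move=> f g [p ->] [q ->]; exists (p * q); apply/funext => x; rewrite /= poly_evalM.
- move=> a.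
  pose P : mpoly.mpoly m R := \sum_(i < m)
    (mpoly.mpolyX R (mpoly.mnm1 i) + mpoly.mpolyC m (- phi a 0 i)) *
    (mpoly.mpolyX R (mpoly.mnm1 i) + mpoly.mpolyC m (- phi a 0 i)).
  have PE x : poly_eval P x = \sum_(i < m) (x 0 i - phi a 0 i) ^+ 2.
    rewrite /P /poly_eval (big_morph _ (mpoly.mevalD _) (mpoly.meval0 _)).
    apply: eq_bigr => i _; rewrite -/(poly_eval _ x) poly_evalM.
    by rewrite poly_evalD poly_evalX poly_evalC expr2.
  exists (poly_eval P \o phi); split.
  + by exists P.
  + by move=> x; rewrite /= PE; apply: sumr_ge0 => i _; exact: sqr_ge0.
  + by rewrite /= PE; apply: big1 => i _; rewrite subrr expr0n.
  + move=> x xa; rewrite /= lt_def PE; apply/andP; split; last first.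
      by apply: sumr_ge0 => i _; exact: sqr_ge0.
    apply/negP => /eqP H; apply: xa; apply: iphi; apply/rowP => i.
    move/eqP: H; rewrite psumr_eq0; last by move=> j _; exact: sqr_ge0.
    by move=> /allP/(_ i (mem_index_enum _)) /=; rewrite sqrf_eq0 subr_eq0 => /eqP.
- move=> U g oU.
  (* [g] transported to the range of [phi]; regularity is tested only on subsets of this range, away
     from the default value 0. *)
  pose g' (y : 'rV[R]_m) : R :=
    if pselect (exists x, phi x = y) is left h then g (projT1 (cid h)) else 0.
  have g'E x : g' (phi x) = g x.
    rewrite /g'; case: pselect => [h|[]]; last by exists x.
    by congr g; apply: iphi; case: (cid h).
  have gE : g = g' \o phi by apply/funext => x; rewrite /= g'E.
  rewrite gE (rV U g' oU); split.
    move=> H x Ux; have [|U2 [g2 [oU2 U2x rg2 gg2]]] := H (phi x); first by exists x.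
    have [W [p [q [oW Wx [p' pE] [q' qE] pq]]]] := rg2 (phi x) U2x.
    have [s [[s' sE] sx sU2]] := algebra_zopenP oU2 U2x.
    have [t [[t' tE] tx tW]] := algebra_zopenP oW Wx.
    (* The factor [s' * t'] vanishes on [phi x] unless it lies in both open sets where the local
       formula is known, so the formula holds wherever the new denominator is nonzero. *)
    exists (poly_eval (p' * (s' * t')) \o phi), (poly_eval (q' * (s' * t')) \o phi).
    split; [by eexists|by eexists| |].
      rewrite /= !poly_evalM -sE -tE -qE !mulf_neq0 //.
      by have [] := pq _ Wx U2x.
    move=> y Uy; rewrite /= !poly_evalM -sE -tE -qE -pE !mulf_eq0 !negb_or.
    move=> /and3P[qy sy ty]; rewrite gg2 //=; last 2 first.
      by exists y.
      exact: sU2.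
    have [_ ->] := pq _ (tW _ ty) (sU2 _ sy).
    by rewrite -mulf_div divff ?mulr1 // mulf_neq0.
  move=> H _ [x Ux <-]; have [n [q [[n' nE] [q' qE] qx nq]]] := H x Ux.
  exists [set y | poly_eval q' y != 0], (fun y => poly_eval n' y / poly_eval q' y).
  have oq : algebra_zopen Am [set y | poly_eval q' y != 0].
    by apply: algebra_zopen_basis; exists q'.
  split=> //.
  + by rewrite qE in qx.
  + move=> y qy; exists [set y | poly_eval q' y != 0], (poly_eval n'), (poly_eval q').
    by split=> //; [exists n'|exists q'].
  + move=> _ [y Uy <-] qy; have := nq y Uy; rewrite nE qE /=; exact.
Qed.

End RealVariety.

Lemma ptws_eval_continuous (I : Type) (T : topologicalType) (i : I) :
  continuous (fun g : {ptws I -> T} => g i).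
Proof.
move=> f; have /cvg_sup/(_ i)/cvg_image : f --> f by apply: cvg_id.
move=> h; apply: cvg_trans (h _) => {h}.
  by move=> Q /= [W nbdW <-]; apply: filterS nbdW; exact: preimage_image.
by rewrite eqEsubset; split => y // _; exists (fun=> y).
Qed.

Section RegularFunctions.
Context (R : realType) (V : funspace R) (A : set (V -> R)).
Hypothesis hA : coordinate_algebra A.

(** The fraction is valid on the whole locus [q y != 0] inside [W], so no separate neighbourhood has
    to be carried along. *)
Definition locally_quotient (W : set V) : set (V -> R) :=
  [set f | forall x, W x -> exists n q, [/\ A n, A q, q x != 0 &
    forall y, W y -> q y != 0 -> f y = n y / q y]].

Lemma zopen_basis q : A q -> fs_zopen [set x | q x != 0].
Proof. by move=> Aq; apply/(ca_open hA)/algebra_zopen_basis. Qed.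

Lemma regular_onP W f : regular_on W f <-> locally_quotient W f.
Proof.
split=> rf x Wx.
  have [U [g [oU Ux /(ca_reg hA _ oU) rg fg]]] := rf x Wx.
  have [n [q [An Aq qx gE]]] := rg x Ux.
  have [s [As sx sU]] := algebra_zopenP ((ca_open hA U).1 oU) Ux.
  exists (fun x => n x * s x), (fun x => q x * s x).
  split; [exact: (alg_mul hA)|exact: (alg_mul hA)|by rewrite mulf_neq0|].
  move=> y Wy; rewrite mulf_eq0 negb_or => /andP[qy sy].
  have Uy := sU y sy.
  by rewrite (fg y Wy Uy) (gE y Uy qy) -mulf_div divff // mulr1.
have [n [q [An Aq qx fE]]] := rf x Wx.
have oq := zopen_basis Aq.
exists [set y | q y != 0], (fun y => n y / q y); split=> //.
by apply/(ca_reg hA _ oq) => y qy; exists n, q.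
Qed.

Lemma locally_quotient_funring W : funring W (locally_quotient W).
Proof.
split.
- move=> c x Wx; exists (fun=> c), (fun=> 1); split; try exact: (alg_cst hA).
    exact: oner_neq0.
  by move=> y _ _; rewrite divr1.
- move=> f g rf rg x Wx; have [n [q [An Aq qx fE]]] := rf x Wx.
  have [n' [q' [An' Aq' q'x gE]]] := rg x Wx.
  exists (fun x => n x * q' x + n' x * q x), (fun x => q x * q' x); split.
  + by apply: (alg_add hA); apply: (alg_mul hA).
  + exact: (alg_mul hA).
  + by rewrite mulf_neq0.
  + move=> y Wy; rewrite mulf_eq0 negb_or => /andP[qy q'y].
    by rewrite fE // gE // addf_div.
- move=> f g rf rg x Wx; have [n [q [An Aq qx fE]]] := rf x Wx.
  have [n' [q' [An' Aq' q'x gE]]] := rg x Wx.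
  exists (fun x => n x * n' x), (fun x => q x * q' x); split.
  + exact: (alg_mul hA).
  + exact: (alg_mul hA).
  + by rewrite mulf_neq0.
  + move=> y Wy; rewrite mulf_eq0 negb_or => /andP[qy q'y].
    by rewrite fE // gE // mulf_div.
- move=> f rf f0 x Wx; have [n [q [An Aq qx fE]]] := rf x Wx.
  (* The plain inverse q / n may be wrong where [q] vanishes; the extra factor [q] in the
     denominator excludes these points. *)
  exists (fun x => q x * q x), (fun x => n x * q x); split.
  + exact: (alg_mul hA).
  + exact: (alg_mul hA).
  + have := f0 x Wx; rewrite fE // mulf_eq0 negb_or => /andP[nx _].
    by rewrite mulf_neq0.
  + move=> y Wy; rewrite mulf_eq0 negb_or => /andP[ny qy].
    by rewrite fE // invf_div -mulf_div divff // mulr1.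
- move=> f g rf fg x Wx; have [n [q [An Aq qx fE]]] := rf x Wx.
  by exists n, q; split=> // y Wy qy; rewrite -fg // fE.
Qed.

Lemma locally_quotientS W W' f :
  W' `<=` W -> locally_quotient W f -> locally_quotient W' f.
Proof.
move=> WW rf x W'x; have [n [q [An Aq qx fE]]] := rf x (WW _ W'x).
by exists n, q; split=> // y W'y; exact/fE/WW.
Qed.

(** As [f] is a fraction only locally, [U] is the union of all basic open sets on which [f] has no
    zero in [W]. Near a given point numerator times denominator defines such a set. *)
Lemma nonvanishing_zopen W f : locally_quotient W f ->
  exists2 U : set V, fs_zopen U & forall x, W x -> (U x <-> f x != 0).
Proof.
move=> rf; pose P : set (V -> R) :=
  [set p | A p /\ forall y, W y -> p y != 0 -> f y != 0].
exists (~` [set x | forall p, P p -> p x = 0]).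
  by apply/(ca_open hA); exists P => // p [].
move=> x Wx; split=> [/existsNP[p /not_implyP[[Ap Pp] /eqP px]]|fx].
  exact: Pp.
have [n [q [An Aq qx fE]]] := rf x Wx.
move=> /(_ (fun y => n y * q y)) H.
have : n x * q x != 0.
  by move: fx; rewrite fE // mulf_eq0 negb_or => /andP[nx _]; rewrite mulf_neq0.
rewrite H ?eqxx //; split; first exact: (alg_mul hA).
move=> y Wy; rewrite mulf_eq0 negb_or => /andP[ny qy].
by rewrite fE // mulf_neq0 // invr_eq0.
Qed.

Lemma zopenI (U U' : set V) : fs_zopen U -> fs_zopen U' -> fs_zopen (U `&` U').
Proof.
move=> /(ca_open hA) oU /(ca_open hA) oU'.
pose P : set (V -> R) := [set p | A p /\ forall y, p y != 0 -> (U `&` U') y].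
apply/(ca_open hA); exists P; first by move=> p [].
apply/seteqP; split=> x /=.
  move=> [Ux U'x] H; have [p [Ap px pU]] := algebra_zopenP oU Ux.
  have [q [Aq qx qU]] := algebra_zopenP oU' U'x.
  have : p x * q x != 0 by rewrite mulf_neq0.
  rewrite (H (fun y => p y * q y)) ?eqxx //; split; first exact: (alg_mul hA).
  move=> y; rewrite mulf_eq0 negb_or => /andP[py qy].
  by split; [exact: pU|exact: qU].
by move=> /existsNP[p /not_implyP[[Ap Pp] /eqP px]]; exact: Pp.
Qed.

Lemma zopenT : fs_zopen (setT : set V).
Proof.
have := zopen_basis (alg_cst hA 1); congr fs_zopen.
by apply/seteqP; split=> // x _ /=; exact: oner_neq0.
Qed.

Lemma zclosed_zeros (P : set (V -> R)) :
  P `<=` A -> zclosed [set x | forall p, P p -> p x = 0].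
Proof. by move=> PA; apply/(ca_open hA); exists P. Qed.

Lemma zclosure_zero (C : set V) p : A p -> (forall x, C x -> p x = 0) ->
  forall x, zclosure C x -> p x = 0.
Proof.
move=> Ap pC x /(_ [set x | p x = 0]); apply; split=> //.
have -> : [set x | p x = 0] = [set x | forall q, [set p] q -> q x = 0].
  by apply/seteqP; split=> y /=; [move=> py _ ->|exact].
by apply: zclosed_zeros => _ ->.
Qed.

Lemma sub_zclosure (C : set V) : C `<=` zclosure C.
Proof. by move=> x Cx D [_ CD]; exact: CD. Qed.

(** The numerator vanishes on [C], hence on its Zariski closure. This identity principle carries
    matrix identities from a cell to a Zariski neighbourhood of it in its closure. *)
Lemma quotient_zero_closure (C Z : set V) f : C `<=` Z -> Z `<=` zclosure C ->
  quotients A Z f -> (forall x, C x -> f x = 0) -> forall x, Z x -> f x = 0.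
Proof.
move=> CZ ZC [n [q [An Aq fE]]] fC x Zx; have [qx ->] := fE x Zx.
rewrite (zclosure_zero An _ (ZC _ Zx)) ?mul0r // => y Cy.
have [qy fy] := fE y (CZ _ Cy); have := fC y Cy; rewrite fy => /eqP.
by rewrite mulf_eq0 invr_eq0 (negPf qy) orbF => /eqP.
Qed.

(** A coordinate of the product of [v] with a regular matrix is a sum over the entries of a column;
    a common denominator makes it a single fraction on the total space. *)
Lemma common_denominator (I : finType) W (f : I -> V -> R) x :
  (forall i, locally_quotient W (f i)) -> W x ->
  exists (n : I -> V -> R) q, [/\ forall i, A (n i), A q, q x != 0 &
    forall y, W y -> q y != 0 -> forall i, f i y = n i y / q y].
Proof.
move=> rf Wx.
suff H (s : seq I) : exists (n : I -> V -> R) q,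
    [/\ forall i, A (n i), A q, q x != 0 &
    forall y, W y -> q y != 0 -> forall i, i \in s -> f i y = n i y / q y].
  have [n [q [An Aq qx fE]]] := H (enum I); exists n, q; split=> // y Wy qy i.
  by apply: fE; rewrite ?mem_enum.
elim: s => [|j s [n [q [An Aq qx fE]]]].
  exists (fun _ _ => 1), (fun=> 1); split=> //; try by move=> *; exact: (alg_cst hA).
have [n' [q' [An' Aq' q'x gE]]] := rf j x Wx.
exists (fun i y => if i == j then n' y * q y else n i y * q' y),
  (fun y => q y * q' y); split.
- by move=> i; case: eqP => _; exact: (alg_mul hA).
- exact: (alg_mul hA).
- by rewrite mulf_neq0.
- move=> y Wy; rewrite mulf_eq0 negb_or => /andP[qy q'y] i.
  rewrite inE; case: eqP => [-> _|_ /= iS].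
    by rewrite gE // [q y * _]mulrC -mulf_div divff // mulr1.
  by rewrite fE // -mulf_div divff // mulr1.
Qed.

Lemma alg_regular f : A f -> fs_reg setT f.
Proof.
move=> Af; apply/(ca_reg hA _ zopenT) => x _.
exists f, (fun=> 1); split=> //; first exact: (alg_cst hA).
by move=> y _ _; rewrite divr1.
Qed.

Lemma alg_continuous f : A f -> continuous f.
Proof.
move=> /alg_regular rf; pose f' : {f : V -> R | fs_reg setT f} := exist _ f rf.
move=> x; apply: (@continuous_comp V {ptws {f : V -> R | fs_reg setT f} -> R} R
  (@regular_eval R V) (fun g => g f')); last exact: ptws_eval_continuous.
exact: initial_continuous.
Qed.

End RegularFunctions.

(** * Algebraic bundles and regular fields of projections *)

Section AlgebraicBundles.
Context (R : realType) (K : scalar_kind) (V : funspace R) (A : set (V -> R)).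
Hypothesis hA : coordinate_algebra A.
Local Notation F := (scalars R K).
Local Notation d := (real_dim K).
Local Notation rc := (@real_coord R K).
Local Notation rvc := (@real_vec_coord R K _).
Local Notation eqvar n q := (equivariant (@scalar_mx R K n) (@scalar_mx R K q)).

Lemma locally_quotient_local W f :
  (forall x, W x -> exists U : set V, [/\ fs_zopen U, U x &
    locally_quotient A (W `&` U) f]) -> locally_quotient A W f.
Proof.
move=> H x Wx; have [U [oU Ux rf]] := H x Wx.
have [n [q [An Aq qx fE]]] := rf x (conj Wx Ux).
have [s [As sx sU]] := algebra_zopenP ((ca_open hA U).1 oU) Ux.
exists (fun x => n x * s x), (fun x => q x * s x).
split; [exact: (alg_mul hA)|exact: (alg_mul hA)|by rewrite mulf_neq0|].
move=> y Wy; rewrite mulf_eq0 negb_or => /andP[qy sy].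
by rewrite (fE y (conj Wy (sU y sy)) qy) -mulf_div divff // mulr1.
Qed.

Lemma real_coordM (c z : F) : rc (c * z) =
  \sum_m rc z 0 m *: rc (c * coord_scalar (delta_mx 0 m)).
Proof.
have zE : z = \sum_m real_scalar K (rc z 0 m) * coord_scalar (delta_mx 0 m).
  apply: (can_inj (@real_coordK R K)).
  rewrite (big_morph _ (@real_coordD R K) (real_coord0 R K)) [LHS]row_sum_delta.
  by apply: eq_bigr => m _; rewrite real_coordZ coord_scalarK.
rewrite {1}zE mulr_sumr (big_morph _ (@real_coordD R K) (real_coord0 R K)).
by apply: eq_bigr => m _; rewrite mulrA -real_scalarC -mulrA real_coordZ.
Qed.

Lemma realmx_regular W k n (s : V -> 'M[F]_(k, n)) :
  (forall i j l, locally_quotient A W (fun y => rc (s y i j) 0 l)) ->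
  mxfun (locally_quotient A W) (fun y => realmx (fun c => c *m s y)).
Proof.
have SR := locally_quotient_funring hA W => rs i' j'.
case/mxvec_indexP: j' => j l.
pose c : 'rV[F]_k := coord_vec (delta_mx 0 i').
apply: (fr_ext SR (f := fun y => \sum_i \sum_m rc (s y i j) 0 m *
    rc (c 0 i * coord_scalar (delta_mx 0 m)) 0 l)).
  apply: (fr_sum SR) => i; apply: (fr_sum SR) => m.
  by apply: (fr_mul SR) => //; exact: (fr_cst SR).
move=> y _; rewrite mxE real_vec_coordE mxE.
rewrite (big_morph _ (@real_coordD R K) (real_coord0 R K)) summxE.
apply: eq_bigr => i _; rewrite [in RHS]real_coordM summxE.
by apply: eq_bigr => m _; rewrite [RHS]mxE.
Qed.

(** As in [proj_locally_trivial], a frame at one point is projected to the other fibres. Its Gram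
    determinant is regular and cuts out a Zariski open set; constancy of the rank replaces closeness
    of the projections. *)
Lemma proj_alg_subbundle n (W : set V) (xi : V -> submodClosed 'rV[F]_n)
    (P : V -> 'M[R]_(n * d)) :
  mxfun (locally_quotient A W) P -> (forall x, W x -> is_proj (P x) (xi x)) ->
  (forall x y, W x -> W y -> \rank (P x) = \rank (P y)) ->
  alg_subbundle W xi.
Proof.
have SR := locally_quotient_funring hA W => rP PW rk x0 Wx0.
have [k [s fs]] := frame_exists (xi x0).
pose S y := realmx (fun c => c *m s) *m P y.
have rS : mxfun (locally_quotient A W) S.
  by apply: (mxfunM SR) => //; exact: (mxfun_cst SR).
have rG := mxfun_gram SR (mxfun_cst SR 1%:M) rS.
have [U oU UE] := nonvanishing_zopen hA (fr_det SR rG).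
have Ux0 : U x0.
  apply/UE => //; rewrite -unitfE -unitmxE; apply: gram1_unit.
  have -> : S x0 = realmx (fun c => c *m s).
    apply: real_vec_mx_eq => c; rewrite mulmxA realmxE; last first.
      exact/linear_real_linear/mulmx_linear.
    by have [_ <-] := PW x0 Wx0; have [-> _] := fs; exists c.
  by apply: realmx_injective; case: fs.
exists U, k, (fun y => scalarmx (S y)); split=> //.
  move=> i j l; apply/(regular_onP hA).
  apply: (locally_quotientS (W := W)) => [x []//|].
  apply: (fr_ext SR (f := fun y => (rvc (delta_mx 0 i) *m S y) 0 (mxvec_index j l))).
    by apply: (mxfunM SR (mxfun_cst SR _) rS).
  have scE (M : 'M[R]_(k * d, n * d)) : scalarmx M i j = coordmap M (delta_mx 0 i) 0 j.
    by rewrite /scalarmx mxE.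
  by move=> y _; rewrite scE -real_vec_coordE coordmapE.
move=> y Wy Uy.
have iS : injective_on 1%:M (S y).
  by apply: gram_unit_injective; rewrite unitmxE unitfE; apply/UE.
by have [] := is_frame_near fs (PW x0 Wx0) (PW y Wy) (rk y x0 Wy Wx0) iS.
Qed.

(** The row projection of a regular frame is regular, and by uniqueness it does not depend on the
    frame. *)
Lemma alg_subbundle_proj n (W : set V) (xi : V -> submodClosed 'rV[F]_n) :
  alg_subbundle W xi -> exists P : V -> 'M[R]_(n * d),
  mxfun (locally_quotient A W) P /\ forall x, W x -> is_proj (P x) (xi x).
Proof.
move=> aW.
have ex x : exists P, W x -> is_proj P (xi x).
  have [Wx|nW] := pselect (W x); last by exists 0.
  have [U [k [s [oU Ux rs fs]]]] := aW x Wx.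
  by exists (rowproj 1%:M (realmx (fun c => c *m s x))) => _; exact/is_frame_proj/fs.
pose P x := projT1 (cid (ex x)).
have PW x : W x -> is_proj (P x) (xi x) by rewrite /P; case: cid.
exists P; split=> // i j; apply: locally_quotient_local => x Wx.
have [U [k [s [oU Ux rs fs]]]] := aW x Wx; exists U; split=> //.
have SR := locally_quotient_funring hA (W `&` U).
have rS : mxfun (locally_quotient A (W `&` U)) (fun y => realmx (fun c => c *m s y)).
  by apply: realmx_regular => i' j' l; apply/(regular_onP hA).
apply: (fr_ext SR (mxfun_rowproj SR (mxfun_cst SR 1%:M) rS _ i j)).
  move=> y [Wy Uy]; apply: gram1_unit.
  by apply: realmx_injective; case: (fs y Wy Uy).
move=> y [Wy Uy]; congr (fun_of_matrix _ i j).
exact: is_proj_uniq (is_frame_proj (fs y Wy Uy)) (PW y Wy).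
Qed.

Lemma matrix_alg_morphism n q (W : set V) (xi : V -> submodClosed 'rV[F]_n)
    (eta : V -> submodClosed 'rV[F]_q) (N : V -> 'M[R]_(n * d, q * d)) :
  mxfun (locally_quotient A W) N -> (forall x, W x -> eqvar n q (N x)) ->
  (forall x v, W x -> v \in xi x -> coordmap (N x) v \in eta x) ->
  alg_morphism_on W xi eta (fun x v => coordmap (N x) v).
Proof.
move=> rN eN Nxi; split.
  move=> x Wx; split=> [v|a u v _ _]; first exact: Nxi.
  by have := coordmap_linear (eN x Wx) a u v.
move=> j l [x v] /= [Wx vx].
pose J := mxvec_index j l.
have [nn [q' [An Aq qx nE]]] := common_denominator hA (fun k => rN k J) Wx.
pose PA : set (V * 'rV[F]_n -> R) := [set f | exists k (a : 'I_k -> V -> R)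
  (p : mpoly.mpoly (k + n * d) R), (forall i, fs_reg setT (a i)) /\
  forall x v, f (x, v) = poly_eval p (row_mx (\row_i a i x) (rvc v))].
have PAq : PA (fun z => q' z.1).
  exists 1%N, (fun=> q'), (mpoly.mpolyX R (mpoly.mnm1 (lshift (n * d) ord0))).
  split=> [_|y w]; first exact: (alg_regular hA).
  by rewrite poly_evalX row_mxEl mxE.
have PAn : PA (fun z => \sum_k rvc z.2 0 k * nn k z.1).
  exists (n * d)%N, nn, (\sum_k mpoly.mpolyX R (mpoly.mnm1 (rshift (n * d) k)) *
    mpoly.mpolyX R (mpoly.mnm1 (lshift (n * d) k))).
  split=> [i|y w]; first exact: (alg_regular hA).
  rewrite /poly_eval (big_morph _ (mpoly.mevalD _) (mpoly.meval0 _)).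
  apply: eq_bigr => k _; rewrite -/(poly_eval _ _) poly_evalM !poly_evalX.
  by rewrite row_mxEl row_mxEr mxE.
have oU : algebra_zopen PA [set z | q' z.1 != 0] by exact: algebra_zopen_basis.
exists [set z | q' z.1 != 0], (fun z => (\sum_k rvc z.2 0 k * nn k z.1) / q' z.1).
split=> //.
  move=> z qz; exists [set z | q' z.1 != 0].
  by exists (fun z => \sum_k rvc z.2 0 k * nn k z.1), (fun z => q' z.1).
move=> [y w] /= [Wy _] qy; rewrite coord_vecE mxE mulr_suml.
by apply: eq_bigr => k _; rewrite nE // mulrA.
Qed.

End AlgebraicBundles.

Section RestrictionToSubset.
Context (R : realType) (V : funspace R) (A : set (V -> R)) (X : set V).
Hypothesis hA : coordinate_algebra A.
Local Notation T := (set_type X).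

Lemma set_val_continuous : continuous (set_val : T -> V).
Proof. exact: (@initial_continuous T V set_val). Qed.

Lemma alg_set_val_continuous f : A f -> continuous (fun b : T => f (set_val b)).
Proof.
move=> Af b; apply: (@continuous_comp _ _ _ (set_val : T -> V) f).
  exact: set_val_continuous.
exact: (alg_continuous hA Af).
Qed.

Definition extend_by Y (y0 : Y) (f : T -> Y) (x : V) : Y :=
  if pselect (X x) is left h then f (exist (fun x : V => x \in X) x (mem_set h))
  else y0.

Lemma extend_byE Y (y0 : Y) (f : T -> Y) b : extend_by y0 f (set_val b) = f b.
Proof.
rewrite /extend_by; case: pselect => [h|[]]; last exact: (set_mem (valP b)).
by congr f; exact: val_inj.
Qed.

Definition restricted_algebra : set (T -> R) :=
  [set f | exists2 g, A g & f = g \o set_val].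

Lemma restricted_algebra_separating : separating_algebra restricted_algebra.
Proof.
split; first split.
- by move=> c; exists (fun=> c) => //; exact: (alg_cst hA).
- move=> _ _ [f Af ->] [g Ag ->]; exists (fun x => f x + g x) => //.
  exact: (alg_add hA).
- move=> _ _ [f Af ->] [g Ag ->]; exists (fun x => f x * g x) => //.
  exact: (alg_mul hA).
- by move=> _ [f Af ->]; exact: alg_set_val_continuous.
- move=> a; have [rho [Arho rho0 rhoa rhop]] := ca_sep hA (set_val a).
  exists (rho \o set_val); split=> //; first by exists rho.
    by move=> x; exact: rho0.
  by move=> x xa; apply: rhop => /val_inj.
Qed.

Lemma compact_set_type : compact X -> compact [set: T].
Proof.
move=> cX G PG _; pose G' := (set_val : T -> V) @ G.
have PG' : ProperFilter G' by exact: fmap_proper_filter.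
have G'X : G' X.
  by apply: (@filterS _ G _ setT); [move=> b _; exact: (set_mem (valP b))|exact: filterT].
have [|x [Xx clx]] := cX G' PG'; first exact: G'X.
exists (exist _ x (mem_set Xx)); split=> // B N GB [_ [[W oW <-] /= Wx WN]].
have GB' : G' ((set_val : T -> V) @` B).
  by apply: (@filterS _ G _ B) => // b Bb; exists b.
have xW : nbhs x W by exact: open_nbhs_nbhs.
have [_ [[b Bb <-] Wb]] := clx _ _ GB' xW.
by exists b; split=> //; exact: WN.
Qed.

Lemma incl_continuous (C : set V) (CX : C `<=` X) :
  continuous (Defs.incl CX : set_type C -> T).
Proof.
move=> b N [_ [[W oW <-] /= Wb WN]].
have : \forall c \near b, W (set_val c).
  apply: (@initial_continuous (set_type C) V set_val); exact: open_nbhs_nbhs.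
by apply: filterS => c Wc; exact: WN.
Qed.

Lemma incl_mxfun (C : set V) (CX : C `<=` X) m n (M : T -> 'M[R]_(m, n)) :
  mxfun (cts_on setT) M ->
  mxfun (cts_on setT) (fun b : set_type C => M (Defs.incl CX b)).
Proof.
move=> cM i j; apply/cts_onT => b.
apply: (@continuous_comp _ _ _ (Defs.incl CX : set_type C -> T) (fun b => M b i j)).
  exact: incl_continuous.
by have /cts_onT := cM i j; exact.
Qed.

End RestrictionToSubset.

Section TopologicalIsomorphisms.
Context (R : realType) (K : scalar_kind) (B : topologicalType).
Implicit Types E : vfamily R K B.

Lemma top_morphism_comp E1 E2 E3 (f : forall b, vf_fib E1 b -> vf_fib E2 b)
    (g : forall b, vf_fib E2 b -> vf_fib E3 b) :
  top_morphism f -> top_morphism g -> top_morphism (fun b v => g b (f b v)).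
Proof.
move=> [lf cf] [lg cg]; split=> [b a u v|e]; first by rewrite lf lg.
have -> : (fun e : vf_total E1 => vf_point (g _ (f _ (vf_vec e)))) =
    (fun e : vf_total E2 => vf_point (g _ (vf_vec e))) \o
    (fun e : vf_total E1 => vf_point (f _ (vf_vec e))).
  apply/funext => z /=.
  pose G (x : {b & vf_fib E2 b}) := vf_point (g (tag x) (tagged x)).
  by rewrite -/(G (vf_dec (vf_point (f _ (vf_vec z))))) /vf_point vf_encK.
by apply: continuous_comp; [exact: cf|exact: cg].
Qed.

Lemma top_isomorphic_span E E1 E2 :
  top_isomorphic E E1 -> top_isomorphic E E2 -> top_isomorphic E1 E2.
Proof.
move=> [f1 [g1 [tf1 tg1 fK1 gK1]]] [f2 [g2 [tf2 tg2 fK2 gK2]]].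
exists (fun b v => f2 b (g1 b v)), (fun b v => f1 b (g2 b v)); split.
- exact: top_morphism_comp tg1 tf2.
- exact: top_morphism_comp tg2 tf1.
- by move=> b v; rewrite fK2 gK1.
- by move=> b v; rewrite fK1 gK2.
Qed.

End TopologicalIsomorphisms.

Section AlgebraicExtensions.
Context (R : realType) (K : scalar_kind) (V : funspace R) (A : set (V -> R)).
Hypothesis hA : coordinate_algebra A.
Local Notation F := (scalars R K).
Local Notation d := (real_dim K).
Local Notation rvc := (@real_vec_coord R K _).
Local Notation eqvar n q := (equivariant (@scalar_mx R K n) (@scalar_mx R K q)).

Lemma alg_subbundleS n (W W' : set V) (xi : V -> submodClosed 'rV[F]_n) :
  W' `<=` W -> alg_subbundle W xi -> alg_subbundle W' xi.
Proof.
move=> WW a x W'x; have [U [k [s [oU Ux rs fs]]]] := a x (WW _ W'x).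
exists U, k, s; split=> // [i j l|y W'y Uy]; last exact/fs/Uy/WW.
apply/(regular_onP hA); apply: (locally_quotientS (W := W `&` U)).
  by move=> y [W'y Uy]; split=> //; exact: WW.
exact/(regular_onP hA).
Qed.

(* The data of an extension of [xi] from [C]: a Zariski open set [U], a bundle
   [xi'] on [zclosure C `&` U] and its orthogonal projection [P]. *)
Definition extension_data n (C : set V) (xi : V -> submodClosed 'rV[F]_n)
    (U : set V) (xi' : V -> submodClosed 'rV[F]_n) (P : V -> 'M[R]_(n * d)) :=
  [/\ fs_zopen U, C `<=` U, alg_subbundle (zclosure C `&` U) xi',
    mxfun (locally_quotient A (zclosure C `&` U)) P &
    (forall x, (zclosure C `&` U) x -> is_proj (P x) (xi' x)) /\
    forall x, C x -> xi' x =i xi x].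

Lemma alg_bundle_extension n (C : set V) (xi : V -> submodClosed 'rV[F]_n) :
  alg_bundle C xi -> exists U xi' P, extension_data C xi U xi' P.
Proof.
move=> [_ [Z0 [xi' [[CZ [U oU Z0E]] aZ xiE]]]]; subst Z0.
have [P [rP PW]] := alg_subbundle_proj hA aZ.
by exists U, xi', P; split=> // x /CZ[].
Qed.

Lemma extended_morphism n q (C : set V) (xi : V -> submodClosed 'rV[F]_n)
    (eta : V -> submodClosed 'rV[F]_q) (phi : Defs.sub_map C xi eta)
    U1 xi' P U2 eta' Q (U : set V) (N : V -> 'M[R]_(n * d, q * d)) :
  extension_data C xi U1 xi' P -> extension_data C eta U2 eta' Q ->
  fs_zopen U -> C `<=` U -> U `<=` U1 `&` U2 ->
  mxfun (locally_quotient A (zclosure C `&` U)) N ->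
  (forall x, (zclosure C `&` U) x -> eqvar n q (N x) /\ N x *m Q x = N x) ->
  top_morphism phi ->
  (forall b v, rvc (fibre_val (phi b v)) = rvc (fibre_val v) *m N (set_val b)) ->
  alg_morphism phi.
Proof.
move=> [oU1 CU1 a1 rP [PW xiE]] [oU2 CU2 a2 rQ [QW etaE]] oU CU U12 rN NQ tphi phiE.
have Z1 : zclosure C `&` U `<=` zclosure C `&` U1.
  by move=> x [Zx /U12[U1x _]].
have Z2 : zclosure C `&` U `<=` zclosure C `&` U2.
  by move=> x [Zx /U12[_ U2x]].
have zn : znbhd_in_closure C (zclosure C `&` U).
  split; last by exists U.
  by move=> x Cx; split; [exact: sub_zclosure|exact: CU].
split=> //; exists (zclosure C `&` U), xi', eta', (fun x v => coordmap (N x) v).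
split.
- by split=> //; exact: alg_subbundleS a1.
- by split=> //; exact: alg_subbundleS a2.
- apply: (matrix_alg_morphism hA) => //.
    by move=> x /NQ[].
  move=> x v Zx vx; have [_ NQx] := NQ x Zx.
  by have [_ ->] := QW x (Z2 x Zx); rewrite coordmapE -mulmxA NQx.
- by move=> b v; apply: (@rvc_inj R K q); rewrite coordmapE phiE.
Qed.

(** The denominators have no zeros on [X], so the same fractions are regular on the Zariski open set
    where all denominators are nonzero. *)
Lemma quotients_lift (X : set V) m n (M : set_type X -> 'M[R]_(m, n)) :
  mxfun (quotients (restricted_algebra A (X := X)) setT) M ->
  exists (M' : V -> 'M[R]_(m, n)) (U : set V), [/\ fs_zopen U, X `<=` U,
    forall W, W `<=` U -> mxfun (locally_quotient A W) M' &
    forall b, M' (set_val b) = M b].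
Proof.
move=> qM.
have H i j : exists nq : (V -> R) * (V -> R), [/\ A nq.1, A nq.2,
    forall x, X x -> nq.2 x != 0 &
    forall b : set_type X, M b i j = nq.1 (set_val b) / nq.2 (set_val b)].
  have [_ [_ [[nn An ->] [qq Aq ->] ME]]] := qM i j.
  exists (nn, qq); split=> // [x Xx|b]; last by have [_ ->] := ME b Logic.I.
  by have [] := ME (exist _ x (mem_set Xx)) Logic.I.
pose nq i j := projT1 (cid (H i j)).
have nqP i j : [/\ A (nq i j).1, A (nq i j).2,
    forall x, X x -> (nq i j).2 x != 0 &
    forall b : set_type X, M b i j = (nq i j).1 (set_val b) / (nq i j).2 (set_val b)].
  by rewrite /nq; case: cid.
pose U : set V := [set x | forall ij : 'I_m * 'I_n, (nq ij.1 ij.2).2 x != 0].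
exists (fun x => \matrix_(i, j) ((nq i j).1 x / (nq i j).2 x)), U; split.
- have -> : U = [set x | \prod_ij (nq ij.1 ij.2).2 x != 0].
    apply/seteqP; split=> x /=.
      by move=> Ux; apply/prodf_neq0 => ij _; exact: Ux.
    by move/prodf_neq0 => H' ij; exact: H'.
  apply/(zopen_basis hA)/(alg_prod hA) => ij _.
  by have [] := nqP ij.1 ij.2.
- by move=> x Xx ij; have [_ _ + _] := nqP ij.1 ij.2; exact.
- move=> W WU i j x Wx; have [An Aq _ _] := nqP i j.
  exists (nq i j).1, (nq i j).2; split=> //; first exact: (WU x Wx (i, j)).
  by move=> y _ _; rewrite mxE.
- by move=> b; apply/matrixP => i j; rewrite mxE; have [_ _ _ ->] := nqP i j.
Qed.

End AlgebraicExtensions.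

(** * Uniqueness *)

Section Uniqueness.
Context (R : realType) (K : scalar_kind) (V : funspace R) (A : set (V -> R)).
Hypothesis hA : coordinate_algebra A.
Local Notation F := (scalars R K).
Local Notation d := (real_dim K).
Local Notation rvc := (@real_vec_coord R K _).
Local Notation eqvar n q := (equivariant (@scalar_mx R K n) (@scalar_mx R K q)).
Context (X : set V).
Hypothesis cX : compact X.
Local Notation T := (set_type X).
Local Notation AT := (restricted_algebra A (X := X)).

Lemma subbundle_projection n (xi : V -> submodClosed 'rV[F]_n) :
  top_subbundle X xi -> exists P : T -> 'M[R]_(n * d),
  mxfun (cts_on setT) P /\ forall b, is_proj (P b) (xi (set_val b)).
Proof.
move=> lxi.
by have [P [cP PW]] := image_projection lxi (@sub_vec_embedding R K V X n xi)
  (W := fun b => xi (set_val b)) (fun b v => @sub_vec_image R K V X n xi b v); exists P.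
Qed.

Lemma equivariant_approx n q (M : T -> 'M[R]_(n * d, q * d)) e : 0 < e ->
  mxfun (cts_on setT) M -> (forall b, eqvar n q (M b)) ->
  exists Phi : T -> 'M[R]_(n * d, q * d), [/\ mxfun (quotients AT setT) Phi,
    forall b, eqvar n q (Phi b) & forall b, entry_norm (Phi b - M b) <= e].
Proof.
move=> e0 cM eM; have hAT := @restricted_algebra_separating R V A X hA.
have cT := compact_set_type cX.
have [C C0 HC] := mx_approx hAT cT (@equivariantizeP R K n q) (@equivariantize_id R K n q).
have eC : 0 < e / C by rewrite divr_gt0.
have [||Phi [qPhi ePhi HPhi]] := HC setT M (e / C) cT eC.
- by move=> x _; exact: eM.
- by move=> a _; exact: mxfun_near.
exists Phi; split=> // b; have := HPhi b Logic.I.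
by rewrite mulrCA divff ?mulr1 // gt_eqF.
Qed.

Section Morphisms.
Context (n q : nat) (xi : V -> submodClosed 'rV[F]_n) (eta : V -> submodClosed 'rV[F]_q).
Context (P : T -> 'M[R]_(n * d)) (Q : T -> 'M[R]_(q * d)).
Hypotheses (HP : forall b, is_proj (P b) (xi (set_val b)))
  (HQ : forall b, is_proj (Q b) (eta (set_val b))).

Lemma coordmap_fib (N : T -> 'M[R]_(n * d, q * d)) b (v : 'rV[F]_n) :
  N b *m Q b = N b -> coordmap (N b) v \in eta (set_val b).
Proof. by move=> NQ; have [_ ->] := HQ b; rewrite coordmapE -mulmxA NQ. Qed.

Definition matrix_map (N : T -> 'M[R]_(n * d, q * d))
    (NQ : forall b, N b *m Q b = N b) : Defs.sub_map X xi eta :=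
  fun b v => Fibre (coordmap_fib (fibre_val v) (NQ b)).

End Morphisms.

Lemma restrict_matrix_map n q (C : set V) (CX : C `<=` X)
    (xi : V -> submodClosed 'rV[F]_n) (eta : V -> submodClosed 'rV[F]_q)
    (phi : Defs.sub_map X xi eta) (N : T -> 'M[R]_(n * d, q * d)) :
  mxfun (cts_on setT) N -> (forall b, eqvar n q (N b)) ->
  (forall b v, rvc (fibre_val (phi b v)) = rvc (fibre_val v) *m N b) ->
  top_morphism (Defs.restrict_map CX phi).
Proof.
move=> cN eN phiE; apply: (matrix_morphism (A := fun b => N (Defs.incl CX b))).
- exact: incl_mxfun.
- by move=> b; exact: eN.
- by move=> b v; exact: phiE.
Qed.

Lemma pw_bundle_isomorphic SS n q (xi : V -> submodClosed 'rV[F]_n)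
    (eta : V -> submodClosed 'rV[F]_q) :
  pw_bundle SS X xi -> pw_bundle SS X eta ->
  top_isomorphic (subfamily xi X) (subfamily eta X) -> pw_isomorphic SS X xi eta.
Proof.
move=> [lxi axi] [leta aeta] [phi0 [psi0 [tphi tpsi phiK psiK]]].
have cT := compact_set_type cX.
have FT := @cts_on_funring R T setT.
have [P [cP HP]] := subbundle_projection lxi.
have [Q [cQ HQ]] := subbundle_projection leta.
have oP b : orthproj (P b) by case: (HP b).
have oQ b : orthproj (Q b) by case: (HQ b).
have eP b : eqvar n n (P b) by exact: is_proj_equivariant (HP b).
have eQ b : eqvar q q (Q b) by exact: is_proj_equivariant (HQ b).
(* Used in both directions: the two injections give equality of ranks, and the matrix of [phi0]
   alone is then approximated. *)
have iso_inj m1 m2 (z1 : V -> submodClosed 'rV[F]_m1) (z2 : V -> submodClosed 'rV[F]_m2)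
    (P1 : T -> 'M[R]_(m1 * d)) (P2 : T -> 'M[R]_(m2 * d)) (f : Defs.sub_map X z1 z2)
    (g : Defs.sub_map X z2 z1) :
    mxfun (cts_on setT) P1 -> (forall b, is_proj (P1 b) (z1 (set_val b))) ->
    (forall b, is_proj (P2 b) (z2 (set_val b))) -> top_morphism f ->
    (forall b, cancel (f b) (g b)) ->
    exists M : T -> 'M[R]_(m1 * d, m2 * d), [/\ mxfun (cts_on setT) M,
      forall b, eqvar m1 m2 (M b), forall b, P1 b *m M b = M b,
      forall b, M b *m P2 b = M b & forall b, injective_on (P1 b) (M b)].
  move=> cP1 HP1 HP2 tf fK.
  have [M [cM eM PM ME]] := morphism_matrix cP1 HP1 tf.
  have fix1 b (v : 'rV[F]_m1) : rvc v *m P1 b = rvc v -> exists w : vf_fib (subfamily z1 X) b,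
      fibre_val w = v.
    by move=> /(proj2 (HP1 b) v) vz; exists (Fibre vz).
  exists M; split=> // b.
    apply: real_vec_mx_eq => v; rewrite -(PM b) !mulmxA -coordmapE.
    have [|w <-] := fix1 b (coordmap (P1 b) v).
      by rewrite coordmapE -mulmxA; have [[_ ->] _] := HP1 b.
    by rewrite -ME; have [_ <-] := HP2 b; case: (f b w).
  move=> v; rewrite -(coord_vecK v) => /fix1[w <-]; rewrite -ME => fw0.
  have [lf _] := tf.
  have : f b w = f b 0.
    rewrite (linear_fun0 (lf b)); apply: val_inj; apply: (@rvc_inj R K m2).
    by rewrite fw0 real_vec_coord0.
  by move/(can_inj (fK b)) => ->; rewrite real_vec_coord0.
have [M [cM eM PM MQ iM]] := iso_inj _ _ _ _ _ _ _ _ cP HP HQ tphi phiK.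
have [M' [_ _ _ M'P iM']] := iso_inj _ _ _ _ _ _ _ _ cQ HQ HP tpsi psiK.
have rPQ b : \rank (P b) = \rank (Q b).
  apply/eqP; rewrite eqn_leq; have [_ PP] := oP b; have [_ QQ] := oQ b.
  rewrite (injective_on_rank_le PP (iM b) (MQ b)).
  exact: injective_on_rank_le QQ (iM' b) (M'P b).
have [|C C0 HC] := mxfun_margin cT cP cM; first by move=> b _; split.
pose g : R := ((n * d)%:R * (n * d)%:R) * ((q * d)%:R * (q * d)%:R) + 1.
have g0 : 0 < g by rewrite ltr_wpDl // !mulr_ge0.
(* [g] bounds the product of the norms of the two projections, so this accuracy puts [N] within 1 /
   (2 C) of [M] and keeps it injective. *)
have e0 : 0 < 1 / (2 * C * g) by rewrite divr_gt0 // !mulr_gt0.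
have [Phi [qPhi ePhi HPhi]] := equivariant_approx e0 cM eM.
have hAT := @restricted_algebra_separating R V A X hA.
have cPhi : mxfun (cts_on setT) Phi.
  by move=> i j; apply/cts_onT; exact: (quotients_continuous hAT (qPhi i j)).
pose N b := P b *m Phi b *m Q b.
have cN : mxfun (cts_on setT) N by apply: (mxfunM FT) => //; apply: (mxfunM FT).
have eN b : eqvar n q (N b).
  by apply: equivariantM (eQ b); apply: equivariantM (eP b) (ePhi b).
have NQ b : N b *m Q b = N b by have [_ QQ] := oQ b; rewrite /N -mulmxA QQ.
have PN b : P b *m N b = N b by have [_ PP] := oP b; rewrite /N !mulmxA PP.
have iN b : injective_on (P b) (N b).
  apply: (margin_injective (injective_on_perturb (HC b Logic.I) (ltW C0) _)).
  have -> : N b - M b = P b *m (Phi b - M b) *m Q b.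
    by rewrite mulmxBr mulmxBl PM MQ.
  have h1 := orthproj_entry_norm (oP b); have h2 := orthproj_entry_norm (oQ b).
  have h : entry_norm (P b *m (Phi b - M b) *m Q b) <= g * (1 / (2 * C * g)).
    rewrite (le_trans (entry_normM _ _)) //.
    rewrite (le_trans (ler_wpM2r (entry_norm_ge0 _) (entry_normM _ _))) //.
    rewrite mulrAC (le_trans (ler_pM _ _ (ler_pM _ _ h1 h2) (HPhi b))) //.
    - by rewrite mulr_ge0 // entry_norm_ge0.
    - exact: entry_norm_ge0.
    - exact: entry_norm_ge0.
    - exact: entry_norm_ge0.
    - by apply: ler_wpM2r; [exact: ltW|rewrite /g lerDl].
  have c0 : 0 <= 2 * C by rewrite mulr_ge0 // ltW.
  apply: (le_trans (ler_wpM2l c0 h)).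
  rewrite mulrA div1r divff // mulf_neq0 ?gt_eqF //.
  by rewrite mulr_gt0.
have uG b : gram (P b) (N b) \in unitmx by exact: gram_unit.
pose N' b := pinv (P b) (N b).
have cN' : mxfun (cts_on setT) N' by apply: (mxfun_pinv FT).
have eN' b : eqvar q n (N' b).
  apply: (equivariant_pinv (@scalar_conjK R K)) => //; exact: scalar_mx_action.
have N'P b : N' b *m P b = N' b by exact: pinvP.
have NN' b : N b *m N' b = P b by exact: mulmx_pinv.
(* [N' *m N] is the row projection of [N]: its image lies in that of [Q] and has the same rank. *)
have N'N b : N' b *m N b = Q b.
  apply: orthproj_eq => //; first exact: rowproj_orth.
    by rewrite -mulmxA NQ.
  by rewrite [LHS](rank_rowproj (oP b) (PN b) (iN b)).
pose phi := matrix_map HQ NQ : Defs.sub_map X xi eta.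
pose psi := matrix_map HP N'P : Defs.sub_map X eta xi.
have phiE b v : rvc (fibre_val (phi b v)) = rvc (fibre_val v) *m N b.
  exact: coordmapE.
have psiE b v : rvc (fibre_val (psi b v)) = rvc (fibre_val v) *m N' b.
  exact: coordmapE.
have tphi1 : top_morphism phi by exact: matrix_morphism cN eN phiE.
have tpsi1 : top_morphism psi by exact: matrix_morphism cN' eN' psiE.
have [PhiV [U3 [oU3 XU3 rPhiV PhiVE]]] := quotients_lift hA qPhi.
(* One lifted matrix [PhiV] serves all components; only [P'] and [Q'] depend on [C1]. Off [X] the
   lift need not commute with scalars, so it is made equivariant again, which changes nothing on
   [X]. *)
have ext S C1 : SS S -> component_of (X `&` S) C1 -> C1 `<=` X ->
    exists U1 xi' P' U2 eta' Q' (U : set V) (NV : V -> 'M[R]_(n * d, q * d)),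
    [/\ extension_data A C1 xi U1 xi' P', extension_data A C1 eta U2 eta' Q',
      [/\ fs_zopen U, C1 `<=` U, U `<=` U1 `&` U2 &
        mxfun (locally_quotient A (zclosure C1 `&` U)) NV],
      forall x, (zclosure C1 `&` U) x -> [/\ orthproj (P' x), eqvar n n (P' x),
        eqvar n q (NV x), P' x *m NV x = NV x & NV x *m Q' x = NV x] &
      forall b : T, C1 (set_val b) -> NV (set_val b) = N b /\ P' (set_val b) = P b].
  move=> SSS C1X C1sub.
  have [U1 [xi' [P' e1]]] := alg_bundle_extension hA (axi S C1 SSS C1X).
  have [U2 [eta' [Q' e2]]] := alg_bundle_extension hA (aeta S C1 SSS C1X).
  have [oU1 CU1 _ rP' [P'W xiE]] := e1; have [oU2 CU2 _ rQ' [Q'W etaE]] := e2.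
  pose U := U1 `&` U2 `&` U3.
  have oU : fs_zopen U by apply: (zopenI hA) => //; exact: (zopenI hA).
  have CU : C1 `<=` U by move=> x Cx; split; [split; [exact: CU1|exact: CU2]|exact/XU3/C1sub].
  have Z1 : zclosure C1 `&` U `<=` zclosure C1 `&` U1 by move=> x [? [[? ?] ?]].
  have Z2 : zclosure C1 `&` U `<=` zclosure C1 `&` U2 by move=> x [? [[? ?] ?]].
  have SR := locally_quotient_funring hA (zclosure C1 `&` U).
  exists U1, xi', P', U2, eta', Q', U,
    (fun x => P' x *m equivariantize (PhiV x) *m Q' x); split=> //.
  - split=> //; first by move=> x [].
    apply: (mxfunM SR).
      apply: (mxfunM SR).
        by move=> i j; apply: (locally_quotientS Z1); exact: rP'.
      by apply: (mxfun_eqv _ SR); apply: rPhiV => x [_ [_ ?]].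
    by move=> i j; apply: (locally_quotientS Z2); exact: rQ'.
  - move=> x Zx; have pP := P'W x (Z1 x Zx); have pQ := Q'W x (Z2 x Zx).
    have [[PT PP] _] := pP; have [[_ QQ] _] := pQ.
    have eP' := is_proj_equivariant pP.
    split=> //.
    + apply: equivariantM (is_proj_equivariant pQ); apply: equivariantM eP' _.
      exact: equivariantizeP.
    + by rewrite !mulmxA PP.
    + by rewrite -mulmxA QQ.
  - move=> b Cb; have Zb : (zclosure C1 `&` U) (set_val b).
      by split; [exact: sub_zclosure|exact: CU].
    have PE : P' (set_val b) = P b.
      exact: is_proj_uniq (xiE _ Cb) (P'W _ (Z1 _ Zb)) (HP b).
    have QE : Q' (set_val b) = Q b.
      exact: is_proj_uniq (etaE _ Cb) (Q'W _ (Z2 _ Zb)) (HQ b).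
    by rewrite PhiVE PE QE equivariantize_id.
exists phi, psi; split.
- split=> // S C1 CX SSS C1X.
  have [U1 [xi' [P' [U2 [eta' [Q' [U [NV [e1 e2 [oU CU U12 rNV] NVp NVE]]]]]]]]] :=
    ext S C1 SSS C1X CX.
  apply: (extended_morphism hA e1 e2 oU CU U12 rNV).
  + by move=> x /NVp[].
  + exact: restrict_matrix_map cN eN phiE.
  + move=> b v; rewrite -[set_val b]/(set_val (Defs.incl CX b)).
    have [|-> _] := NVE (Defs.incl CX b); first exact: (set_mem (valP b)).
    exact: phiE.
- split=> // S C1 CX SSS C1X.
  have [U1 [xi' [P' [U2 [eta' [Q' [U [NV [e1 e2 [oU CU U12 rNV] NVp NVE]]]]]]]]] :=
    ext S C1 SSS C1X CX.
  have SR := locally_quotient_funring hA (zclosure C1 `&` U).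
  have [_ _ _ rP' _] := e1.
  have rP'U : mxfun (locally_quotient A (zclosure C1 `&` U)) P'.
    move=> i j; apply: (locally_quotientS (W := zclosure C1 `&` U1)); last exact: rP'.
    by move=> x [? /U12[]].
  have rG := mxfun_gram SR rP'U rNV.
  (* Regularity of the pseudo-inverse needs a nonzero Gram determinant, a Zariski open condition
     that holds on the component. *)
  have [U4 oU4 U4E] := nonvanishing_zopen hA (fr_det SR rG).
  have CU4 : C1 `<=` U4.
    move=> x Cx; have Zx : (zclosure C1 `&` U) x by split; [exact: sub_zclosure|exact: CU].
    apply/(U4E x Zx); rewrite -unitfE -unitmxE.
    have [|-> ->] := NVE (exist _ x (mem_set (CX x Cx))); first exact: Cx.
    exact: uG.
  have ZU : zclosure C1 `&` (U `&` U4) `<=` zclosure C1 `&` U by move=> x [? []].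
  have SR4 := locally_quotient_funring hA (zclosure C1 `&` (U `&` U4)).
  apply: (extended_morphism hA e2 e1 (zopenI hA oU oU4) _ _
    (N := fun x => pinv (P' x) (NV x))).
  + by move=> x Cx; split; [exact: CU|exact: CU4].
  + by move=> x [/U12[? ?] _].
  + apply: (mxfun_pinv SR4).
    * by move=> i j; apply: (locally_quotientS ZU); exact: rP'U.
    * by move=> i j; apply: (locally_quotientS ZU); exact: rNV.
    * move=> x Zx; rewrite unitmxE unitfE; apply/(U4E x (ZU x Zx)).
      by case: Zx => _ [].
  + move=> x Zx; have [oP' eP' eNV PNV _] := NVp x (ZU x Zx).
    have uGx : gram (P' x) (NV x) \in unitmx.
      rewrite unitmxE unitfE; apply/(U4E x (ZU x Zx)).
      by case: Zx => _ [].
    split.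
      apply: (equivariant_pinv (@scalar_conjK R K)) => //; exact: scalar_mx_action.
    by apply: pinvP => //; exact: gram_unit_injective.
  + exact: restrict_matrix_map cN' eN' psiE.
  + move=> b v; rewrite -[set_val b]/(set_val (Defs.incl CX b)).
    have [|-> ->] := NVE (Defs.incl CX b); first exact: (set_mem (valP b)).
    exact: psiE.
- move=> b v; apply: val_inj; apply: (@rvc_inj R K n).
  rewrite -[LHS]/(rvc (fibre_val (psi b (phi b v)))) psiE phiE.
  by rewrite -mulmxA NN'; have [_ <-] := HP b; case: v.
- move=> b v; apply: val_inj; apply: (@rvc_inj R K q).
  rewrite -[LHS]/(rvc (fibre_val (phi b (psi b v)))) phiE psiE.
  by rewrite -mulmxA N'N; have [_ <-] := HQ b; case: v.
Qed.

End Uniqueness.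

(** * Existence *)

Section LinearImage.
Context (S : nzRingType) (U V : lmodType S) (f : U -> V) (lf : linear f).

(** The linearity proof is an argument so that the submodule structure, which depends on it, can be
    attached to the predicate. *)
Definition linear_image (_ : linear f) : pred V := fun v => `[< exists u, f u = v >].

Fact linear_image_closed : submod_closed (linear_image lf).
Proof.
split; first by apply/asboolP; exists 0; exact: linear_fun0.
by move=> a _ _ /asboolP[u <-] /asboolP[w <-]; apply/asboolP; exists (a *: u + w); rewrite lf.
Qed.

HB.instance Definition _ :=
  GRing.isSubmodClosed.Build S V (linear_image lf) linear_image_closed.

Definition image_space : submodClosed V :=
  GRing.SubmodClosed.clone S V (linear_image lf) _.

End LinearImage.

Section Connected.
Context (R : realType) (T : topologicalType) (C : set T) (f : T -> R).
Hypotheses (cC : connected C) (cf : cts_on C f).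

Lemma connected_ivt x y (r : R) : C x -> C y -> f x <= r <= f y ->
  exists2 z, C z & f z = r.
Proof.
move=> Cx Cy rxy.
have /connected_intervalP itv : connected (f @` C).
  by apply: connected_continuous_connected => //; exact/subspace_continuousP.
have Ex : (f @` C) (f x) by exists x.
have Ey : (f @` C) (f y) by exists y.
by have [z Cz zr] := itv _ _ Ex Ey r rxy; exists z.
Qed.

Lemma connected_nat_cst : (forall x, C x -> exists k : nat, f x = k%:R) ->
  forall x y, C x -> C y -> f x = f y.
Proof.
move=> fn.
suff H x y : C x -> C y -> ~ f x < f y.
  move=> x y Cx Cy; apply/eqP; rewrite eq_le !leNgt.
  by apply/andP; split; apply/negP; exact: H.
move=> Cx Cy; have [k fx] := fn x Cx; have [l fy] := fn y Cy.
rewrite fx fy ltr_nat => kl.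
(* Between two different natural values a half-integer would be attained. *)
have [|z Cz fz] := connected_ivt (r := k%:R + 1 / 2) Cx Cy.
  have : k%:R + 1 <= l%:R :> R by rewrite natr1 ler_nat.
  by rewrite fx fy => ?; apply/andP; split; lra.
have [m fm] := fn z Cz; move: fz; rewrite fm => mk.
case: (leqP m k) => h.
  by have : m%:R <= k%:R :> R by [rewrite ler_nat]; rewrite mk; lra.
by have : k%:R + 1 <= m%:R :> R by [rewrite natr1 ler_nat]; rewrite mk; lra.
Qed.

Lemma connected_sign : (forall x, C x -> f x != 0) ->
  forall x y, C x -> C y -> f x < 0 -> f y < 0.
Proof.
move=> f0 x y Cx Cy fx; rewrite ltNge; apply/negP => fy.
have [|z Cz fz] := connected_ivt (r := 0) Cx Cy; first by rewrite ltW.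
by have := f0 z Cz; rewrite fz eqxx.
Qed.

End Connected.

(** * Sublevel sets over which every bundle is trivial *)

Section ContractibleCover.
Context (R : realType) (V : funspace R) (A : set (V -> R)) (X : set V).
Hypotheses (hA : coordinate_algebra A) (cX : compact X).
Local Notation T := (set_type X).
Local Notation I01 := (`[0, 1]%classic : set R).

(* [f <= 0] contracts to a point inside [X]. *)
Definition contracted_sublevel (f : V -> R) := A f /\
  exists (W : set V) (H : V * R -> V) c,
  [/\ {within (W `&` X) `*` I01, continuous H},
    forall y, X y -> f y <= 0 -> W y &
    forall y, W y -> X y -> [/\ H (y, 0) = y, H (y, 1) = c &
      forall t, I01 t -> X (H (y, t))]].

Lemma contractible_cover : locally_contractible R X ->
  exists s : seq (V -> R),
  (forall i, (i < size s)%N -> contracted_sublevel (nth (fun=> 0) s i)) /\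
  forall x, X x -> exists2 i, (i < size s)%N & nth (fun=> 0) s i x < 0.
Proof.
move=> lX; have cT := compact_set_type cX.
have [|s [Hs sT]] := @compact_seq_cover T _ (fun=> 0) setT contracted_sublevel
    (fun f => [set b | f (set_val b) < 0]) cT.
  move=> a _; have Xa : X (set_val a) by exact: (set_mem (valP a)).
  have [W [H [c [aW _ cH HW]]]] := lX (set_val a) setT Xa filterT.
  have [rho [Arho rho0 rhoa rhop]] := ca_sep hA (set_val a).
  have crhoT := alg_set_val_continuous (X := X) hA Arho.
  have WT : nbhs a ((set_val : T -> V) @^-1` W) by exact: set_val_continuous.
  have [r r0 Hr] := sublevel_nbhs cT WT crhoT rhoa
    (fun b ba => rhop _ (fun h => ba (val_inj h))).
  (* The open sets [rho < r] give the cover, while the closed sublevel set stays inside [W], where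
     the contraction is defined. *)
  exists (fun y => rho y - r); last first.
    have := crhoT a; move=> /cvgrPdist_lt/(_ r r0); apply: filterS => b /=.
    by rewrite rhoa sub0r normrN ger0_norm // subr_lt0.
  split; first by apply: (alg_add hA) => //; exact: (alg_cst hA).
  exists W, H, c; split=> // y.
    by move=> Xy; rewrite subr_le0 => /(Hr (exist _ y (mem_set Xy))).
  by move=> Wy Xy; have [h0 h1 ht] := HW y Wy Xy; split=> // t /ht[].
exists s; split=> // x Xx; exact: (sT (exist _ x (mem_set Xx)) Logic.I).
Qed.

(* The homotopy pulls the projection back to a path of projections ending at a
   constant one. *)
Lemma contracted_proj_iso (sc : Type) m (J : sc -> 'M[R]_m) (f : V -> R)
    (P : T -> 'M[R]_m) :
  contracted_sublevel f -> mxfun (cts_on setT) P ->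
  (forall b, orthproj (P b) /\ equivariant J J (P b)) ->
  exists P0, [/\ orthproj P0, equivariant J J P0 &
    proj_iso J [set b : T | f (set_val b) <= 0] P (fun=> P0)].
Proof.
move=> [Af [W [H [c [cH fW HW]]]]] cP oP.
(* The default 0 is itself an equivariant projection, so [PV] has these properties at every point of
   [V]. *)
pose PV := extend_by (0 : 'M[R]_m) P.
have PVE (b : T) : PV (set_val b) = P b by exact: extend_byE.
have oPV x : orthproj (PV x) /\ equivariant J J (PV x).
  rewrite /PV /extend_by; case: pselect => // _; split; last exact: equivariant0.
  by split; rewrite ?trmx0 ?mulmx0.
pose B := [set b : T | f (set_val b) <= 0].
have cval := @set_val_continuous R V X.
have cB : compact B.
  apply: (@subclosed_compact _ _ setT) => //; last exact: compact_set_type.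
  apply: (@preimage_closed _ _ (fun b : T => f (set_val b)) [set r : R | r <= 0]).
    by move=> b _; exact: (alg_set_val_continuous hA Af).
  exact: closed_le.
have BX (b : T) : B b -> X (set_val b) /\ W (set_val b).
  by move=> Bb; have Xb := set_mem (valP b); split=> //; exact: fW.
pose G (z : T * R) := PV (H (set_val z.1, z.2)).
have cG : mxfun (cts_on (B `*` I01)) G.
  move=> i j; apply: near_cts_on => -[b t] [/= Bb t01] e e0.
  have [Xb Wb] := BX b Bb; have [_ _ /(_ t t01) XH] := HW _ Wb Xb.
  pose y : T := exist (fun x : V => x \in X) (H (set_val b, t)) (mem_set XH).
  have [_ [[W0 oW0 <-] /= W0y] W0P] := cts_on_near (cP i j) (Logic.I : setT y) e0.
  have cHbt : H @ within ((W `&` X) `*` I01) (nbhs (set_val b, t)) --> H (set_val b, t).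
    by move/subspace_continuousP: cH; apply.
  have nW0 : nbhs (H (set_val b, t)) W0 by exact: open_nbhs_nbhs.
  have : within ((W `&` X) `*` I01) (nbhs (set_val b, t)) (H @^-1` W0) by exact: cHbt.
  rewrite /within /= => -[[M1 M2] [/= bM1 tM2] M12].
  have bM1' : \forall z \near b, M1 (set_val z) by exact: cval.
  exists ((set_val : T -> V) @^-1` M1, M2); first by split.
  move=> [z u] /= [M1z M2u] [Bz u01].
  have [Xz Wz] := BX z Bz; have [_ _ /(_ u u01) XHz] := HW _ Wz Xz.
  have W0z : W0 (H (set_val z, u)) by exact: (M12 (set_val z, u)).
  have := W0P (exist (fun x : V => x \in X) _ (mem_set XHz)) W0z Logic.I.
  by rewrite -!PVE.
have : proj_iso J B (fun b => G (b, 0)) (fun b => G (b, 1)).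
  by apply: proj_iso_homotopy => // b t _ _; exact: oPV.
move=> [al [cal Hal]]; exists (PV c); have [? ?] := oPV c; split=> //.
exists al; split=> // b Bb; have := Hal b Bb.
have [Xb Wb] := BX b Bb; have [h0 h1 _] := HW _ Wb Xb.
by rewrite /G /= h0 h1 PVE.
Qed.

End ContractibleCover.

Section CellBundles.
Context (R : realType) (K : scalar_kind) (V : funspace R) (A : set (V -> R)).
Hypothesis hA : coordinate_algebra A.
Local Notation F := (scalars R K).
Local Notation d := (real_dim K).
Local Notation eqvar n q := (equivariant (@scalar_mx R K n) (@scalar_mx R K q)).
Context (X : set V).
Local Notation T := (set_type X).

(** [P] extends to a matrix [Q] on the part [Z] of the Zariski closure of [C] where the denominators
    do not vanish. Being a projection, being equivariant and having a given trace are identities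
    between fractions, so they pass from [C] to [Z]. *)
Lemma cell_alg_bundle n (C : set V) (P : T -> 'M[R]_(n * d))
    (xi : V -> submodClosed 'rV[F]_n) :
  C `<=` X -> connected C -> C !=set0 ->
  mxfun (cts_on setT) P -> (forall b, is_proj (P b) (xi (set_val b))) ->
  (forall i j, exists nn q, [/\ A nn, A q & forall b : T, C (set_val b) ->
     q (set_val b) != 0 /\ P b i j = nn (set_val b) / q (set_val b)]) ->
  alg_bundle C xi.
Proof.
move=> CX cC [x0 Cx0] cP HP qP.
split.
  apply: (proj_locally_trivial (P := fun b : set_type C => P (Defs.incl CX b))).
    exact: incl_mxfun.
  by move=> b; exact: (HP (Defs.incl CX b)).
pose nn i j := projT1 (cid (qP i j)).
have ex2 i j : exists q, [/\ A (nn i j), A q & forall b : T, C (set_val b) ->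
     q (set_val b) != 0 /\ P b i j = nn i j (set_val b) / q (set_val b)].
  by rewrite /nn; case: cid.
pose qq i j := projT1 (cid (ex2 i j)).
have nqP i j : [/\ A (nn i j), A (qq i j) & forall b : T, C (set_val b) ->
     qq i j (set_val b) != 0 /\ P b i j = nn i j (set_val b) / qq i j (set_val b)].
  by rewrite /qq; case: cid.
pose Q x : 'M[R]_(n * d) := \matrix_(i, j) (nn i j x / qq i j x).
pose U : set V := [set x | \prod_i \prod_j qq i j x != 0].
have Uq x : U x -> forall i j, qq i j x != 0.
  by move=> /prodf_neq0 H i j; have /prodf_neq0 := H i isT; exact.
have oU : fs_zopen U.
  apply/(zopen_basis hA)/(alg_prod hA) => i _; apply: (alg_prod hA) => j _.
  by case: (nqP i j).
have toT x (Cx : C x) : exists2 b : T, set_val b = x & C (set_val b).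
  by exists (exist (fun x : V => x \in X) x (mem_set (CX x Cx))).
have CU : C `<=` U.
  move=> x /toT[b <- Cb]; apply/prodf_neq0 => i _; apply/prodf_neq0 => j _.
  by have [_ _ /(_ b Cb)[]] := nqP i j.
have QP (b : T) : C (set_val b) -> Q (set_val b) = P b.
  move=> Cb; apply/matrixP => i j; rewrite mxE.
  by have [_ _ /(_ b Cb)[]] := nqP i j.
pose Z := zclosure C `&` U.
have CZ : C `<=` Z by move=> x Cx; split; [exact: sub_zclosure|exact: CU].
have ZC : Z `<=` zclosure C by move=> x [].
have SG := quotients_funring hA Z.
have gQ : mxfun (quotients A Z) Q.
  move=> i j; have [An Aq _] := nqP i j; exists (nn i j), (qq i j); split=> // x [_ Ux].
  by rewrite mxE; split=> //; exact: Uq.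
have mx0 k l (M : V -> 'M[R]_(k, l)) : mxfun (quotients A Z) M ->
    (forall x, C x -> M x = 0) -> forall x, Z x -> M x = 0.
  move=> gM MC x Zx; apply/matrixP => i j; rewrite mxE.
  apply: (quotient_zero_closure hA CZ ZC (gM i j)) => // y Cy.
  by rewrite MC // mxE.
have oQ x : Z x -> orthproj (Q x).
  move=> Zx; split; apply/eqP; rewrite -subr_eq0; apply/eqP.
    apply: (mx0 _ _ (fun x => (Q x)^T - Q x)) => //.
      by apply: (mxfunB SG) => //; exact: (mxfun_tr SG).
    by move=> y /toT[b <- Cb]; rewrite QP //; have [[-> _] _] := HP b; rewrite subrr.
  apply: (mx0 _ _ (fun x => Q x *m Q x - Q x)) => //.
    by apply: (mxfunB SG) => //; exact: (mxfunM SG).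
  by move=> y /toT[b <- Cb]; rewrite QP //; have [[_ ->] _] := HP b; rewrite subrr.
have eQ x : Z x -> eqvar n n (Q x).
  move=> Zx a; apply/eqP; rewrite -subr_eq0; apply/eqP.
  apply: (mx0 _ _ (fun x => scalar_mx n a *m Q x - Q x *m scalar_mx n a)) => //.
    by apply: (mxfunB SG); apply: (mxfunM SG) => //; exact: (mxfun_cst SG).
  by move=> y /toT[b <- Cb]; rewrite QP // (is_proj_equivariant (HP b)) subrr.
(* The trace of a projection is its rank, a natural number, hence constant on the connected [C]. *)
have trC x : C x -> \tr (Q x) = \tr (Q x0).
  move=> Cx; apply: (connected_nat_cst cC (f := fun x => \tr (Q x))) => //.
    apply: (fr_sum (@cts_on_funring R V C)) => i.
    have [An Aq _] := nqP i i.
    apply: (fr_ext (@cts_on_funring R V C) (f := fun x => nn i i x * (qq i i x)^-1)).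
      apply: (fr_mul (@cts_on_funring R V C)).
        by apply: continuous_cts_on; exact: (alg_continuous hA An).
      apply: (fr_inv (@cts_on_funring R V C)).
        by apply: continuous_cts_on; exact: (alg_continuous hA Aq).
      by move=> y Cy; exact: (Uq y (CU y Cy) i i).
    by move=> y _; rewrite mxE.
  move=> y Cy; exists (\rank (Q y)); apply: idem_trace.
  by case: (oQ y (CZ y Cy)).
have rQ x y : Z x -> Z y -> \rank (Q x) = \rank (Q y).
  suff H z : Z z -> \tr (Q z) = \tr (Q x0).
    move=> Zx Zy; have [_ QQx] := oQ x Zx; have [_ QQy] := oQ y Zy.
    apply/eqP; rewrite -(eqr_nat R) -!idem_trace //.
    by rewrite (H x Zx) (H y Zy).
  move=> Zz; apply/eqP; rewrite -subr_eq0; apply/eqP.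
  apply: (@quotient_zero_closure R V A hA C Z (fun x => \tr (Q x) - \tr (Q x0))) => //.
    apply: (fr_add SG); last exact: (fr_cst SG).
    by apply: (fr_sum SG) => i; exact: gQ.
  by move=> w Cw; rewrite trC // subrr.
have rlQ : mxfun (locally_quotient A Z) Q.
  move=> i j x [_ Ux]; have [An Aq _] := nqP i j.
  exists (nn i j), (qq i j); split=> //; first exact: Uq.
  by move=> y _ _; rewrite mxE.
have pQ x : Z x -> is_proj (Q x) (fixed_space (Q x)).
  by move=> Zx; apply: fixed_space_proj; [exact: oQ|exact: eQ].
exists Z, (fun x => fixed_space (Q x)); split.
- by split=> //; exists U.
- exact: (proj_alg_subbundle hA rlQ pQ rQ).
- move=> x /[dup] Cx /toT[b bx Cb] v.
  have [_ pQx] := pQ x (CZ x Cx); have [_ pPb] := HP b.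
  apply/idP/idP.
    by move/pQx => h; rewrite -bx; apply/pPb; rewrite -QP // bx.
  by rewrite -bx => /pPb h; apply/(proj2 (pQ _ (CZ _ Cb))); rewrite QP.
Qed.

End CellBundles.

(** * Strata and sign patterns *)

Section Strata.
Context (R : realType) (V : funspace R) (A : set (V -> R)).
Hypothesis hA : coordinate_algebra A.
Context (N : nat) (f : 'I_N -> V -> R).
Hypothesis Af : forall i, A (f i).

Definition stratum (I : {set 'I_N}) : set V :=
  [set x | forall i, (f i x == 0) = (i \in I)].

Definition strata : set (set V) := [set stratum I | I in [set: {set 'I_N}]].

Lemma strata_stratification : stratification strata.
Proof.
split.
- by apply: finite_image; exact: finite_finset.
- move=> _ [I _ <-].
  exists [set x | \prod_(i | i \notin I) f i x != 0],
    [set x | forall p, [set f i | i in [set i | i \in I]] p -> p x = 0]; split.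
  + exact/(zopen_basis hA)/(alg_prod hA).
  + by apply: (zclosed_zeros hA) => _ [i _ <-].
  + apply/seteqP; split=> x /=.
      move=> Ix; split; first by apply/prodf_neq0 => i iI; rewrite Ix.
      by move=> _ [i /= iI <-]; apply/eqP; rewrite Ix.
    move=> [/prodf_neq0 nI fI] i; case: (boolP (i \in I)) => iI.
      by apply/eqP; apply: fI; exists i.
    exact/negbTE/nI.
- move=> _ _ [I _ <-] [I' _ <-] [x [Ix I'x]].
  by congr stratum; apply/setP => i; rewrite -Ix I'x.
- apply/seteqP; split=> // x _.
  pose I := finset (fun i => f i x == 0).
  by exists (stratum I); [exists I|move=> i; rewrite inE].
Qed.

Context (X : set V).

Definition sign_cell (x : set_type X) : {ffun 'I_N -> bool * bool} :=
  [ffun i => (f i (set_val x) < 0, f i (set_val x) == 0)].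

Lemma component_sign_cell S C : strata S -> component_of (X `&` S) C ->
  [/\ C `<=` X, connected C, C !=set0 & forall b b' : set_type X,
    C (set_val b) -> C (set_val b') -> sign_cell b = sign_cell b'].
Proof.
move=> [I _ <-] [x Xx ->].
have sub := @connected_component_sub _ (X `&` stratum I) x.
have cC := @component_connected _ (X `&` stratum I) x.
split=> //.
- by move=> y /sub[].
- by exists x; exact: connected_component_refl.
- move=> b b' Cb Cb'; apply/ffunP => i; rewrite !ffunE.
  have [_ Ib] := sub _ Cb; have [_ Ib'] := sub _ Cb'.
  congr pair; last by rewrite Ib Ib'.
  have cf : cts_on (connected_component (X `&` stratum I) x) (f i).
    by apply: continuous_cts_on; exact: (alg_continuous hA).
  have [iI|iI] := boolP (i \in I).
    have fb0 : f i (set_val b) = 0 by apply/eqP; rewrite Ib.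
    have fb'0 : f i (set_val b') = 0 by apply/eqP; rewrite Ib'.
    by rewrite fb0 fb'0.
  have f0 y : connected_component (X `&` stratum I) x y -> f i y != 0.
    by move=> /sub[_ ->].
  by apply/idP/idP; exact: (connected_sign cC cf f0).
Qed.

Definition sublevel_function (i : 'I_N) (x : set_type X) : R :=
  Num.max (f i (set_val x)) 0.

Lemma sublevel_function0 i x : sublevel_function i x = 0 <-> f i (set_val x) <= 0.
Proof.
rewrite /sublevel_function; split=> [h|/max_r//].
by rewrite -h le_max lexx.
Qed.

(** The sign of [f i] is constant on a cell, so there the positive part is either 0 or [f i]. *)
Lemma sublevel_function_piecewise i :
  piecewise_regular (restricted_algebra A (X := X)) sign_cell (sublevel_function i).
Proof.
have cf := alg_set_val_continuous (X := X) hA (Af i).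
split=> [x|c]; first by apply: continuous_maxr0; exact: cf.
have cst k : restricted_algebra A (X := X) (fun=> k).
  by exists (fun=> k) => //; exact: (alg_cst hA).
case ci : ((c i).1 || (c i).2).
  exists (fun=> 0), (fun=> 1); split=> // x xc; split; first exact: oner_neq0.
  rewrite divr1; apply/sublevel_function0.
  by move: ci; rewrite -xc ffunE /= le_eqVlt orbC.
exists (fun x => f i (set_val x)), (fun=> 1); split=> //; first by exists (f i).
move=> x xc; split; first exact: oner_neq0.
rewrite divr1 /sublevel_function max_l //.
by move: ci; rewrite -xc ffunE /= orbC -le_eqVlt leNgt => /negbFE/ltW.
Qed.

Lemma sublevel_function_saturated i : saturated sign_cell (sublevel_function i).
Proof.
move=> x y xy /sublevel_function0 fx; apply/sublevel_function0.
have := congr1 (fun c : {ffun _} => (c i).1 || (c i).2) xy.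
by rewrite !ffunE /= orbC -le_eqVlt fx orbC -le_eqVlt => <-.
Qed.

End Strata.

Section Existence.
Context (R : realType) (K : scalar_kind) (V : funspace R) (A : set (V -> R)).
Hypothesis hA : coordinate_algebra A.
Local Notation F := (scalars R K).
Local Notation d := (real_dim K).
Local Notation rvc := (@real_vec_coord R K _).
Local Notation eqvar n q := (equivariant (@scalar_mx R K n) (@scalar_mx R K q)).
Context (X : set V).
Hypothesis cX : compact X.
Local Notation T := (set_type X).
Local Notation AT := (restricted_algebra A (X := X)).
Context (s : seq (V -> R)).
Local Notation f := (fun i : 'I_(size s) => nth (fun=> 0) s i).
Hypotheses (Hs : forall i, (i < size s)%N ->
    contracted_sublevel A X (nth (fun=> 0) s i))
  (cov : forall x, X x -> exists2 i, (i < size s)%N & nth (fun=> 0) s i x < 0).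

Lemma piecewise_bundle_exists (E : vfamily R K T) : locally_trivial E ->
  exists (n : nat) (xi : V -> submodClosed 'rV[F]_n),
  pw_bundle (strata f) X xi /\ top_isomorphic E (subfamily xi X).
Proof.
move=> lE; have cT := compact_set_type cX.
have hAT := @restricted_algebra_separating R V A X hA.
have FT := @cts_on_funring R T setT.
have Af i : A (f i) by have [] := Hs (ltn_ord i).
have [n0 [th hth]] := embedding_exists hAT cT lE.
have [lth ith cth] := hth.
pose W b := image_space (lth b).
have WE b v : v \in W b <-> exists w, th b w = v.
  by split=> [/asboolP|?]; last exact/asboolP.
have [pi [cpi piW]] := image_projection lE hth WE.
have opi b : orthproj (pi b) by case: (piW b).
have epi b : eqvar n0 n0 (pi b) by exact: is_proj_equivariant (piW b).
pose N := size s; pose n := (N * n0)%N.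
pose D i (x : T) : R := Num.max (nth (fun=> 0) s i (set_val x)) 0.
have [p [u [Sp Su pu]]] : exists (p : T -> 'M[R]_(n * d)) (u : T -> 'M[R]_(n0 * d, n * d)),
    [/\ mxfun (piecewise_regular AT (sign_cell f (X := X))) p,
      mxfun (piecewise_regular AT (sign_cell f (X := X))) u &
    forall x, [/\ orthproj (p x), eqvar n n (p x), eqvar n0 n (u x),
      \rank (p x) = \rank (pi x) & injective_on (pi x) (u x *m p x)]].
  apply: (piecewise_projection hAT cT (@scalar_conjK R K) (@scalar_mx_action R K n0)
    (@scalar_mx_action R K n) (@equivariantizeP R K n0 n) (@equivariantize_id R K n0 n)
    cpi opi epi (N := N) (D := D) (io := @block_mx_incl R K N n0)).
  - move=> i iN; split.
    + exact: (@sublevel_function_piecewise _ _ _ hA _ f Af X (Ordinal iN)).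
    + by move=> x; rewrite le_max lexx orbT.
    + exact: (@sublevel_function_saturated _ _ _ f X (Ordinal iN)).
    + have [P0 [oP0 eP0 iso]] := contracted_proj_iso hA cX (Hs iN) cpi
        (fun b => conj (opi b) (epi b)).
      exists P0; split=> //.
      suff -> : [set x | D i x = 0] = [set b : T | nth (fun=> 0) s i (set_val b) <= 0] by [].
      apply/seteqP; split=> b /= h.
        exact/(@sublevel_function0 _ _ _ f X (Ordinal iN) b).
      exact/(@sublevel_function0 _ _ _ f X (Ordinal iN) b).
  - move=> i iN; split; first exact/equivariant_realmx/block_incl_linear.
    by rewrite block_mx_incl_dot // eqxx.
  - move=> i j ij jN; rewrite block_mx_incl_dot ?(ltn_trans ij) //.
    by rewrite (ltn_eqF ij).
  - move=> x; have [i iN fi] := cov (set_mem (valP x)).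
    by exists i => //; rewrite /D max_r // ltW.
have cp : mxfun (cts_on setT) p by move=> i j; apply/cts_onT; case: (Sp i j).
have cu : mxfun (cts_on setT) u by move=> i j; apply/cts_onT; case: (Su i j).
pose xi x : submodClosed 'rV[F]_n := fixed_space (extend_by (0 : 'M[R]_(n * d)) p x).
have HP b : is_proj (p b) (xi (set_val b)).
  by rewrite /xi extend_byE; apply: fixed_space_proj; have [] := pu b.
exists n, xi; split.
  split; first exact: proj_locally_trivial cp HP.
  move=> S C SS CS; have [CX cC C0 Ccell] := component_sign_cell hA Af SS CS.
  apply: (cell_alg_bundle hA CX cC C0 cp HP) => i j.
  have [x0 Cx0] := C0; pose b0 : T := exist (fun x : V => x \in X) x0 (mem_set (CX x0 Cx0)).
  have [_ /(_ (sign_cell f b0))[_ [_ [[g Ag ->] [q Aq ->] pE]]]] := Sp i j.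
  exists g, q; split=> // b Cb.
  by apply: pE; exact: Ccell.
(* [u *m p] carries the image of [pi] onto that of [p], so the first embedding followed by it embeds
   [E] with image [xi]. *)
pose th' b (v : vf_fib E b) : 'rV[F]_n := coordmap (u b *m p b) (th b v).
have eup b : eqvar n0 n (u b *m p b).
  by have [_ ep eu _ _] := pu b; exact: equivariantM eu ep.
have thpi b v : rvc (th b v) *m pi b = rvc (th b v).
  by have [_ <-] := piW b; apply/WE; exists v.
have hth' : family_embedding th'.
  split.
  - by move=> b a v w; rewrite /th' lth (coordmap_linear (eup b)).
  - move=> b v w vw; apply: ith; apply: (@rvc_inj R K n0); apply/eqP.
    rewrite -subr_eq0; apply/eqP; have [_ _ _ _ iu] := pu b; apply: iu.
      by rewrite mulmxBl !thpi.
    by rewrite mulmxBl -!coordmapE -/(th' b v) vw subrr.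
  - move=> e; apply: (@sub_cts_mul R K V X _ _ _ setT (fun b => u b *m p b)
      (@vf_proj R K T E) (fun z => th _ (vf_vec z)) e openT) => //.
    + exact: (mxfunM FT).
    + exact: vf_proj_continuous.
    + exact: cth.
apply: (image_subfamily lE hth') => b v.
have [op ep eu rp iu] := pu b; have [_ pxi] := HP b; have [_ pp] := op.
split=> [/pxi vp|[w <-]]; last by apply/pxi; rewrite coordmapE -!mulmxA pp.
have [_ pipi] := opi b.
(* Surjectivity is a rank count: [pi *m u *m p] has its row space in that of [p], and the same
   rank. *)
have sub : (pi b *m (u b *m p b) <= p b)%MS by rewrite mulmxA submxMl.
have /andP[_ /submxP[B pB]] : (pi b *m (u b *m p b) == p b)%MS.
  by rewrite -(geq_leqif (mxrank_leqif_eq sub)) rp (injective_on_rank pipi iu).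
have [|w wE] := (WE b (coord_vec (rvc v *m B *m pi b))).1.
  by have [_ ->] := piW b; rewrite coord_vecK -mulmxA pipi.
exists w; apply: (@rvc_inj R K n); rewrite coordmapE wE coord_vecK.
by rewrite -[RHS]vp [in RHS]pB !mulmxA.
Qed.

End Existence.

Theorem theorem5p11 (R : realType) (K : scalar_kind) (V : funspace R)
    (X : set V) :
  real_variety V -> compact X -> locally_contractible R X ->
  exists SS : set (set V), stratification SS /\
    forall E : vfamily R K (set_type X), locally_trivial E ->
      exists (n : nat) (xi : V -> submodClosed 'rV[scalars R K]_n),
        [/\ pw_bundle SS X xi, top_isomorphic E (subfamily xi X) &
            forall (q : nat) (eta : V -> submodClosed 'rV[scalars R K]_q),
              pw_bundle SS X eta -> top_isomorphic E (subfamily eta X) ->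
              pw_isomorphic SS X xi eta].
Proof.
move=> rV cX lX; have [A hA] := coordinate_algebra_exists rV.
have [s [Hs cov]] := contractible_cover hA cX lX.
(* The strata are fixed before any bundle is given. *)
exists (strata (fun i : 'I_(size s) => nth (fun=> 0) s i)); split.
  by apply: (strata_stratification hA) => i; have [] := Hs i (ltn_ord i).
move=> E lE; have [n [xi [pwxi isoxi]]] := piecewise_bundle_exists hA cX Hs cov lE.
exists n, xi; split=> // q eta pweta isoeta.
apply: (pw_bundle_isomorphic hA cX pwxi pweta).
exact: top_isomorphic_span isoxi isoeta.
Qed.
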